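(* Let $(X_k,\overline{\nabla_x^i f}(X_k),\Sigma_k,S_k)_{k\ge 0}$ be generated by the StOFFAR$p$ algorithm described in the context. Suppose that: (i) $f$ is $p$ times continuously differentiable on $\mathbb{R}^n$; (ii) there is a constant $f_{\rm low}$ with $f(x)\ge f_{\rm low}$ for all $x\in\mathbb{R}^n$; (iii) there is a constant $L_p\ge 3$ with $\|\nabla_x^p f(x)-\nabla_x^p f(y)\|\le L_p\|x-y\|$ for all $x,y\in\mathbb{R}^n$; (iv) if $p>1$, there is a constant $\kappa_{\rm high}\ge 0$ with $\min_{\|d\|\le 1}\overline{\nabla_x^i f}(x)[d]^i\ge-\kappa_{\rm high}$ for all $x\in\mathbb{R}^n$ and $i\in\{2,\ldots,p\}$ (and $\kappa_{\rm high}=0$ if $p=1$); (v) there is a constant $\kappa_D\ge 0$ such that, for every $k\ge 0$ and every $i\in\{1,\ldots,p\}$, $\mathbb{E}_k\big[\|\nabla_x^i f(X_k)-\overline{\nabla_x^i f}(X_k)\|^{\frac{p+1}{p+1-i}}\big]\le\kappa_D\,\xi_k$. Then, for all $k\ge 0$, $$\min_{j\in\{0,\ldots,k\}}\mathbb{E}\big[\|G_{j+1}\|\big]\le(\kappa_c+\kappa_d m)^{\frac{p}{p+1}}\,\frac{\sigma_{\max}}{(k+1)^{\frac{p}{p+1}}},$$ where $\kappa_c,\kappa_d,\sigma_{\max}$ are the explicit constants defined in the context.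
   Context: Setting. Fix integers $p,n,m\ge 1$, constants $\sigma_0>0$, $\theta_1>1$, and $f:\mathbb{R}^n\to\mathbb{R}$. $\|\cdot\|$ is the Euclidean norm for vectors and the associated subordinate norm for tensors; $T[d]^i$ is the $i$-tensor $T$ applied to $i$ copies of $d$. StOFFAR$p$ algorithm (generating a stochastic process on a probability space): start from a (possibly random) $X_0\in\mathbb{R}^n$ and deterministic $\Sigma_0=\sigma_0$. At each iteration $k=0,1,2,\ldots$: (1) random approximations $\overline{\nabla_x^i f}(X_k)$ of $\nabla_x^i f(X_k)$, $i=1,\ldots,p$, are evaluated. (2) With $\overline{T_{f,p}}(x,s)=f(x)+\sum_{i=1}^p\frac{1}{i!}\overline{\nabla_x^i f}(x)[s]^i$ and $m_k(s)=\overline{T_{f,p}}(X_k,s)+\frac{\Sigma_k}{(p+1)!}\|s\|^{p+1}$, a step $S_k$ is computed such that $m_k(S_k)-m_k(0)\le 0$ and $\|\overline{\nabla_s^1T_{f,p}}(X_k,S_k)\|\le\theta_1\frac{\Sigma_k}{p!}\|S_k\|^p$, where $\overline{\nabla_s^1T_{f,p}}$ is the gradient of $\overline{T_{f,p}}$ with respect to $s$. (3) $X_{k+1}=X_k+S_k$ and $\Sigma_{k+1}=\Sigma_k+\Sigma_k\|S_k\|^{p+1}$. Notation. $G_k=\nabla_x^1 f(X_k)$, $\overline{G}_k=\overline{\nabla_x^1 f}(X_k)$. $\mathbb{E}$ is expectation and $\mathbb{E}_k$ is conditional expectation given $\{\overline{\nabla_x^i f}(X_j): 1\le i\le p,\ 0\le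 j\le k-1\}$; $\Sigma_k$ and $S_j$ ($j<k$) are measurable with respect to this conditioning. $\xi_k=\sum_{i=1}^m\|S_{k-i}\|^{p+1}$, with conventions $\|S_{-1}\|=\cdots=\|S_{-m}\|=1$ and $\Sigma_j=\sigma_0/2^{-j}$ for $j\in\{-m,\ldots,-1\}$. All expectations written are understood to be well defined, with $\mathbb{E}[f(X_0)]$ and $\mathbb{E}[\|G_0\|^{\frac{p+1}{p}}]$ finite. Constants. $\chi_p^1=\sum_{i=1}^p\frac{i}{i!(p+1)}$, $\chi_p^2=\sum_{i=1}^p\frac{p+i-1}{i!(p+1)}$, $\kappa_p=(2p)^{1/p}$, $\chi_p^3=\sum_{i=2}^p\Big(\frac{i-1}{(i-1)!\,p}\Big)^{\frac{p+1}{p}}$, $\chi_p^4=1+\sum_{i=2}^p\Big(\frac{p-i+1}{(i-1)!\,p}\Big)^{\frac{p+1}{p}}$, $\kappa_a=\frac{L_p}{(p+1)!}+\chi_p^1$, $\kappa_b=\kappa_p\Big(\big(\frac{L_p}{p!}\big)^{\frac{p+1}{p}}+\chi_p^3\Big)$, $\kappa_c=\frac{2^{1/p}}{\sigma_0^{(p+1)/p}}\Big(\kappa_b+\frac{\theta_1^{(p+1)/p}}{(p!)^{(p+1)/p}}\sigma_0^{\frac{p+1}{p}}\Big)$, $\kappa_d=\frac{2^{\frac{mp+1}{p}}\kappa_p\kappa_D\chi_p^4}{\sigma_0^{(p+1)/p}}$, $\eta=\max_{i\in\{2,\ldots,p\}}\Big[\frac{\kappa_{\rm high}(p+1)!}{i!\,\sigma_0}\Big]^{\frac{1}{p-i+1}}$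 if $p>1$, $\eta=0$ if $p=1$, $$\begin{aligned}\kappa_e=\;&2^{p+1}((p+1)!)^{\frac{p+1}{p}}\Big(2^{\frac1p}\,\frac{m\kappa_D+\mathbb{E}[\|G_0\|^{\frac{p+1}{p}}]}{\sigma_0^{(p+1)/p}}+2^{\frac1p}\kappa_d\,m\big(\tfrac{m+1}{2}\log 2-\log\sigma_0\big)-2^{\frac1p}\kappa_c\log\sigma_0\\&+\frac{\kappa_D2^{\frac{mp+2}{p}}m}{\sigma_0^{(p+1)/p}}\big(\tfrac{m-1}{2}\log 2-\log\sigma_0\big)\Big)-(1+2^{p+1}\eta^{p+1})\log\sigma_0,\end{aligned}$$ $$\kappa_f=1+2^{p+1}\eta^{p+1}+2^{p+1}((p+1)!)^{\frac{p+1}{p}}\Big(\frac{2^{\frac{mp+2}{p}}m\kappa_D(1+\chi_p^4\kappa_p)}{\sigma_0^{(p+1)/p}}+2^{\frac1p}\kappa_c\Big),$$ $\Gamma_0=\mathbb{E}[f(X_0)-f_{\rm low}]$, $$\kappa_g=\frac{\Gamma_0+\frac{\sigma_0}{(p+1)!}+\kappa_a\kappa_e+m\kappa_D\chi_p^2\big(\frac{m+1}{2}+\kappa_e\big)}{\kappa_a\kappa_f+m\kappa_D\chi_p^2\kappa_f},$$ $$\sigma_{\max}=-(p+1)!\,(\kappa_a\kappa_f+m\kappa_D\chi_p^2\kappa_f)\,W_{-1}\!\left(\frac{-e^{-\kappa_g}}{(p+1)!\,(\kappa_a\kappa_f+m\kappa_D\chi_p^2\kappa_f)}\right),$$ where $W_{-1}$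 is the lower real branch of the Lambert function. *)

(* Defs.v *)
From HB Require Import structures.
From mathcomp Require Import all_boot all_order all_algebra.
From mathcomp Require Import all_classical all_reals all_analysis measurable_realfun.

Set Implicit Arguments.
Unset Strict Implicit.
Unset Printing Implicit Defensive.

Import Order.TTheory GRing.Theory Num.Theory.
Import numFieldNormedType.Exports.

Local Open Scope classical_set_scope.
Local Open Scope ring_scope.

(* The library norm `|v| on 'rV[R]_n is the max norm, hence this one; the
   topology, and therefore differentiability, is the same for both. *)
Definition enorm (R : realType) (n : nat) (v : 'rV[R]_n) : R :=
  Num.sqrt (\sum_(j < n) v 0 j ^+ 2).

(* An i-tensor on R^n is given by its n^i coordinates in the canonical basis;
   symmetry is not required. *)
Notation tensor R n i := {ffun i.-tuple 'I_n -> R}.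

Definition tapp (R : realType) (n i : nat) (A : tensor R n i)
    (v : 'I_i -> 'rV[R]_n) : R :=
  \sum_(J : i.-tuple 'I_n) A J * \prod_(l < i) v l 0 (tnth J l).

Definition tpow (R : realType) (n i : nat) (A : tensor R n i)
    (d : 'rV[R]_n) : R :=
  tapp A (fun=> d).

(* Norm subordinate to the Euclidean norm: the maximum of |A[v_1, ..., v_i]|
   over Euclidean unit vectors v_1, ..., v_i. *)
Definition tnorm (R : realType) (n i : nat) (A : tensor R n i) : R :=
  sup [set `|tapp A v| | v in [set v : 'I_i -> 'rV[R]_n |
                                forall l, enorm (v l) = 1]].

Fixpoint partials (R : realType) (n : nat) (f : 'rV[R]_n -> R) (J : seq 'I_n) :
    'rV[R]_n -> R :=
  if J is j :: J' then 'D_(delta_mx 0 j) (partials f J') else f.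

Definition dtensor (R : realType) (n : nat) (f : 'rV[R]_n -> R) (i : nat)
    (x : 'rV[R]_n) : tensor R n i :=
  [ffun J : i.-tuple 'I_n => partials f J x].

Definition grad (R : realType) (n : nat) (f : 'rV[R]_n -> R) (x : 'rV[R]_n) :
    'rV[R]_n :=
  \row_j 'D_(delta_mx 0 j) f x.

(* Fréchet differentiability is required because 'D_v is total: a directional
   derivative which does not exist has an arbitrary value. *)
Definition class_C (R : realType) (n p : nat) (f : 'rV[R]_n -> R) : Prop :=
  (forall J : seq 'I_n, (size J < p)%N ->
     forall x, differentiable (partials f J) x) /\
  (forall J : seq 'I_n, (size J <= p)%N -> continuous (partials f J)).

Section Algorithm.
Context (R : realType) (n p : nat) (f : 'rV[R]_n -> R).

Definition taylor (A : forall i : nat, tensor R n i) (x s : 'rV[R]_n) : R :=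
  f x + \sum_(1 <= i < p.+1) (i`!%:R)^-1 * tpow (A i) s.

Definition model (A : forall i : nat, tensor R n i) (sigma : R)
    (x s : 'rV[R]_n) : R :=
  taylor A x s + sigma / (p.+1)`!%:R * enorm s ^+ p.+1.

Context (d : measure_display) (T : measurableType d) (P : probability T R).

(* Generators of the sigma-algebra conditioning E_k. *)
Definition past (A : forall i : nat, nat -> T -> tensor R n i) (k : nat) :
    set (set T) :=
  [set C | exists i j (J : i.-tuple 'I_n) (B : set R),
    [/\ (1 <= i <= p)%N, (j < k)%N, measurable B
      & C = (fun w => A i j w J) @^-1` B]].

(* Measurability with respect to <<s F >>. *)
Definition wrt (F : set (set T)) (d' : measure_display)
    (U : measurableType d') (g : T -> U) : Prop :=
  @measurable_fun _ _ (g_sigma_algebraType F) U setT g.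

(* Z is a version of E[Y | <<s F >>], for a nonnegative random variable Y. *)
Definition is_condexp (F : set (set T)) (Y : T -> R) (Z : T -> \bar R) : Prop :=
  [/\ measurable_fun setT Y /\ (forall w, 0 <= Y w),
      wrt F Z,
      (forall w, (0 <= Z w)%E)
    & forall C : set T, <<s F >> C ->
        (\int[P]_(w in C) Z w = \int[P]_(w in C) (Y w)%:E)%E].

Definition condexp_le (F : set (set T)) (Y B : T -> R) : Prop :=
  exists2 Z : T -> \bar R, is_condexp F Y Z
    & {ae P, forall w, (Z w <= (B w)%:E)%E}.

(* Runs of the algorithm; A i k is the approximation of the i-th derivative
   of f at X k. *)
Record StOFFAR (sigma0 theta1 : R) (X : nat -> T -> 'rV[R]_n)
    (A : forall i : nat, nat -> T -> tensor R n i)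
    (Sigma : nat -> T -> R) (S : nat -> T -> 'rV[R]_n) : Prop := MkStOFFAR {
  initial_point_measurable :
    forall l, measurable_fun setT (fun w => X 0%N w 0 l);
  approximations_measurable :
    forall i k (J : i.-tuple 'I_n), (1 <= i <= p)%N ->
      measurable_fun setT (fun w => A i k w J);
  initial_weight : forall w, Sigma 0%N w = sigma0;
  step_decrease : forall k w,
    model (A ^~ k ^~ w) (Sigma k w) (X k w) (S k w)
      - model (A ^~ k ^~ w) (Sigma k w) (X k w) 0 <= 0;
  step_gradient : forall k w,
    enorm (grad (taylor (A ^~ k ^~ w) (X k w)) (S k w))
      <= theta1 * (Sigma k w / p`!%:R) * enorm (S k w) ^+ p;
  next_point : forall k w, X k.+1 w = X k w + S k w;
  next_weight : forall k w,
    Sigma k.+1 w = Sigma k w + Sigma k w * enorm (S k w) ^+ p.+1;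
  weight_measurable : forall k, wrt (past A k) (Sigma k);
  step_measurable : forall k j l, (j < k)%N ->
    wrt (past A k) (fun w => S j w 0 l)
}.

(* Steps with a negative index have norm 1 by convention. *)
Definition past_step_norm (S : nat -> T -> 'rV[R]_n) (k i : nat) (w : T) : R :=
  if (i <= k)%N then enorm (S (k - i)%N w) else 1.

Definition xi (m : nat) (S : nat -> T -> 'rV[R]_n) (k : nat) (w : T) : R :=
  \sum_(1 <= i < m.+1) past_step_norm S k i w ^+ p.+1.

End Algorithm.

(* Junk value 0 when x is outside [-1/e, 0[. *)
Definition lambertWm1 (R : realType) (x : R) : R :=
  xget 0 [set w : R | w <= -1 /\ w * expR w = x].

Section Constants.
Context (R : realType) (p m : nat) (sigma0 theta1 Lp khigh kD : R).

Local Notation pR := (p%:R : R).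
Local Notation mR := (m%:R : R).
Local Notation q := (p.+1%:R / p%:R : R).
Local Notation fact1 := ((p.+1)`!%:R : R).

Definition chi1 : R :=
  \sum_(1 <= i < p.+1) i%:R / (i`!%:R * p.+1%:R).

Definition chi2 : R :=
  \sum_(1 <= i < p.+1) (p + i - 1)%:R / (i`!%:R * p.+1%:R).

Definition chi3 : R :=
  \sum_(2 <= i < p.+1) ((i - 1)%:R / ((i - 1)`!%:R * pR)) `^ q.

Definition chi4 : R :=
  1 + \sum_(2 <= i < p.+1) ((p - i + 1)%:R / ((i - 1)`!%:R * pR)) `^ q.

Definition kappa_p : R := (2 * pR) `^ pR^-1.

Definition kappa_a : R := Lp / fact1 + chi1.

Definition kappa_b : R := kappa_p * ((Lp / p`!%:R) `^ q + chi3).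

Definition kappa_c : R :=
  2 `^ pR^-1 / sigma0 `^ q
    * (kappa_b + theta1 `^ q / p`!%:R `^ q * sigma0 `^ q).

Definition kappa_d : R :=
  2 `^ ((mR * pR + 1) / pR) * kappa_p * kD * chi4 / sigma0 `^ q.

(* All terms are nonnegative, so that the default value 0 is harmless for
   1 < p and gives the conventional value for p = 1. *)
Definition eta : R :=
  \big[Num.max/0]_(2 <= i < p.+1)
    (khigh * fact1 / (i`!%:R * sigma0)) `^ (p - i + 1)%:R^-1.

(* EG0 stands for E[ |G_0|^((p+1)/p) ]. *)
Definition kappa_e (EG0 : R) : R :=
  2 ^+ p.+1 * fact1 `^ q
    * (2 `^ pR^-1 * ((mR * kD + EG0) / sigma0 `^ q)
       + 2 `^ pR^-1 * kappa_d * mR * ((mR + 1) / 2 * ln 2 - ln sigma0)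
       - 2 `^ pR^-1 * kappa_c * ln sigma0
       + kD * 2 `^ ((mR * pR + 2) / pR) * mR / sigma0 `^ q
           * ((mR - 1) / 2 * ln 2 - ln sigma0))
  - (1 + 2 ^+ p.+1 * eta ^+ p.+1) * ln sigma0.

Definition kappa_f : R :=
  1 + 2 ^+ p.+1 * eta ^+ p.+1
  + 2 ^+ p.+1 * fact1 `^ q
    * (2 `^ ((mR * pR + 2) / pR) * mR * kD * (1 + chi4 * kappa_p) / sigma0 `^ q
       + 2 `^ pR^-1 * kappa_c).

Definition kappa_af : R := kappa_a * kappa_f + mR * kD * chi2 * kappa_f.

(* Gamma0 stands for E[f(X_0) - f_low]. *)
Definition kappa_g (EG0 Gamma0 : R) : R :=
  (Gamma0 + sigma0 / fact1 + kappa_a * kappa_e EG0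
     + mR * kD * chi2 * ((mR + 1) / 2 + kappa_e EG0)) / kappa_af.

Definition sigma_max (EG0 Gamma0 : R) : R :=
  - (fact1 * kappa_af
       * lambertWm1 (- expR (- kappa_g EG0 Gamma0) / (fact1 * kappa_af))).

End Constants.

(* Main.v *)
(* Along a run the weights satisfy Sigma_(k+1) = Sigma_k (1 + |S_k|^(p+1)), so the
   relative increments 1 - Sigma_k / Sigma_(k+1) telescope into ln Sigma, while
   the absolute ones telescope into Sigma. Taylor's formula, Young's inequality
   and the conditional error bounds control |G_(k+1)|^((p+1)/p) / Sigma_(k+1)^q,
   in mean, by relative increments if q = (p+1)/p and by absolute increments if
   q = 1/p. With q = (p+1)/p and the bound on the step length (Lagrange's bound
   on the roots of the model polynomial), the mean of the sum of the
   |S_j|^(p+1) is at most affine in ln E[Sigma_(k+1)] (Jensen); summing the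
   decrease of f then gives E[Sigma_(k+1)] <= C (g + ln E[Sigma_(k+1)]), which
   the branch W_(-1) solves: E[Sigma_(k+1)] <= sigma_max. With q = 1/p the sum
   over j <= k of the means of |G_(j+1)|^((p+1)/p) / Sigma_(j+1)^(1/p) is at most
   (kappa_c + kappa_d m) sigma_max, so one of the terms is at most that divided
   by k + 1, and Hölder's inequality removes the weight. *)

Require Import Defs.
From HB Require Import structures.
From mathcomp Require Import all_boot all_order all_algebra.
From mathcomp Require Import all_classical all_reals all_analysis measurable_realfun.
From mathcomp Require Import perm ring lra zify.

Import Order.TTheory GRing.Theory Num.Theory.
Import numFieldNormedType.Exports.

Local Open Scope classical_set_scope.
Local Open Scope ring_scope.

Set Implicit Arguments.
Unset Strict Implicit.
Unset Printing Implicit Defensive.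

(** * Real inequalities *)

(** Two obstacles shape the estimates. First, S_k depends on the approximations at iteration k, so
    Sigma_(k+1) is not determined by the past of iteration k: the conditional error bounds can be
    weighted only by powers of Sigma_k, and monotonicity of the weights replaces Sigma_(k+1) by
    Sigma_k in the error terms. The window xi_k contains only steps before iteration k, whose
    increments are complete at Sigma_k; the conventional weights sigma0 / 2^i extend the recursion
    backwards with steps of norm 1, at the cost of a factor 2^m. Second, the bound on |S_k| contains
    the constant eta, whose sum over k is linear in k and would leave the weights unbounded. With U
    = 1 - Sigma_k / Sigma_(k+1) one has |S_k|^(p+1) = U (1 + |S_k|^(p+1)); inserting the bound on
    the right multiplies eta by U, whose sum is only logarithmic. The gradient in that bound is
    controlled through the preceding step. No moment of Sigma_k is assumed finite, so means are
    compared in the extended reals, and U <= 1 gives finiteness before the logarithmic argument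
    starts. *)

Lemma ln_le_subr1 (R : realType) (x : R) : 0 < x -> ln x <= x - 1.
Proof.
move=> x0; rewrite -[in leLHS](subrK 1 x) (addrC _ 1); apply: le_ln1Dx.
by rewrite ltrBrDl subrr.
Qed.

Lemma young_exprn (R : realType) (N a : nat) (D s : R) : (0 < a < N)%N ->
  0 <= D -> 0 <= s ->
  D * s ^+ a <= a%:R / N%:R * s ^+ N
                + (N - a)%:R / N%:R * D `^ (N%:R / (N - a)%:R).
Proof.
move=> /andP[a0 aN] D0 s0.
have N0 : (0 : R) < N%:R by rewrite ltr0n; apply: leq_ltn_trans aN.
have a0' : (0 : R) < a%:R by rewrite ltr0n.
have Na0 : (0 : R) < (N - a)%:R by rewrite ltr0n subn_gt0.
have NE : N%:R = (N - a)%:R + a%:R :> R by rewrite -natrD subnK// ltnW.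
have := @conjugate_powR R D (s ^+ a) (N%:R / (N - a)%:R) (N%:R / a%:R) D0.
move=> /(_ (exprn_ge0 _ s0)) /(_ (divr_gt0 N0 Na0)) /(_ (divr_gt0 N0 a0')).
rewrite !invf_div => /(_ _)/le_trans; apply.
  by rewrite -mulrDl -NE divff// gt_eqF.
rewrite addrC; apply: lerD; last by rewrite mulrC.
have -> : (s ^+ a) `^ (N%:R / a%:R) = s ^+ N.
  rewrite -!powR_mulrn// -powRrM; congr (_ `^ _).
  by rewrite mulrCA divff ?mulr1// gt_eqF.
by rewrite mulrC.
Qed.

(** Young's inequality against the power q - 1 of the mean [b] of the terms is the tangent line of
    the q-th power at [b]; summing these lines gives the bound. *)
Lemma power_mean (R : realType) (I : Type) (r : seq I) (F : I -> R) (q : R) :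
  1 < q -> (forall i, 0 <= F i) ->
  (\sum_(i <- r) F i) `^ q
    <= (size r)%:R `^ (q - 1) * \sum_(i <- r) F i `^ q.
Proof.
move=> q1 F0; have q0 : 0 < q by apply: lt_trans q1.
case: (posnP (size r)) => [/size0nil ->|r0].
  by rewrite !big_nil powR0 ?gt_eqF// mulr0.
have N0 : 0 < (size r)%:R :> R by rewrite ltr0n.
set N := (size r)%:R in N0 *; set s := \sum_(i <- r) F i.
have s0 : 0 <= s by apply: sumr_ge0.
pose b := s / N; have b0 : 0 <= b by rewrite divr_ge0// ltW.
have q' : 0 < q / (q - 1) by rewrite divr_gt0// subr_gt0.
have tangent i : F i * b `^ (q - 1) <= F i `^ q / q + (q - 1) / q * b `^ q.
  have := conjugate_powR (F0 i) (powR_ge0 b (q - 1)) q0 q'.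
  rewrite -powRrM mulrCA divff ?gt_eqF ?subr_gt0// mulr1 invf_div.
  rewrite [_ / q * b `^ q]mulrC; apply.
  by field; rewrite gt_eqF.
have : s * b `^ (q - 1)
    <= (\sum_(i <- r) F i `^ q) / q + (q - 1) / q * b `^ q * N.
  rewrite mulr_suml (le_trans (ler_sum _ (fun i _ => tangent i)))//.
  rewrite big_split/= -mulr_suml lerD2l.
  by rewrite big_const_seq count_predT iter_addr_0 -mulr_natr.
have sE : s = N * b by rewrite /b mulrCA divff ?mulr1// gt_eqF.
rewrite {1}sE -mulrA mulr_powRB1// => H.
have {H} : N * b `^ q <= \sum_(i <- r) F i `^ q.
  have -> : N * b `^ q = q * (N * b `^ q - (q - 1) / q * b `^ q * N).
    by field; rewrite gt_eqF.
  have -> : \sum_(i <- r) F i `^ q = q * ((\sum_(i <- r) F i `^ q) / q).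
    by field; rewrite gt_eqF.
  by rewrite ler_pM2l// lerBlDr.
have NN : N `^ (q - 1) * N = N `^ q by rewrite mulrC mulr_powRB1// ltW.
rewrite sE powRM ?(ltW N0)// -NN -mulrA => H.
by rewrite ler_wpM2l ?powR_ge0.
Qed.

Lemma power_mean2 (R : realType) (x y q : R) : 1 < q -> 0 <= x -> 0 <= y ->
  (x + y) `^ q <= 2 `^ (q - 1) * (x `^ q + y `^ q).
Proof.
move=> q1 x0 y0.
have := @power_mean R bool [:: true; false] (fun b => if b then x else y) q q1.
rewrite /= !big_cons !big_nil !addr0; apply.
by case.
Qed.

Lemma weighted_am_gm (R : realType) (x y a : R) : 0 < a < 1 -> 0 <= x -> 0 <= y ->
  x `^ a * y `^ (1 - a) <= a * x + (1 - a) * y.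
Proof.
move=> /andP[a0 a1] x0 y0; have b0 : 0 < 1 - a by rewrite subr_gt0.
have ai : 0 < a^-1 by rewrite invr_gt0.
have bi : 0 < (1 - a)^-1 by rewrite invr_gt0.
have := conjugate_powR (powR_ge0 x a) (powR_ge0 y (1 - a)) ai bi.
rewrite -!powRrM !divff ?gt_eqF// !powRr1// !invrK => /(_ _)/le_trans; apply.
  by rewrite addrC subrK.
by rewrite (mulrC a) (mulrC (1 - a)).
Qed.

(* Lagrange's bound on the positive roots of a polynomial. *)
Lemma root_bound (R : realType) (p : nat) (r M : R) : 0 <= M -> (0 < p)%N ->
  r ^+ p <= \sum_(1 <= i < p.+1) M ^+ (p - i + 1) * r ^+ (i - 1) -> r <= 2 * M.
Proof.
move=> M0 p0 H; rewrite leNgt; apply/negP => Mr.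
have r0 : 0 < r by apply: le_lt_trans Mr; rewrite mulr_ge0.
(* [s] is the cofactor in [r ^+ p - M ^+ p = (r - M) * s], and the right-hand side of the hypothesis
   is [M * s]. If [2 * M < r], then [M * s < (r - M) * s], so [r ^+ p] would be less than
   [r ^+ p - M ^+ p]. *)
pose s := \sum_(i < p) r ^+ (p.-1 - i) * M ^+ i.
have s0 : 0 < s.
  rewrite /s -(prednK p0) big_ord_recl/= subn0 mulr1 ltr_pwDl ?exprn_gt0//.
  by apply: sumr_ge0 => i _; rewrite mulr_ge0 ?exprn_ge0// ltW.
have sE : \sum_(1 <= i < p.+1) M ^+ (p - i + 1) * r ^+ (i - 1) = M * s.
  rewrite big_add1/= big_mkord (reindex_inj rev_ord_inj)/= /s mulr_sumr.
  apply: eq_bigr => i _; rewrite mulrC mulrCA -exprS; congr (_ ^+ _ * _ ^+ _).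
    by rewrite subn1/=; case: p p0 i {H s s0} => // p' _ i; rewrite subSS.
  by rewrite subnSK// subKn ?addn1// ltnW.
move: H; rewrite sE => H.
have : M * s < (r - M) * s by rewrite ltr_pM2r// ltrBrDr; lra.
rewrite -subrXX => H2; have := le_lt_trans H H2.
by rewrite ltrBrDr gtrDl ltNge exprn_ge0.
Qed.

Lemma lambertWm1P (R : realType) (z : R) : - expR (- 1) <= z < 0 ->
  lambertWm1 z <= -1 /\ lambertWm1 z * expR (lambertWm1 z) = z.
Proof.
move=> /andP[ez z0]; rewrite /lambertWm1.
suff : exists w : R, w <= -1 /\ w * expR w = z.
  by case=> w /= hw; apply: (@xgetPex _ 0 [set w | w <= -1 /\ w * expR w = z]); exists w.
(* Since [expR N] is at least [(N / 2) ^+ 2], the term [- (4 / z)] makes [- N * expR (- N)] at least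
   [z], so a root lies between [- N] and -1. *)
pose N : R := Num.max 1 (- (4 / z)).
have N1 : 1 <= N by rewrite le_max lexx.
have Nz : - (4 / z) <= N by rewrite le_max lexx orbT.
have N0 : 0 < N by apply: lt_le_trans N1.
have hN : z <= - N * expR (- N).
  rewrite expRN mulNr lerNr ler_pdivrMr ?expR_gt0//.
  have e1 : (N / 2) ^+ 2 <= expR N.
    have -> : expR N = expR (N / 2) ^+ 2 by rewrite expr2 -expRD -splitr.
    have N20 : 0 <= N / 2 by rewrite divr_ge0// ltW.
    rewrite lerXn2r// ?nnegrE ?expR_ge0//.
    by apply: le_trans (expR_ge1Dx _); rewrite lerDr.
  apply: (@le_trans _ _ (- z * (N / 2) ^+ 2)); last first.
    by rewrite ler_wpM2l// oppr_ge0 ltW.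
  have -> : - z * (N / 2) ^+ 2 = N * (- z * N / 4) by field.
  rewrite ler_peMr ?(ltW N0)// ler_pdivlMr// mul1r.
  have -> : 4 = - z * - (4 / z) by field; rewrite lt_eqF.
  by rewrite ler_wpM2l// oppr_ge0 ltW.
have [|||c] := @IVT R (fun w => w * expR w) (- N) (-1) z.
- by rewrite lerN2.
- apply: continuous_subspaceT => x; apply: cvgM; first exact: cvg_id.
  exact: continuous_expR.
- rewrite ge_min le_max hN mulN1r.
  by rewrite ez orbT.
by rewrite in_itv/= => /andP[_ c1] <-; exists c.
Qed.

(** For [w = - (y / C)] the hypothesis reads [w * expR w <= z]. As [w * expR w] is never below -1/e,
    [z] lies in the domain of the branch. The map t e^t is strictly decreasing up to -1, so [w]
    cannot lie to the left of the branch value [W]. *)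
Lemma lambertWm1_bound (R : realType) (y C g : R) : 0 < y -> 0 < C ->
  y <= C * (g + ln y) -> y <= - (C * lambertWm1 (- expR (- g) / C)).
Proof.
move=> y0 C0 H; set z := - expR (- g) / C.
have z0 : z < 0 by rewrite /z mulNr oppr_lt0 divr_gt0 ?expR_gt0.
pose w := - (y / C).
have wz : w * expR w <= z.
  rewrite /w /z !mulNr lerN2 mulrAC ler_pM2r ?invr_gt0//.
  rewrite -[X in _ <= X * _](@lnK _ y) ?posrE// -expRD ler_expR.
  have : y / C <= g + ln y by rewrite ler_pdivrMr// mulrC.
  lra.
have ew : - expR (- 1) <= w * expR w.
  rewrite lerNl -mulNr /w opprK -ler_pdivlMr ?expR_gt0// -expRN opprK -expRD.
  by apply: le_trans (expR_ge1Dx _); rewrite addrA addrN add0r.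
have [W1 WE] : lambertWm1 z <= -1 /\ lambertWm1 z * expR (lambertWm1 z) = z.
  by apply: lambertWm1P; rewrite z0 (le_trans ew).
set W := lambertWm1 z in W1 WE *.
suff Ww : W <= w by rewrite -mulrN mulrC -ler_pdivrMr// lerNr.
rewrite leNgt; apply/negP => wW; move: wz; rewrite -WE leNgt => /negP; apply.
have WwE : expR W = expR (W - w) * expR w by rewrite -expRD subrK.
rewrite WwE mulrA ltr_pM2r ?expR_gt0//.
have d0 : 0 < W - w by rewrite subr_gt0.
have : 1 + (W - w) < expR (W - w) by apply: expR_gt1Dx; rewrite gt_eqF.
set e := expR _ => he.
have : W * e < W * (1 + (W - w)) by rewrite ltr_nM2l//; lra.
move/lt_le_trans; apply.
have : 0 <= (-1 - W) * (W - w) by rewrite mulr_ge0 ?(ltW d0)// subr_ge0.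
lra.
Qed.

(** * Euclidean norm and tensors *)

Section EuclideanNorm.
Context (R : realType) (n : nat).
Implicit Types u v : 'rV[R]_n.

Lemma enorm_ge0 v : 0 <= enorm v. Proof. exact: sqrtr_ge0. Qed.

Lemma enorm_sqr v : enorm v ^+ 2 = \sum_(j < n) v 0 j ^+ 2.
Proof. by rewrite sqr_sqrtr// sumr_ge0// => j _; rewrite sqr_ge0. Qed.

Lemma enorm0 : enorm (0 : 'rV[R]_n) = 0.
Proof.
by rewrite /enorm big1 ?sqrtr0// => j _; rewrite mxE expr0n.
Qed.

Lemma enorm_eq0 v : enorm v = 0 -> v = 0.
Proof.
move=> v0; have : \sum_(j < n) v 0 j ^+ 2 == 0 by rewrite -enorm_sqr v0 expr0n.
rewrite psumr_eq0 => [/allP h|j _]; last exact: sqr_ge0.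
apply/rowP => j; rewrite mxE; apply/eqP.
by have := h j (mem_index_enum _); rewrite /= expf_eq0.
Qed.

Lemma enormZ (c : R) v : enorm (c *: v) = `|c| * enorm v.
Proof.
rewrite /enorm -sqrtr_sqr -sqrtrM ?sqr_ge0// mulr_sumr.
by congr Num.sqrt; apply: eq_bigr => j _; rewrite mxE exprMn.
Qed.

Lemma enormN v : enorm (- v) = enorm v.
Proof. by rewrite -scaleN1r enormZ normrN normr1 mul1r. Qed.

Lemma coord_le_enorm v j : `|v 0 j| <= enorm v.
Proof.
rewrite -sqrtr_sqr ler_wsqrtr// (bigD1 j)//= lerDl sumr_ge0// => i _.
exact: sqr_ge0.
Qed.

Lemma cauchy_schwarz u v : \sum_j u 0 j * v 0 j <= enorm u * enorm v.
Proof.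
have [/eqP|u0] := eqVneq (enorm u) 0.
  move=> /eqP/enorm_eq0 ->; rewrite enorm0 mul0r big1// => j _.
  by rewrite mxE mul0r.
have [/eqP|v0] := eqVneq (enorm v) 0.
  move=> /eqP/enorm_eq0 ->; rewrite enorm0 mulr0 big1// => j _.
  by rewrite mxE mulr0.
set a := enorm u; set b := enorm v; set s := \sum_j _.
have ab0 : 0 < a * b by rewrite mulr_gt0// lt_neqAle enorm_ge0 eq_sym ?u0 ?v0.
have : 0 <= \sum_j (b * u 0 j - a * v 0 j) ^+ 2.
  by apply: sumr_ge0 => j _; rewrite sqr_ge0.
have -> : \sum_j (b * u 0 j - a * v 0 j) ^+ 2 = 2 * (a * b) * (a * b - s).
  transitivity (\sum_j (b ^+ 2 * u 0 j ^+ 2 + a ^+ 2 * v 0 j ^+ 2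
                        - 2 * (a * b) * (u 0 j * v 0 j))).
    by apply: eq_bigr => j _; ring.
  rewrite sumrB big_split/= -!mulr_sumr -!enorm_sqr -/a -/b -/s; ring.
by rewrite pmulr_rge0 ?subr_ge0// mulr_gt0.
Qed.

Lemma enormD u v : enorm (u + v) <= enorm u + enorm v.
Proof.
rewrite -(@ler_pXn2r _ 2)// ?nnegrE ?addr_ge0 ?enorm_ge0// enorm_sqr sqrrD.
rewrite !enorm_sqr.
have -> : \sum_j (u + v) 0 j ^+ 2 =
    \sum_j u 0 j ^+ 2 + (\sum_j u 0 j * v 0 j) *+ 2 + \sum_j v 0 j ^+ 2.
  rewrite -sumrMnl -!big_split/=; apply: eq_bigr => j _.
  by rewrite mxE sqrrD.
by rewrite lerD2r lerD2l lerMn2r/= cauchy_schwarz.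
Qed.

(** Gradient estimates go through this dual form: the product of a Taylor gradient with a direction
    is a sum of tensor applications, to which the subordinate norm applies. *)
Lemma enorm_le_dual (c : R) v : 0 <= c ->
  (forall u, \sum_j v 0 j * u 0 j <= c * enorm u) -> enorm v <= c.
Proof.
move=> c0 /(_ v); rewrite (eq_bigr (fun j => v 0 j ^+ 2)) => [|j _//].
rewrite -enorm_sqr expr2; have [->//|v0] := eqVneq (enorm v) 0.
by rewrite ler_pM2r// lt_neqAle eq_sym v0 enorm_ge0.
Qed.

End EuclideanNorm.

Section Tensors.
Context (R : realType) (n : nat).

Definition slot_set i (v : 'I_i -> 'rV[R]_n) (l : 'I_i) (u : 'rV[R]_n) :
  'I_i -> 'rV[R]_n := fun l' => if l' == l then u else v l'.

Lemma tapp_scale i (A : tensor R n i) (c : 'I_i -> R) v :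
  tapp A (fun l => c l *: v l) = (\prod_l c l) * tapp A v.
Proof.
rewrite /tapp mulr_sumr; apply: eq_bigr => J _.
rewrite mulrCA -big_split/=; congr (_ * _).
by apply: eq_bigr => l _; rewrite mxE.
Qed.

Lemma tappB i (A B : tensor R n i) v : tapp (A - B) v = tapp A v - tapp B v.
Proof.
by rewrite /tapp -sumrB; apply: eq_bigr => J _; rewrite !ffunE mulrBl.
Qed.

Lemma tapp_slot_linear i (A : tensor R n i) v l (u : 'rV[R]_n) :
  \sum_j u 0 j * tapp A (slot_set v l (delta_mx 0 j))
    = tapp A (slot_set v l u).
Proof.
under eq_bigr do rewrite mulr_sumr.
rewrite exchange_big/=; apply: eq_bigr => J _.
pose P := \prod_(l' < i | l' != l) v l' 0 (tnth J l').
have E w : \prod_(l' < i) slot_set v l w l' 0 (tnth J l') = w 0 (tnth J l) * P.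
  rewrite (bigD1 l)//= {1}/slot_set eqxx; congr (_ * _).
  by apply: eq_bigr => l' /negbTE l'l; rewrite /slot_set l'l.
rewrite E (bigD1 (tnth J l))//= E mxE !eqxx mul1r big1.
  by rewrite addr0 mulrCA.
by move=> j /negbTE jl; rewrite E mxE eqxx/= eq_sym jl mul0r !mulr0.
Qed.

Lemma tnorm_has_ubound i (A : tensor R n i) :
  has_ubound [set `|tapp A v| | v in [set v : 'I_i -> 'rV[R]_n |
                                forall l, enorm (v l) = 1]].
Proof.
exists (\sum_J `|A J|) => _ [v v1 <-].
rewrite (le_trans (ler_norm_sum _ _ _))// ler_sum// => J _.
rewrite normrM ler_piMr// normr_prod.
apply: (@le_trans _ _ (\prod_(l < i) (1 : R))); last by rewrite big1.
by apply: ler_prod => l _; rewrite normr_ge0 -(v1 l) coord_le_enorm.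
Qed.

Lemma tnorm_ge0 i (A : tensor R n i) : 0 <= tnorm A.
Proof.
rewrite /tnorm; set E := [set _ | _ in _].
have [[x Ex]|E0] := pselect (E !=set0).
  apply: (@le_trans _ _ x); last first.
    by apply: ub_le_sup => //; exact: tnorm_has_ubound.
  by case: Ex => v _ <-.
(* Without unit vectors ([n = 0] and [0 < i]) the supremum of the empty set is 0 by default. *)
by rewrite sup_out// => -[].
Qed.

Lemma tapp_le_tnorm i (A : tensor R n i) v :
  `|tapp A v| <= tnorm A * \prod_l enorm (v l).
Proof.
have [/existsP[l /eqP l0]|] := boolP [exists l, enorm (v l) == 0].
  rewrite /tapp big1 ?normr0 ?mulr_ge0 ?tnorm_ge0 ?prodr_ge0// => [? _|? _].
    exact: enorm_ge0.
  rewrite (bigD1 l)//= (enorm_eq0 l0) mxE mul0r mulr0//.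
rewrite negb_exists => /forallP v0.
have vE : v = fun l => enorm (v l) *: ((enorm (v l))^-1 *: v l).
  by apply/funext => l; rewrite scalerA divff// scale1r.
have P0 : 0 <= \prod_l enorm (v l) by apply: prodr_ge0 => l _; exact: enorm_ge0.
rewrite {1}vE tapp_scale normrM mulrC (ger0_norm P0) ler_wpM2r//.
apply: ub_le_sup; first exact: tnorm_has_ubound.
exists (fun l => (enorm (v l))^-1 *: v l) => //= l.
by rewrite enormZ ger0_norm ?invr_ge0 ?enorm_ge0// mulVf.
Qed.

Lemma tpow_le_tnorm i (A : tensor R n i) s : tpow A s <= tnorm A * enorm s ^+ i.
Proof.
apply: le_trans (ler_norm _) (le_trans (tapp_le_tnorm _ _) _).
by rewrite prodr_const card_ord.
Qed.

Lemma tapp_slot_le_tnorm i (A : tensor R n i) s l u :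
  `|tapp A (slot_set (fun=> s) l u)| <= tnorm A * enorm s ^+ i.-1 * enorm u.
Proof.
rewrite (le_trans (tapp_le_tnorm _ _))// -mulrA ler_wpM2l ?tnorm_ge0//.
rewrite (bigD1 l)//= {1}/slot_set eqxx mulrC ler_wpM2r ?enorm_ge0//.
rewrite (eq_bigr (fun=> enorm s)) => [|l' /negbTE l'l]; last first.
  by rewrite /slot_set l'l.
by rewrite prodr_const cardC1 card_ord.
Qed.

Lemma is_derive_coord (s v : 'rV[R]_n) (j : 'I_n) :
  is_derive s v (fun x : 'rV[R]_n => x 0 j) (v 0 j).
Proof.
have /derivable_mxP/(_ 0 j) d := @derivable_id R _ s v.
apply: DeriveDef => //.
have := derive_mx (@derivable_id R 'rV[R]_n s v).
rewrite derive_id => /matrixP/(_ 0 j); rewrite mxE => ->//.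
Qed.

Lemma is_derive_bigsum (V : normedModType R) (I : Type) (r : seq I)
    (F : I -> V -> R) x v (dF : I -> R) :
  (forall i, is_derive x v (F i) (dF i)) ->
  is_derive x v (fun y => \sum_(i <- r) F i y) (\sum_(i <- r) dF i).
Proof.
move=> h; elim: r => [|i r IH].
  rewrite big_nil (_ : (fun _ => _) = cst 0); first exact: is_derive_cst.
  by apply/funext => y; rewrite big_nil.
rewrite big_cons (_ : (fun _ => _) = F i + fun y => \sum_(i <- r) F i y).
  exact: is_deriveD.
by apply/funext => y; rewrite big_cons.
Qed.

Lemma is_derive_prod (V : normedModType R) i (F : 'I_i -> V -> R) x v
    (dF : 'I_i -> R) :
  (forall l, is_derive x v (F l) (dF l)) ->
  is_derive x v (fun y => \prod_l F l y)
    (\sum_l \prod_l' (if l' == l then dF l' else F l' x)).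
Proof.
elim: i F dF => [|i IH] F dF h.
  rewrite big_ord0 (_ : (fun _ => _) = cst 1); first exact: is_derive_cst.
  by apply/funext => y; rewrite big_ord0.
have IH' := IH (fun l => F (lift ord0 l)) _ (fun l => h (lift ord0 l)).
have := is_deriveM (h ord0) IH'.
rewrite (_ : F ord0 * _ = fun y => \prod_l F l y); last first.
  by apply/funext => y; rewrite big_ord_recl.
move=> H; apply: is_derive_eq.
rewrite big_ord_recl addrC; congr (_ + _).
  rewrite big_ord_recl eqxx mulrC; congr (_ * _).
rewrite [_ *: _]mulr_sumr; apply: eq_bigr => l _.
by rewrite big_ord_recl; congr (_ * _).
Qed.

Lemma is_derive_tpow i (A : tensor R n i) s v :
  is_derive s v (fun x => tpow A x) (\sum_l tapp A (slot_set (fun=> s) l v)).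
Proof.
have H (J : i.-tuple 'I_n) : is_derive s v
    (fun x : 'rV[R]_n => A J * \prod_(l < i) x 0 (tnth J l))
    (A J * \sum_l \prod_l' (if l' == l then v 0 (tnth J l')
                            else s 0 (tnth J l'))).
  apply: (@is_deriveZ _ _ _
    (fun x : 'rV[R]_n => \prod_(l < i) x 0 (tnth J l)) (A J)).
  by apply: is_derive_prod => l; exact: is_derive_coord.
rewrite /tpow /tapp.
have -> : \sum_l \sum_J A J * \prod_(l' < i)
    slot_set (fun=> s) l v l' 0 (tnth J l') =
  \sum_(J : i.-tuple 'I_n) A J * \sum_l \prod_l'
    (if l' == l then v 0 (tnth J l') else s 0 (tnth J l')).
  rewrite exchange_big/=; apply: eq_bigr => J _; rewrite mulr_sumr.
  apply: eq_bigr => l _; congr (_ * _); apply: eq_bigr => l' _.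
  by rewrite /slot_set; case: ifP.
exact: is_derive_bigsum.
Qed.

(** The tensors may be asymmetric, so the derivative of each power keeps one term per slot. *)
Lemma grad_taylor_dot p (f : 'rV[R]_n -> R) (A : forall i, tensor R n i)
    (x s u : 'rV[R]_n) :
  \sum_j u 0 j * grad (taylor p f A x) s 0 j
    = \sum_(1 <= i < p.+1) (i`!%:R)^-1
        * \sum_(l < i) tapp (A i) (slot_set (fun=> s) l u).
Proof.
have H (v : 'rV[R]_n) : 'D_v (taylor p f A x) s =
    \sum_(1 <= i < p.+1) (i`!%:R)^-1
        * \sum_(l < i) tapp (A i) (slot_set (fun=> s) l v).
  apply: derive_val.
  rewrite -[X in is_derive _ _ _ X]add0r.
  apply: (@is_deriveD _ _ _ (cst (f x))).
  apply: is_derive_bigsum => i.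
  apply: (@is_deriveZ _ _ _ (fun y : 'rV[R]_n => tpow (A i) y) (i`!%:R)^-1).
  exact: is_derive_tpow.
under eq_bigr do rewrite mxE H mulr_sumr.
rewrite exchange_big/=; apply: eq_bigr => i _.
under eq_bigr do rewrite mulrCA mulr_sumr.
rewrite -mulr_sumr exchange_big/=; congr (_ * _); apply: eq_bigr => l _.
exact: tapp_slot_linear.
Qed.

End Tensors.

(** * Taylor bounds *)

Section OneDimensionalTaylor.
Context (R : realType).

Lemma ge0_derive_le (g dg : R -> R) (b : R) : 0 <= b ->
  (forall t : R, is_derive t 1 g (dg t)) ->
  (forall t, 0 <= t <= b -> 0 <= dg t) -> g 0 <= g b.
Proof.
move=> b0 hg hdg.
have [|c cb] := @MVT_segment R g dg 0 b b0 (fun t _ => hg t).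
  by apply: derivable_within_continuous => t _; exact: ex_derive.
rewrite subr0 => E; rewrite -subr_ge0 E mulr_ge0// hdg//.
Qed.

Lemma is_derive_scaled_exprn (t c : R) k :
  is_derive t 1 (fun t : R => c * t ^+ k.+1 / k.+1`!%:R) (c * t ^+ k / k`!%:R).
Proof.
have H := is_deriveX k.+1 (is_derive_id t (1 : R)).
have := @is_deriveZ _ _ _ (id ^+ k.+1 : R -> R) (c / k.+1`!%:R) t 1 _ H.
rewrite (_ : _ \*: _ = fun t : R => c * t ^+ k.+1 / k.+1`!%:R).
  move=> H1; apply: is_derive_eq; rewrite /GRing.scale/= mulr1 factS natrM.
  have : k.+1%:R != 0 :> R by rewrite pnatr_eq0.
  have : k`!%:R != 0 :> R by rewrite pnatr_eq0 -lt0n fact_gt0.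
  by move: k.+1%:R k`!%:R => a b b0 a0; field; rewrite a0 b0.
by apply/funext => y /=; rewrite fctE mulrAC.
Qed.

Lemma integrate_bound (g dg : R -> R) (C t : R) k :
  (forall t : R, is_derive t 1 g (dg t)) -> g 0 = 0 -> 0 <= t <= 1 ->
  (forall t, 0 <= t <= 1 -> `|dg t| <= C * t ^+ k / k`!%:R) ->
  `|g t| <= C * t ^+ k.+1 / k.+1`!%:R.
Proof.
move=> hg g0 /andP[t0 t1] hdg.
pose c t : R := C * t ^+ k.+1 / k.+1`!%:R.
have c0 : c 0 = 0 by rewrite /c expr0n/= mulr0 mul0r.
have hc (s : R) : is_derive s 1 c (C * s ^+ k / k`!%:R).
  exact: is_derive_scaled_exprn.
have hdg' s : 0 <= s <= t -> `|dg s| <= C * s ^+ k / k`!%:R.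
  by move=> /andP[s0 st]; apply: hdg; rewrite s0 (le_trans st).
rewrite ler_norml; apply/andP; split.
- rewrite -subr_ge0 opprK -/(c t).
  have := @ge0_derive_le (fun s => g s + c s) (fun s => dg s + C * s ^+ k / k`!%:R) t t0.
  rewrite g0 c0 addr0; apply => s /hdg'.
  by rewrite ler_norml => /andP[+ _]; rewrite -subr_ge0 opprK.
- rewrite -subr_ge0 -/(c t).
  have := @ge0_derive_le (fun s => c s - g s) (fun s => C * s ^+ k / k`!%:R - dg s) t t0.
  rewrite g0 c0 subr0; apply => s /hdg'.
  by rewrite ler_norml => /andP[_]; rewrite subr_ge0.
Qed.

(** The last derivative satisfies only a Lipschitz bound at 0, so no Lagrange form of the remainder
    is available. The derivative of the remainder is the remainder of the shifted sequence, and each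
    integration of the bound raises the power of [t] by one. *)
Lemma taylor_remainder p (phi : nat -> R -> R) (C t : R) :
  (forall i (t : R), (i < p)%N -> is_derive t 1 (phi i) (phi i.+1 t)) ->
  (forall t, 0 <= t <= 1 -> `|phi p t - phi p 0| <= C * t) -> 0 <= t <= 1 ->
  `|phi 0%N t - \sum_(l < p.+1) phi l 0 * t ^+ l / l`!%:R|
    <= C * t ^+ p.+1 / p.+1`!%:R.
Proof.
elim: p phi t => [|p IH] phi t h hC t01.
  by rewrite big_ord_recl big_ord0 addr0 !expr1 expr0 mulr1 !divr1 hC.
pose g (t : R) := phi 0%N t - \sum_(l < p.+2) phi l 0 * t ^+ l / l`!%:R.
pose dg (t : R) := phi 1%N t - \sum_(l < p.+1) phi l.+1 0 * t ^+ l / l`!%:R.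
apply: (@integrate_bound g dg C t p.+1) => //.
- move=> s; apply: is_deriveB; first exact: h.
  rewrite -[X in is_derive _ _ _ X]add0r.
  under eq_fun do rewrite big_ord_recl/=.
  apply: is_deriveD.
    rewrite (_ : (fun _ => _) = cst (phi 0%N 0)); first exact: is_derive_cst.
    by apply/funext => y; rewrite expr0 mulr1 divr1.
  apply: is_derive_bigsum => i; rewrite /bump/= add1n.
  exact: is_derive_scaled_exprn.
- rewrite /g big_ord_recl big1/= => [|i _]; last first.
    by rewrite expr0n/= mulr0 mul0r.
  by rewrite expr0 mulr1 divr1 addr0 subrr.
- by move=> s s01; apply: (IH (fun i => phi i.+1)) => // i u ip; exact: h.
Qed.

End OneDimensionalTaylor.

(** * Derivatives along lines and Schwarz's theorem *)

Section Lines.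
Context (R : realType) (n : nat).
Implicit Types (g : 'rV[R]_n -> R) (x s u v : 'rV[R]_n).

Lemma is_derive_line g x s (t : R) : differentiable g (x + t *: s) ->
  is_derive t 1 (fun t => g (x + t *: s)) ('D_s g (x + t *: s)).
Proof.
move=> /(@diff_derivable _ _ _ _ _ s) dg.
have E : (fun h : R => h^-1 *: (g (x + (h *: (1 : R) + t) *: s) - g (x + t *: s)))
       = (fun h : R => h^-1 *: (g (h *: s + (x + t *: s)) - g (x + t *: s))).
  apply/funext => h; congr (_ *: (g _ - _)).
  by rewrite scalerDl -[h%:A]/(h * 1) mulr1 addrCA.
by apply: DeriveDef; rewrite /derivable /derive/= E.
Qed.

Lemma derive_partials g x s : differentiable g x ->
  'D_s g x = \sum_j s 0 j * 'D_(delta_mx 0 j) g x.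
Proof.
move=> dg; rewrite deriveE// {1}[s]row_sum_delta linear_sum/=.
by apply: eq_bigr => j _; rewrite linearZ/= -deriveE.
Qed.

(** The mean value theorem is used along [u] on a difference in the direction [v], then along [v] on
    the derivative along [u]. The left-hand side is symmetric in [u] and [v], which is the source of
    Schwarz's theorem. *)
Lemma second_difference_MVT g x u v (h : R) : 0 < h ->
  (forall y, differentiable g y) -> (forall y, differentiable ('D_u g) y) ->
  exists t1 t2 : R, [/\ 0 <= t1 <= h, 0 <= t2 <= h &
    g (x + h *: u + h *: v) - g (x + h *: u) - g (x + h *: v) + g x
      = 'D_v ('D_u g) (x + t1 *: u + t2 *: v) * h ^+ 2].
Proof.
move=> h0 dg ddg.
pose k (t : R) := g (x + h *: v + t *: u) - g (x + t *: u).
have [||t1 t1h E1] := @MVT_segment R k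
    (fun t => 'D_u g (x + h *: v + t *: u) - 'D_u g (x + t *: u)) 0 h (ltW h0).
- by move=> t _; apply: is_deriveB; exact: is_derive_line.
- apply: derivable_within_continuous => t _.
  by apply: ex_derive; apply: is_deriveB; exact: is_derive_line.
have [||t2 t2h E2] := @MVT_segment R (fun t => 'D_u g (x + t1 *: u + t *: v))
    (fun t => 'D_v ('D_u g) (x + t1 *: u + t *: v)) 0 h (ltW h0).
- by move=> t _; exact: is_derive_line.
- apply: derivable_within_continuous => t _.
  by have H := is_derive_line (ddg (x + t1 *: u + t *: v)); exact: ex_derive.
exists t1, t2; split; [by rewrite in_itv/= in t1h|by rewrite in_itv/= in t2h|].
rewrite subr0 in E2; rewrite subr0 in E1.
rewrite expr2 mulrA -E2 scale0r addr0 (addrAC x (t1 *: u)) -E1 /k scale0r !addr0.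
rewrite (addrAC x (h *: v)); ring.
Qed.

Lemma dist_le_halves (a b c e : R) :
  `|a - c| <= e / 2 -> `|b - c| <= e / 2 -> `|a - b| <= e.
Proof.
move=> h1 h2; rewrite [e]splitr -(subrKA c).
by apply: le_trans (ler_normD _ _) _; rewrite lerD// distrC.
Qed.

Lemma schwarz g u v : (forall y, differentiable g y) ->
  (forall y, differentiable ('D_u g) y) ->
  (forall y, differentiable ('D_v g) y) ->
  continuous ('D_v ('D_u g)) -> continuous ('D_u ('D_v g)) ->
  'D_v ('D_u g) = 'D_u ('D_v g).
Proof.
move=> dg du dv cvu cuv; apply/funext => x; apply/eqP; rewrite -subr_eq0.
rewrite -normr_le0; apply/ler_addgt0Pl => e e0; rewrite addr0.
have e2 : 0 < e / 2 by rewrite divr_gt0.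
have /cvgrPdist_lt/(_ _ e2)/nbhs_normP[d1 /= d10 H1] := cvu x.
have /cvgrPdist_lt/(_ _ e2)/nbhs_normP[d2 /= d20 H2] := cuv x.
pose d := Num.min d1 d2; pose c := `|u| + `|v| + 1.
have c0 : 0 < c by rewrite ltr_wpDl ?addr_ge0.
have d0 : 0 < d by rewrite lt_min d10 d20.
(* This [h] keeps the intermediate points of both orders of differentiation within distance [d] of
   [x]. *)
pose h := d / c; have h0 : 0 < h by rewrite divr_gt0.
have near_x (a b : R) u' v' : 0 <= a <= h -> 0 <= b <= h ->
    `|u'| + `|v'| = `|u| + `|v| -> `|x - (x + a *: u' + b *: v')| < d.
  move=> /andP[a0 ah] /andP[b0 bh] uv.
  rewrite -addrA opprD addrA subrr sub0r normrN.
  rewrite (le_lt_trans (ler_normD _ _))// !normrZ !ger0_norm//.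
  apply: (@le_lt_trans _ _ (h * (`|u'| + `|v'|))).
    by rewrite mulrDr lerD// ler_wpM2r.
  rewrite uv /h mulrAC ltr_pdivrMr// ltr_pM2l// /c ltrDl//.
have [t1 [t2 [t1h t2h E1]]] := second_difference_MVT x v h0 dg du.
have [t3 [t4 [t3h t4h E2]]] := second_difference_MVT x u h0 dg dv.
have E : 'D_v ('D_u g) (x + t1 *: u + t2 *: v)
       = 'D_u ('D_v g) (x + t3 *: v + t4 *: u).
  apply: (@mulIf _ (h ^+ 2)); first by rewrite expf_neq0// gt_eqF.
  apply: etrans (esym E1) (etrans _ E2); rewrite (addrAC x (h *: u)).
  have swap (a b k l : R) : a - b - k + l = a - k - b + l by ring.
  exact: swap.
have h1 : `|x - (x + t1 *: u + t2 *: v)| < d1.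
  by apply: lt_le_trans (near_x _ _ _ _ t1h t2h erefl) _; rewrite ge_min lexx.
have h2 : `|x - (x + t3 *: v + t4 *: u)| < d2.
  apply: lt_le_trans (near_x _ _ _ _ t3h t4h (addrC _ _)) _.
  by rewrite ge_min lexx orbT.
have {H1} := ltW (H1 _ h1); have {H2} := ltW (H2 _ h2); rewrite -E => H2 H1.
exact: dist_le_halves H1 H2.
Qed.

End Lines.

(** * Symmetry of higher derivatives and Taylor bounds for f and its gradient *)

Section Partials.
Context (R : realType) (n p : nat) (f : 'rV[R]_n -> R) (hf : class_C p f).

Lemma partials_swap (a b : 'I_n) (J : seq 'I_n) : (size J + 2 <= p)%N ->
  partials f (a :: b :: J) = partials f (b :: a :: J).
Proof.
case: hf => hd hc; rewrite addn2 => Jp; apply: schwarz => *.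
- by apply: hd; exact: ltn_trans Jp.
- exact: (hd (b :: J)).
- exact: (hd (a :: J)).
- exact: (hc [:: a, b & J]).
- exact: (hc [:: b, a & J]).
Qed.

(** Adjacent transpositions, allowed by Schwarz's theorem, carry [j] to the front; repeating this
    yields invariance under all permutations. *)
Lemma partials_rem (j : 'I_n) (J : seq 'I_n) : j \in J -> (size J <= p)%N ->
  partials f J = partials f (j :: rem j J).
Proof.
elim: J => // a J IH; rewrite inE /= => + Jp.
have [->//|ja/= jJ] := eqVneq j a.
apply: etrans (congr1 (fun g => 'D_(delta_mx 0 a) g) (IH jJ (ltnW Jp))) _.
apply: (@partials_swap a j (rem j J)); rewrite size_rem// addn2.
by case: J jJ Jp {IH}.
Qed.

Lemma partials_perm (J1 J2 : seq 'I_n) : (size J1 <= p)%N -> perm_eq J1 J2 ->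
  partials f J1 = partials f J2.
Proof.
elim: J1 J2 => [|j J1 IH] J2 /= J1p H.
  by move: H; rewrite perm_sym => /perm_nilP ->.
have jJ2 : j \in J2 by rewrite -(perm_mem H) mem_head.
rewrite (partials_rem jJ2) -?(perm_size H)//=.
suff -> : partials f J1 = partials f (rem j J2) by [].
apply: IH; first exact: ltnW.
by rewrite -(perm_cons j) (perm_trans H)// perm_to_rem.
Qed.

(** Reindexing by the transposition of the two slots permutes the coordinates, under which iterated
    partial derivatives agree. For exact derivatives the sum over slots thus collapses to a factor
    [i.+1], which cancels against the factorial. *)
Lemma dtensor_slot i x s (l : 'I_i.+1) (u : 'rV[R]_n) : (i < p)%N ->
  tapp (dtensor f i.+1 x) (slot_set (fun=> s) l u)
    = tapp (dtensor f i.+1 x) (slot_set (fun=> s) ord_max u).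
Proof.
move=> ip; pose t := tperm l (@ord_max i).
pose perm_tuple (J : i.+1.-tuple 'I_n) := [tuple tnth J (t k) | k < i.+1].
have permK : involutive perm_tuple.
  by move=> J; apply: eq_from_tnth => k; rewrite !tnth_mktuple tpermK.
rewrite /tapp (reindex_inj (inv_inj permK))/=; apply: eq_bigr => J _.
congr (_ * _).
  rewrite !ffunE (@partials_perm (perm_tuple J) J)// ?size_tuple//.
  by apply/tuple_permP; exists t.
rewrite (reindex_inj (@perm_inj _ t))/=; apply: eq_bigr => k _.
rewrite {1}/perm_tuple tnth_mktuple tpermK /slot_set.
have -> // : (t k == l) = (k == ord_max).
by rewrite -(inj_eq (@perm_inj _ t)) tpermK tpermL.
Qed.

(** The new direction goes in front because the head index in [partials] is the outermost
    derivative. *)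
Definition cons_arg i (s : 'rV[R]_n) (v : 'I_i -> 'rV[R]_n) (l : 'I_i.+1) :=
  if unlift ord0 l is Some l' then v l' else s.

Lemma is_derive_dtensor i (v : 'I_i -> 'rV[R]_n) x s (t : R) : (i < p)%N ->
  is_derive t 1 (fun t : R => tapp (dtensor f i (x + t *: s)) v)
    (tapp (dtensor f i.+1 (x + t *: s)) (cons_arg s v)).
Proof.
move=> ip; case: hf => hd _; set y := x + t *: s.
have -> : tapp (dtensor f i.+1 y) (cons_arg s v) =
    \sum_(J : i.-tuple 'I_n) (\prod_(l < i) v l 0 (tnth J l))
      * 'D_s (partials f J) y.
  pose h (jJ : 'I_n * i.-tuple 'I_n) := [tuple of jJ.1 :: jJ.2].
  pose h' (J : i.+1.-tuple 'I_n) := (thead J, [tuple of behead J]).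
  rewrite /tapp (reindex h)/=; last first.
    exists h' => [[j J] _|J _]; last by rewrite /h/= -tuple_eta.
    by congr pair; apply: val_inj.
  rewrite -(pair_bigA _ (fun j J => (dtensor f i.+1 y) (h (j, J)) *
    \prod_(l < i.+1) cons_arg s v l 0 (tnth (h (j, J)) l)))/=.
  rewrite exchange_big/=; apply: eq_bigr => J _.
  rewrite derive_partials; last by apply: hd; rewrite size_tuple.
  rewrite mulr_sumr; apply: eq_bigr => j _; rewrite ffunE big_ord_recl.
  have -> : \prod_(l < i) cons_arg s v (lift ord0 l) 0
      (tnth (h (j, J)) (lift ord0 l)) = \prod_(l < i) v l 0 (tnth J l).
    by apply: eq_bigr => l _; rewrite /cons_arg liftK tnthS.
  by rewrite /cons_arg unlift_none mulrC (mulrC (s _ _)) -mulrA.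
rewrite /tapp.
rewrite (_ : (fun _ => _) = fun t : R => \sum_(J : i.-tuple 'I_n)
    (\prod_(l < i) v l 0 (tnth J l)) * partials f J (x + t *: s)); last first.
  by apply/funext => t'; apply: eq_bigr => J _; rewrite ffunE mulrC.
apply: is_derive_bigsum => J.
apply: (@is_deriveZ _ _ _ (fun t : R => partials f J (x + t *: s))).
by apply: is_derive_line; apply: hd; rewrite size_tuple.
Qed.

Lemma cons_arg_cst i s : cons_arg s (fun _ : 'I_i => s) = fun=> s.
Proof. by apply/funext => l; rewrite /cons_arg; case: unliftP. Qed.

Lemma cons_arg_slot i s u :
  cons_arg s (slot_set (fun _ : 'I_i.+1 => s) ord_max u)
    = slot_set (fun=> s) ord_max u.
Proof.
apply/funext => l; rewrite /cons_arg /slot_set.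
by case: unliftP => [l' ->|->].
Qed.

Context (L : R).
Hypothesis hlip : forall x y,
  tnorm (dtensor f p x - dtensor f p y) <= L * enorm (x - y).

Lemma taylor_value_bound x s : (0 < p)%N ->
  f (x + s) <= taylor p f (fun i => dtensor f i x) x s
               + L / p.+1`!%:R * enorm s ^+ p.+1.
Proof.
move=> p0; pose phi i (t : R) := tpow (dtensor f i (x + t *: s)) s.
have := @taylor_remainder R p phi (L * enorm s ^+ p.+1) 1.
rewrite ler01 lexx => /(_ _ _ isT) H.
have /(le_trans (ler_norm _)) : `|phi 0%N 1
    - \sum_(l < p.+1) phi l 0 * 1 ^+ l / l`!%:R|
    <= L * enorm s ^+ p.+1 * 1 ^+ p.+1 / (p.+1)`!%:R.
  apply: H => [i t ip|t /andP[t0 _]].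
    by have := is_derive_dtensor (fun=> s) x s t ip; rewrite cons_arg_cst.
  rewrite /phi /tpow -tappB (le_trans (tapp_le_tnorm _ _))//.
  rewrite prodr_const card_ord.
  have := hlip (x + t *: s) (x + 0 *: s).
  rewrite scale0r addr0 (addrC x) addrK enormZ ger0_norm// => /ler_wpM2r.
  move=> /(_ _ (exprn_ge0 p (enorm_ge0 s)))/le_trans; apply.
  by rewrite le_eqVlt; apply/orP; left; apply/eqP; rewrite exprS; ring.
have phi0 t : phi 0%N t = f (x + t *: s).
  rewrite /phi /tpow /tapp (big_pred1 [tuple])/=.
    by rewrite big_ord0 mulr1 ffunE.
  by move=> J; apply/esym/eqP; exact: tuple0.
rewrite !expr1n mulr1 phi0 scale1r lerBlDr mulrAC => /le_trans; apply.
rewrite addrC lerD2r /taylor big_ord_recl phi0 scale0r addr0 expr0 mulr1 divr1.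
rewrite lerD2l big_add1/= big_mkord le_eqVlt; apply/orP; left; apply/eqP.
apply: eq_bigr => i _; rewrite /bump/= add1n expr1n mulr1 mulrC /phi.
by rewrite scale0r addr0.
Qed.

(** By duality it suffices to expand the derivative along a direction [u]; one derivative is already
    spent, so the remainder has order [p.-1]. *)
Lemma taylor_grad_bound x s : (0 < p)%N -> 0 <= L ->
  enorm (grad f (x + s) - grad (taylor p f (fun i => dtensor f i x) x) s)
    <= L / p`!%:R * enorm s ^+ p.
Proof.
move=> p0 L0; apply: enorm_le_dual => [|u].
  by rewrite mulr_ge0 ?divr_ge0// exprn_ge0// enorm_ge0.
(* Prepending [s] leaves [u] in the last slot, so that the derivatives along the line form the
   single sequence [psi]. *)
pose w i := slot_set (fun _ : 'I_i.+1 => s) ord_max u.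
pose psi i (t : R) := tapp (dtensor f i.+1 (x + t *: s)) (w i).
pose C := L * enorm s ^+ p * enorm u.
have := @taylor_remainder R p.-1 psi C 1.
rewrite ler01 lexx prednK// => /(_ _ _ isT) H.
have /(le_trans (ler_norm _)) : `|psi 0%N 1
    - \sum_(l < p) psi l 0 * 1 ^+ l / l`!%:R| <= C * 1 ^+ p / p`!%:R.
  apply: H => [i t ip|t /andP[t0 _]].
    have ip' : (i.+1 < p)%N by rewrite -(prednK p0).
    by have := is_derive_dtensor (w i) x s t ip'; rewrite cons_arg_slot.
  rewrite /psi -tappB (le_trans (tapp_slot_le_tnorm _ _ _ _))//=.
  have : forall x y : 'rV[R]_n, tnorm (dtensor f p.-1.+1 x
      - dtensor f p.-1.+1 y) <= L * enorm (x - y) by rewrite (prednK p0).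
  move=> /(_ (x + t *: s) (x + 0 *: s)).
  rewrite scale0r addr0 [x + _]addrC addrK enormZ ger0_norm// => /ler_wpM2r.
  move=> /(_ (enorm s ^+ p.-1 * enorm u)) h; rewrite -mulrA (le_trans (h _))//.
    by rewrite mulr_ge0 ?exprn_ge0 ?enorm_ge0.
  rewrite le_eqVlt; apply/orP; left; apply/eqP.
  by rewrite /C -(prednK p0) exprS/=; ring.
rewrite !expr1n mulr1 mulrAC -[L * _ / _]mulrAC => /(le_trans _); apply.
rewrite le_eqVlt; apply/orP; left; apply/eqP.
under eq_bigr do rewrite !mxE mulrBl.
rewrite sumrB; congr (_ - _).
  rewrite /psi scale1r /tapp (reindex (fun j : 'I_n => [tuple j]))/=.
    apply: eq_bigr => j _; rewrite big_ord1 ffunE/=.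
    by have -> : w 0%N ord0 = u by [].
  exists (fun J => thead J) => [j _|J _]; first by rewrite theadE.
  by case/tupleP: J => j J; rewrite theadE; apply: val_inj => /=;
    congr (_ :: _); rewrite (size0nil (size_tuple J)).
transitivity (\sum_j u 0 j
    * grad (taylor p f (fun i => dtensor f i x) x) s 0 j).
  by apply: eq_bigr => j _; rewrite mxE mulrC.
rewrite (@grad_taylor_dot R n p f (fun i => dtensor f i x)).
rewrite big_add1/= big_mkord; apply: eq_bigr => i _.
rewrite expr1n mulr1 /psi scale0r addr0.
rewrite (eq_bigr (fun=> tapp (dtensor f i.+1 x) (w i))) => [|l _]; last first.
  exact: dtensor_slot.
rewrite sumr_const card_ord.
rewrite -(mulr_natr (tapp _ _)) [LHS]mulrC -mulrA; congr (_ * _).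
by rewrite factS natrM invfM mulVKf// pnatr_eq0.
Qed.

End Partials.

(** * Means of nonnegative random variables *)

Section IntegralComparison.
Context (R : realType) (d : measure_display) (T : measurableType d)
  (P : probability T R).
Implicit Types g h : T -> R.

(** The integral of a nonnegative function is a supremum over the simple functions below it, hence
    monotone also for functions that may fail to be measurable, such as the gradient norms along the
    run. *)
Lemma ge0_le_integral_nonmeasurable (f1 f2 : T -> \bar R) :
  (forall w, (0 <= f1 w)%E) -> (forall w, (f1 w <= f2 w)%E) ->
  (\int[P]_w f1 w <= \int[P]_w f2 w)%E.
Proof.
move=> f10 f12; rewrite !ge0_integralTE//; last first.
  by move=> w; exact: le_trans (f12 w).
apply: ereal_sup_le => _ [h hf <-]; exists h => //= w.
exact: le_trans (f12 w).
Qed.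

Definition rv_ge0 g := measurable_fun setT g /\ forall w, 0 <= g w.

(** The integrals are extended reals, so comparisons can be chained before any mean is known to be
    finite; the bundled measurability and sign make sums and multiples of comparisons valid. *)
Definition mean_le g h := [/\ rv_ge0 g, rv_ge0 h &
  (\int[P]_w (g w)%:E <= \int[P]_w (h w)%:E)%E].

Lemma rv_ge0_cst c : 0 <= c -> rv_ge0 (cst c).
Proof. by move=> c0; split => //; exact: measurable_cst. Qed.

Lemma rv_ge0_add g h : rv_ge0 g -> rv_ge0 h -> rv_ge0 (fun w => g w + h w).
Proof.
move=> [mg g0] [mh h0]; split; first exact: measurable_funD.
by move=> w; rewrite addr_ge0.
Qed.

Lemma rv_ge0_mul g h : rv_ge0 g -> rv_ge0 h -> rv_ge0 (fun w => g w * h w).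
Proof.
move=> [mg g0] [mh h0]; split; first exact: measurable_funM.
by move=> w; rewrite mulr_ge0.
Qed.

Lemma rv_ge0_scale c g : 0 <= c -> rv_ge0 g -> rv_ge0 (fun w => c * g w).
Proof. by move=> /rv_ge0_cst; exact: rv_ge0_mul. Qed.

Lemma rv_ge0_sum (I : eqType) (r : seq I) (g : I -> T -> R) :
  (forall i, i \in r -> rv_ge0 (g i)) -> rv_ge0 (fun w => \sum_(i <- r) g i w).
Proof.
elim: r => [|i r IH] hg.
  by under eq_fun do rewrite big_nil; exact: (@rv_ge0_cst 0).
under eq_fun do rewrite big_cons.
apply: rv_ge0_add; first by apply: hg; exact: mem_head.
by apply: IH => j jr; apply: hg; rewrite inE jr orbT.
Qed.

Lemma rv_ge0_powR g q : measurable_fun setT g -> rv_ge0 (fun w => g w `^ q).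
Proof.
move=> mg; split => [|w]; last exact: powR_ge0.
by apply: (measurableT_comp (measurable_powR q)).
Qed.

Lemma rv_ge0_exprn g k : rv_ge0 g -> rv_ge0 (fun w => g w ^+ k).
Proof.
move=> [mg g0]; split => [|w]; last by rewrite exprn_ge0.
exact: measurable_funX.
Qed.

Lemma rv_ge0_inv g : rv_ge0 g -> rv_ge0 (fun w => (g w)^-1).
Proof.
move=> [mg g0]; have -> : (fun w => (g w)^-1) = fun w => g w `^ (-1).
  by apply/funext => w; rewrite powR_inv1.
exact: rv_ge0_powR.
Qed.

Lemma mean_le_pointwise g h : rv_ge0 g -> rv_ge0 h -> (forall w, g w <= h w) ->
  mean_le g h.
Proof.
move=> hg hh gh; split => //; apply: ge0_le_integral_nonmeasurable => w.
  by rewrite lee_fin; case: hg.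
by rewrite lee_fin.
Qed.

Lemma mean_le_trans h g k : mean_le g h -> mean_le h k -> mean_le g k.
Proof.
by move=> [hg _ gh] [_ hk hk']; split => //; exact: le_trans hk'.
Qed.

Lemma mean_le_refl g : rv_ge0 g -> mean_le g g. Proof. by []. Qed.

Lemma mean_le_add g1 g2 h1 h2 : mean_le g1 h1 -> mean_le g2 h2 ->
  mean_le (fun w => g1 w + g2 w) (fun w => h1 w + h2 w).
Proof.
move=> [G1 H1 l1] [G2 H2 l2]; split; [exact: rv_ge0_add..|].
have E a b : rv_ge0 a -> rv_ge0 b -> (\int[P]_w (a w + b w)%:E
    = \int[P]_w (a w)%:E + \int[P]_w (b w)%:E)%E.
  move=> [ma a0] [mb b0]; under eq_integral do rewrite EFinD.
  rewrite ge0_integralD//; try (by move=> w _; rewrite lee_fin).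
    exact/measurable_EFinP.
  exact/measurable_EFinP.
by rewrite !E// leeD.
Qed.

Lemma mean_le_scale c g h : 0 <= c -> mean_le g h ->
  mean_le (fun w => c * g w) (fun w => c * h w).
Proof.
move=> c0 [G H l]; split; [exact: rv_ge0_scale..|].
have E a : rv_ge0 a -> (\int[P]_w (c * a w)%:E = c%:E * \int[P]_w (a w)%:E)%E.
  move=> [ma a0]; under eq_integral do rewrite EFinM.
  rewrite ge0_integralZl_EFin// ?lee_fin//.
    by move=> w _; rewrite lee_fin.
  exact/measurable_EFinP.
by rewrite !E// lee_wpmul2l.
Qed.

Lemma mean_le_sum (I : eqType) (r : seq I) (g h : I -> T -> R) :
  (forall i, i \in r -> mean_le (g i) (h i)) ->
  mean_le (fun w => \sum_(i <- r) g i w) (fun w => \sum_(i <- r) h i w).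
Proof.
elim: r => [|i r IH] gh.
  under eq_fun do rewrite big_nil; under [X in mean_le _ X]eq_fun do rewrite big_nil.
  exact/mean_le_refl/(@rv_ge0_cst 0).
under eq_fun do rewrite big_cons; under [X in mean_le _ X]eq_fun do rewrite big_cons.
apply: mean_le_add; first by apply: gh; exact: mem_head.
by apply: IH => j jr; apply: gh; rewrite inE jr orbT.
Qed.

Lemma integral_cstT (c : R) : (\int[P]_w c%:E = c%:E)%E.
Proof.
by rewrite integral_cst//= probability_setT mule1.
Qed.

Lemma mean_le_cst g c : mean_le g (cst c) -> (\int[P]_w (g w)%:E <= c%:E)%E.
Proof. by case=> _ _; rewrite integral_cstT. Qed.

Lemma mean_le_cstP g c : rv_ge0 g -> 0 <= c ->
  (\int[P]_w (g w)%:E <= c%:E)%E -> mean_le g (cst c).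
Proof.
by move=> hg c0 h; split; [by []|exact: rv_ge0_cst|rewrite integral_cstT].
Qed.

Lemma mean_le_addrI g h c : 0 <= c -> rv_ge0 g -> rv_ge0 h ->
  mean_le (fun w => g w + c) (fun w => h w + c) -> mean_le g h.
Proof.
move=> c0 [mg g0] [mh h0] [_ _]; rewrite /mean_le.
have E a : rv_ge0 a -> (\int[P]_w (a w + c)%:E = \int[P]_w (a w)%:E + c%:E)%E.
  move=> [ma a0]; under eq_integral do rewrite EFinD.
  rewrite ge0_integralD// ?integral_cstT//; try (by move=> w _; rewrite lee_fin).
  exact/measurable_EFinP.
by rewrite !E// leeD2rE.
Qed.

(** The tangent of the logarithm at [y] lies above it, and [y] bounds the mean of [g]. Division by
    the lower bound [a] keeps the logarithm nonnegative, as [mean_le] requires. *)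
Lemma jensen_ln g a y : 0 < a -> (forall w, a <= g w) -> measurable_fun setT g ->
  mean_le g (cst y) -> mean_le (fun w => ln (g w / a)) (cst (ln (y / a))).
Proof.
move=> a0 ag mg gy.
have g0 w : 0 < g w by apply: lt_le_trans (ag w).
have ay : a <= y.
  have : mean_le (cst a) (cst y).
    apply: mean_le_trans gy; apply: mean_le_pointwise => //.
    - exact/rv_ge0_cst/ltW.
    - by split => // w; exact: ltW.
  by move/mean_le_cst; rewrite integral_cstT lee_fin.
have y0 : 0 < y by apply: lt_le_trans ay.
have hg : rv_ge0 g by split => // w; exact: ltW.
have lny : 0 <= ln (y / a) by rewrite ln_ge0// ler_pdivlMr ?mul1r.
have hln : rv_ge0 (fun w => ln (g w / a)).
  split => [|w]; last by rewrite ln_ge0// ler_pdivlMr ?mul1r.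
  apply: (measurableT_comp (@measurable_ln R)).
  by apply: measurable_funM => //; exact: measurable_cst.
(* The tangent is [ln (y / a) + y^-1 * g w - 1]; adding 1 on both sides writes it as a sum of
   nonnegative terms. *)
apply: (@mean_le_addrI _ _ 1) => //.
apply: (@mean_le_trans (fun w => ln (y / a) + y^-1 * g w)).
  apply: mean_le_pointwise.
  - by apply: rv_ge0_add => //; exact: rv_ge0_cst.
  - by apply: rv_ge0_add; [exact: rv_ge0_cst|apply: rv_ge0_scale => //; rewrite invr_ge0 ltW].
  - move=> w; rewrite !ln_div ?posrE//.
    have : ln (g w / y) <= g w / y - 1 by rewrite ln_le_subr1// divr_gt0.
    rewrite ln_div ?posrE//; lra.
have -> : (fun w : T => cst (ln (y / a)) w + 1)
    = fun w : T => ln (y / a) + y^-1 * cst y w.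
  by apply/funext => w; rewrite /= mulVf// gt_eqF.
apply: mean_le_add; first exact/mean_le_refl/rv_ge0_cst.
by apply: mean_le_scale => //; rewrite invr_ge0 ltW.
Qed.

End IntegralComparison.

(** * Conditional bounds weighted by variables known from the past *)

Section ConditionalExpectation.
Context (R : realType) (d : measure_display) (T : measurableType d)
  (P : probability T R).
Import HBNNSimple.

Lemma measurable_wrt (F : set (set T)) d' (U : measurableType d') (g : T -> U) :
  F `<=` measurable -> wrt F g -> measurable_fun setT g.
Proof.
move=> Fm mg _ Y mY; have := mg measurableT Y mY.
by apply: smallest_sub; [exact: sigma_algebra_measurable|].
Qed.

Lemma integral_mul_simple (F : set (set T)) (Y : T -> R)
    (h : {nnsfun g_sigma_algebraType F >-> R}) : F `<=` measurable ->
  rv_ge0 Y ->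
  (\int[P]_w (Y w * h w)%:E = \sum_(r <- finmap.enum_fset (fset_set (range h)))
     (r%:E * \int[P]_(w in h @^-1` [set r]) (Y w)%:E))%E.
Proof.
move=> Fm [mY Y0].
have mh : measurable_fun (setT : set T) h.
  by apply: (@measurable_wrt F) => //; exact: measurable_funP.
have mC r : measurable (h @^-1` [set r] : set T).
  rewrite -[X in measurable X]setTI.
  exact: (mh measurableT _ (measurable_set1 r)).
have YE w : (Y w * h w)%:E = (\sum_(r <- finmap.enum_fset (fset_set (range h)))
    (r * (Y w * \1_(h @^-1` [set r]) w))%:E)%E.
  rewrite sumEFin; congr EFin; rewrite (fimfunE h w) fsbig_finite//= mulr_sumr.
  by apply: eq_bigr => r _; rewrite mulrCA.
have mY1 r : measurable_fun setT (fun w => Y w * \1_(h @^-1` [set r]) w).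
  by apply: measurable_funM => //; exact: measurable_indic.
have Y1 w r : 0 <= Y w * \1_(h @^-1` [set r]) w by rewrite mulr_ge0.
(* Nonnegativity is asked of the term of every real [r]; the level sets of negative [r] are
   empty. *)
have r0 r w : ~ 0 <= r -> \1_(h @^-1` [set r]) w = 0 :> R.
  move=> r0; rewrite indicE memNset// => /= hr; apply: r0.
  by rewrite -hr; exact: fun_ge0.
under eq_integral do rewrite YE.
rewrite ge0_integral_sum//; last 2 first.
- by move=> r; apply/measurable_EFinP/measurable_funM => //; exact: measurable_cst.
- move=> r w _; rewrite lee_fin; have [r0'|/r0 ->] := pselect (0 <= r).
    by rewrite mulr_ge0.
  by rewrite !mulr0.
apply: eq_bigr => r _; rewrite [in RHS]integral_mkcond epatch_indic.
have -> : ((EFin \o Y) \* (EFin \o \1_(h @^-1` [set r])))%E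
    = fun w => (Y w * \1_(h @^-1` [set r]) w)%:E.
  by apply/funext => w; rewrite /= EFinM.
under eq_integral do rewrite EFinM.
have [r0'|r0'] := pselect (0 <= r).
  rewrite ge0_integralZl_EFin//; last exact/measurable_EFinP.
  by move=> w _; rewrite lee_fin.
rewrite [X in (_ * X)%E]integral0_eq ?mule0 => [|w _]; last first.
  by rewrite r0// mulr0.
by apply: integral0_eq => w _; rewrite r0// mulr0 mule0.
Qed.

(** For a simple [h] the two means are combinations of integrals over level sets, which are compared
    by hypothesis; monotone convergence extends this to every nonnegative [h]. *)
Lemma integral_mul_le (F : set (set T)) (Y B h : T -> R) :
  F `<=` measurable -> rv_ge0 Y -> rv_ge0 B ->
  (forall C, <<s F >> C ->
     (\int[P]_(w in C) (Y w)%:E <= \int[P]_(w in C) (B w)%:E)%E) ->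
  wrt F h -> (forall w, 0 <= h w) ->
  mean_le P (fun w => Y w * h w) (fun w => B w * h w).
Proof.
move=> Fm hY hB YB mh h0.
have hh : rv_ge0 h by split => //; exact: measurable_wrt mh.
split; [exact: rv_ge0_mul..|].
(* The approximation is built in the sigma-algebra generated by [F], so that the level sets of every
   [hn n] are admissible events. *)
have mEh : measurable_fun (setT : set (g_sigma_algebraType F)) (EFin \o h).
  exact/measurable_EFinP.
pose hn := nnsfun_approx measurableT mEh.
have nd_hn := nd_nnsfun_approx measurableT mEh : nondecreasing_seq _.
have cvg_hn w : EFin \o hn^~ w @ \oo --> (h w)%:E.
  by apply: cvg_nnsfun_approx => // w' _; rewrite lee_fin.
have hnm n : measurable_fun (setT : set T) (hn n).
  by apply: (@measurable_wrt F) => //; exact: measurable_funP.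
have hn0 n w : 0 <= hn n w by exact: fun_ge0.
have cvg_int Z : rv_ge0 Z ->
    ((\int[P]_w (Z w * hn n w)%:E)%E @[n --> \oo] --> \int[P]_w (Z w * h w)%:E)%E.
  move=> [mZ Z0].
  have E w : (Z w * h w)%:E = limn (fun n => (Z w * hn n w)%:E).
    apply/esym/cvg_lim => //; under eq_fun do rewrite EFinM.
    by rewrite EFinM; apply: cvgeZl => //; exact: cvg_hn.
  under [X in _ --> X]eq_integral do rewrite E.
  apply: (@cvg_monotone_convergence _ _ _ P setT measurableT
    (fun n w => (Z w * hn n w)%:E)) => //.
  - by move=> n; apply/measurable_EFinP/measurable_funM.
  - by move=> n w _; rewrite lee_fin mulr_ge0.
  - move=> w _ n n' nn'; rewrite lee_fin ler_wpM2l//.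
    by have /lefP := nd_hn _ _ nn'; apply.
rewrite -(cvg_lim _ (cvg_int _ hY))// -(cvg_lim _ (cvg_int _ hB))//.
apply: lee_lim; [exact: cvgP (cvg_int _ hY)|exact: cvgP (cvg_int _ hB)|].
near=> n; rewrite !integral_mul_simple//; apply: lee_sum => r _.
have [r0|r0] := pselect (0 <= r).
  rewrite lee_wpmul2l//; apply: YB.
  rewrite -[X in <<s F >> X]setTI.
  have mhn : measurable_fun (setT : set (g_sigma_algebraType F)) (hn n).
    exact: measurable_funP.
  exact: (mhn measurableT _ (measurable_set1 r)).
have -> : hn n @^-1` [set r] = set0.
  by apply/seteqP; split => // w /= E; apply: r0; rewrite -E.
by rewrite !integral_set0.
Unshelve. all: by end_near. Qed.

(** Taking out what is known, as an inequality. It is applied with [h] a power of the inverse of the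
    current weight. *)
Lemma condexp_le_mul (F : set (set T)) (Y B h : T -> R) : F `<=` measurable ->
  condexp_le P F Y B -> rv_ge0 B -> wrt F h -> (forall w, 0 <= h w) ->
  mean_le P (fun w => Y w * h w) (fun w => B w * h w).
Proof.
move=> Fm [Z [[mY Y0] mZ Z0 ZE] ZB] hB mh h0.
apply: (@integral_mul_le F) => // C FC.
have mC : measurable C.
  by move: C FC; apply: smallest_sub => //; exact: sigma_algebra_measurable.
rewrite -ZE//; apply: ae_ge0_le_integral => //.
- exact: measurable_funS (measurable_wrt Fm mZ).
- by move=> w _; rewrite lee_fin; case: hB.
- by apply: (@measurable_funS _ _ _ _ setT) => //; apply/measurable_EFinP; case: hB.
- by apply: filterS ZB => w ZBw _.
Qed.

End ConditionalExpectation.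

(** * One step of the algorithm *)

(* Young's inequality bounds |error| |s|^i by a combination of |s|^(p+1) and of
   this power of the error. *)
Definition tensor_error (R : realType) (p n : nat) (f : 'rV[R]_n -> R)
    (A : forall i : nat, tensor R n i) (x : 'rV[R]_n) (i : nat) : R :=
  tnorm (dtensor f i x - A i) `^ (p.+1%:R / (p + 1 - i)%:R).

Section Step.
Context (R : realType) (p n : nat) (f : 'rV[R]_n -> R).
Hypotheses (hp : (1 <= p)%N) (hC : class_C p f).
Context (Lp : R) (hLp : 0 <= Lp).
Hypothesis hlip : forall x y,
  tnorm (dtensor f p x - dtensor f p y) <= Lp * enorm (x - y).
Context (A : forall i : nat, tensor R n i) (sigma : R) (x s : 'rV[R]_n).
Hypothesis sigma_ge0 : 0 <= sigma.
Hypothesis decrease : model p f A sigma x s - model p f A sigma x 0 <= 0.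

Local Notation q := (p.+1%:R / p%:R : R).
Local Notation r := (enorm s).
Local Notation fact1 := ((p.+1)`!%:R : R).
Local Notation D i := (tnorm (dtensor f i x - A i)).
Local Notation err := (tensor_error p f A x).

Let p_gt0 : 0 < p%:R :> R. Proof. by rewrite ltr0n. Qed.
Let r_ge0 : 0 <= r. Proof. exact: enorm_ge0. Qed.
Let D_ge0 i : 0 <= D i :> R. Proof. exact: tnorm_ge0. Qed.
Let fact_gt0' k : 0 < k`!%:R :> R. Proof. by rewrite ltr0n fact_gt0. Qed.
Let q_gt1 : 1 < q. Proof. by rewrite ltr_pdivlMr// mul1r ltr_nat. Qed.
Let q_subr1 : q - 1 = p%:R^-1.
Proof. by rewrite -natr1 mulrDl divff ?gt_eqF// mul1r addrAC subrr add0r. Qed.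

Lemma tpow0 i (B : tensor R n i) : (0 < i)%N -> tpow B 0 = 0.
Proof.
case: i B => // i B _; rewrite /tpow /tapp big1// => J _.
by rewrite big_ord_recl mxE mul0r mulr0.
Qed.

Lemma model_decrease :
  \sum_(1 <= i < p.+1) (i`!%:R)^-1 * tpow (A i) s + sigma / fact1 * r ^+ p.+1 <= 0.
Proof.
move: decrease; rewrite /model /taylor enorm0 expr0n/= mulr0 addr0.
have -> : \sum_(1 <= i < p.+1) (i`!%:R)^-1 * tpow (A i) 0 = 0.
  rewrite big_nat_cond big1// => i /andP[/andP[i0 _] _].
  by rewrite tpow0// mulr0.
lra.
Qed.

(** The exact Taylor polynomial is the approximate one plus an error. [model_decrease] bounds the
    approximate part, and Young's inequality splits each error term into a power of the step,
    collected in [chi1], and a power of the error. *)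
Lemma value_decrease :
  f (x + s) + sigma / fact1 * r ^+ p.+1 <= f x + kappa_a p Lp * r ^+ p.+1
    + \sum_(1 <= i < p.+1) (p + i - 1)%:R / (i`!%:R * p.+1%:R) * err i.
Proof.
have H1 := taylor_value_bound hC hlip x s hp.
have H2 := model_decrease.
have H3 : \sum_(1 <= i < p.+1) (i`!%:R)^-1 * tpow (dtensor f i x) s <=
    \sum_(1 <= i < p.+1) (i`!%:R)^-1 * tpow (A i) s + chi1 R p * r ^+ p.+1
    + \sum_(1 <= i < p.+1) (p + i - 1)%:R / (i`!%:R * p.+1%:R) * err i.
  rewrite /chi1 mulr_suml -!big_split/= big_nat_cond [leRHS]big_nat_cond.
  apply: ler_sum => i /andP[/andP[i1 ip] _].
  have E : tpow (dtensor f i x) s = tpow (A i) s + tpow (dtensor f i x - A i) s.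
    by rewrite /tpow tappB addrC subrK.
  rewrite E mulrDr -addrA lerD2l.
  have Y : D i * r ^+ i <= i%:R / p.+1%:R * r ^+ p.+1
      + (p + i - 1)%:R / p.+1%:R * err i.
    have iN : (0 < i < p.+1)%N by rewrite i1.
    apply: le_trans (young_exprn iN (D_ge0 i) r_ge0) _.
    rewrite lerD2l /tensor_error addn1 ler_wpM2r ?powR_ge0// ler_wpM2r ?invr_ge0//.
    (* Young's inequality gives p + 1 - i, which is at most the numerator p + i - 1 of [chi2]
       because i is at least 1. *)
    by rewrite ler_nat; lia.
  have := le_trans (tpow_le_tnorm _ _) Y.
  have c0 : 0 <= (i`!%:R)^-1 :> R by rewrite invr_ge0.
  move=> /(ler_wpM2l c0)/le_trans; apply; rewrite mulrDr !mulrA !invfM.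
  by rewrite le_eqVlt; apply/orP; left; apply/eqP; ring.
move: H1; rewrite /taylor /kappa_a mulrDl; lra.
Qed.

Lemma model_gradient_error :
  enorm (grad (taylor p f (fun i => dtensor f i x) x) s
         - grad (taylor p f A x) s)
    <= \sum_(1 <= i < p.+1) D i * r ^+ (i - 1) / (i - 1)`!%:R.
Proof.
apply: enorm_le_dual => [|u].
  by apply: sumr_ge0 => i _; rewrite divr_ge0 ?mulr_ge0 ?exprn_ge0.
have -> : \sum_j (grad (taylor p f (fun i => dtensor f i x) x) s
      - grad (taylor p f A x) s) 0 j * u 0 j =
    \sum_(1 <= i < p.+1) (i`!%:R)^-1
      * \sum_(l < i) tapp (dtensor f i x - A i) (slot_set (fun=> s) l u).
  under eq_bigr do rewrite !mxE mulrBl.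
  rewrite sumrB.
  have E B : \sum_j 'D_(delta_mx 0 j) (taylor p f B x) s * u 0 j =
      \sum_(1 <= i < p.+1) (i`!%:R)^-1
        * \sum_(l < i) tapp (B i) (slot_set (fun=> s) l u).
    by rewrite -(grad_taylor_dot p f B x s u); apply: eq_bigr => j _; rewrite mxE mulrC.
  rewrite !E -sumrB; apply: eq_bigr => i _; rewrite -mulrBr -sumrB.
  by congr (_ * _); apply: eq_bigr => l _; rewrite tappB.
rewrite mulr_suml big_nat_cond [leRHS]big_nat_cond.
apply: ler_sum => -[|i] // _; rewrite subSS subn0.
apply: (@le_trans _ _ ((i.+1`!%:R)^-1
    * \sum_(l < i.+1) D i.+1 * r ^+ i * enorm u)).
  rewrite ler_wpM2l ?invr_ge0//; apply: ler_sum => l _.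
  exact: le_trans (ler_norm _) (tapp_slot_le_tnorm _ _ _ _).
rewrite sumr_const card_ord -(mulr_natr (_ * _)) factS natrM invfM.
rewrite le_eqVlt; apply/orP; left; apply/eqP; rewrite mulrC -!mulrA.
congr (_ * _); congr (_ * _); rewrite mulVKf ?pnatr_eq0// mulrC//.
Qed.

Lemma next_grad_bound (theta1 : R) :
  enorm (grad (taylor p f A x) s) <= theta1 * (sigma / p`!%:R) * r ^+ p ->
  enorm (grad f (x + s)) <=
    Lp / p`!%:R * r ^+ p + \sum_(1 <= i < p.+1) D i * r ^+ (i - 1) / (i - 1)`!%:R
    + theta1 * (sigma / p`!%:R) * r ^+ p.
Proof.
move=> hg; pose a := grad (taylor p f (fun i => dtensor f i x) x) s.
pose b := grad (taylor p f A x) s.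
have -> : grad f (x + s) = (grad f (x + s) - a) + (a - b) + b.
  by rewrite addrA !subrK.
apply: le_trans (enormD _ _) (lerD _ hg).
apply: le_trans (enormD _ _) (lerD _ model_gradient_error).
exact: taylor_grad_bound.
Qed.

(** The coefficients add up to [chi4], so a mean bound common to all orders is multiplied by
    [chi4]. *)
Definition grad_error : R := err 1%N + \sum_(2 <= i < p.+1)
   ((p - i + 1)%:R / ((i - 1)`!%:R * p%:R)) `^ q * err i.

Lemma exprn_powR (a : R) : 0 <= a -> (a ^+ p) `^ q = a ^+ p.+1.
Proof.
move=> a0; rewrite -!powR_mulrn// -powRrM; congr (_ `^ _).
by rewrite mulrCA divff ?mulr1// gt_eqF.
Qed.

Lemma next_grad_powR (theta1 : R) : 0 <= theta1 ->
  enorm (grad (taylor p f A x) s) <= theta1 * (sigma / p`!%:R) * r ^+ p ->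
  enorm (grad f (x + s)) `^ q <= 2 `^ p%:R^-1 *
    (kappa_b p Lp * r ^+ p.+1 + kappa_p R p * grad_error
     + theta1 `^ q / p`!%:R `^ q * (sigma `^ q * r ^+ p.+1)).
Proof.
move=> th0 hg; have H := next_grad_bound hg.
have q0 : 0 < q by apply: lt_trans q_gt1.
(* Young's inequality splits term [i] of the gradient error into [alpha i * r ^+ p] and [beta i].
   The term [i = 1] carries no power of [r], and its free place is taken by the Lipschitz
   remainder. *)
pose alpha i : R := if i == 1%N then Lp / p`!%:R
  else (i - 1)%:R / ((i - 1)`!%:R * p%:R).
pose beta i : R := if i == 1%N then D 1%N
  else (p - i + 1)%:R / ((i - 1)`!%:R * p%:R) * D i `^ (p%:R / (p - i + 1)%:R).
have alpha0 i : 0 <= alpha i.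
  by rewrite /alpha; case: ifP => _; rewrite divr_ge0// mulr_ge0.
have beta0 i : 0 <= beta i.
  rewrite /beta; case: ifP => _//.
  by rewrite mulr_ge0 ?powR_ge0// divr_ge0// mulr_ge0.
set b := theta1 * (sigma / p`!%:R) * r ^+ p in H.
have b0 : 0 <= b by rewrite /b !mulr_ge0 ?invr_ge0 ?exprn_ge0.
have H' : enorm (grad f (x + s))
    <= \sum_(1 <= i < p.+1) (alpha i * r ^+ p + beta i) + b.
  apply: le_trans H _; rewrite lerD2r big_ltn// [leRHS]big_ltn//.
  rewrite subnn expr0 mulr1 divr1 addrA lerD//.
  rewrite big_nat_cond [leRHS]big_nat_cond.
  apply: ler_sum => i /andP[/andP[i2 ip] _].
  have i1 : (i == 1%N) = false by apply: gtn_eqF.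
  rewrite /alpha /beta i1.
  have iN : (0 < i - 1 < p)%N by rewrite subn_gt0 i2 ltn_subLR// ltnW.
  have := young_exprn iN (D_ge0 i) r_ge0.
  have -> : (p - (i - 1))%N = (p - i + 1)%N by rewrite subnBA 1?ltnW// -addnBAC.
  have c0 : 0 <= ((i - 1)`!%:R)^-1 :> R by rewrite invr_ge0.
  move=> /(ler_wpM2r c0)/le_trans; apply; rewrite mulrDl !invfM.
  by rewrite le_eqVlt; apply/orP; left; apply/eqP; ring.
have S0 : 0 <= \sum_(1 <= i < p.+1) (alpha i * r ^+ p + beta i).
  by apply: sumr_ge0 => i _; rewrite addr_ge0// mulr_ge0// exprn_ge0.
apply: (@le_trans _ _ ((\sum_(1 <= i < p.+1) (alpha i * r ^+ p + beta i) + b) `^ q)).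
  by rewrite ge0_ler_powR ?nnegrE ?enorm_ge0 ?(ltW q0) ?addr_ge0.
apply: le_trans (power_mean2 q_gt1 S0 b0) _.
rewrite q_subr1 ler_wpM2l ?powR_ge0//; apply: lerD; last first.
  rewrite /b !powRM ?mulr_ge0 ?invr_ge0 ?exprn_ge0//.
  rewrite exprn_powR// -(powR_inv1 (_ : 0 <= p`!%:R)) // (powRAC _ (-1)).
  by rewrite powR_inv1 ?powR_ge0// !mulrA -(mulrA (theta1 `^ q)) (mulrC (sigma `^ q)) mulrA.
apply: le_trans (power_mean _ q_gt1 _) _ => [i|].
  by rewrite addr_ge0// mulr_ge0// exprn_ge0.
(* The [p] summands have two parts each: the factors p^(1/p) and 2^(1/p) make up [kappa_p]. The
   outer 2^(1/p) comes from splitting off the term [b] of the step condition. *)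
rewrite size_iota subn1/= q_subr1.
apply: (@le_trans _ _ (p%:R `^ p%:R^-1 * (\sum_(1 <= i < p.+1)
   2 `^ p%:R^-1 * (alpha i `^ q * r ^+ p.+1 + beta i `^ q)))).
  rewrite ler_wpM2l ?powR_ge0//; apply: ler_sum => i _.
  apply: le_trans (power_mean2 q_gt1 _ _) _ => //.
    by rewrite mulr_ge0// exprn_ge0.
  by rewrite q_subr1 powRM ?exprn_ge0// exprn_powR.
rewrite -mulr_sumr mulrA -powRM// (mulrC p%:R) -/(kappa_p R p).
rewrite big_split/= -mulr_suml /kappa_b -mulrA -mulrDr ler_wpM2l ?powR_ge0//.
rewrite le_eqVlt; apply/orP; left; apply/eqP; congr (_ * _ + _).
  rewrite big_ltn//; congr (_ + _); rewrite /chi3 big_nat_cond [RHS]big_nat_cond.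
  apply: eq_bigr => i /andP[/andP[i2 ip] _].
  by rewrite /alpha gtn_eqF.
rewrite big_ltn// /grad_error /tensor_error addn1 subn1/=; congr (_ + _).
rewrite big_nat_cond [RHS]big_nat_cond.
apply: eq_bigr => i /andP[/andP[i2 ip] _].
rewrite /beta gtn_eqF// powRM ?powR_ge0 ?divr_ge0 ?mulr_ge0//; congr (_ * _).
rewrite -powRrM; congr (_ `^ _).
have -> : (p.+1 - i)%N = (p - i + 1)%N by rewrite subSn// addn1.
by rewrite mulrC mulrA mulfVK// gt_eqF.
Qed.

Context (sigma0 : R) (sigma0_gt0 : 0 < sigma0) (sigma0_le : sigma0 <= sigma).
Context (khigh : R) (hkhigh : 0 <= khigh).
Hypothesis hhigh : forall i, (2 <= i <= p)%N ->
  forall v, enorm v <= 1 -> - khigh <= tpow (A i) v.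

Lemma tpowZ i (B : tensor R n i) (c : R) v : tpow B (c *: v) = c ^+ i * tpow B v.
Proof.
by rewrite /tpow (tapp_scale B (fun=> c) (fun=> v)) prodr_const card_ord.
Qed.

Lemma tpow_lower i : (2 <= i <= p)%N -> - (khigh * r ^+ i) <= tpow (A i) s.
Proof.
move=> ip; have [r0|r0] := eqVneq r 0.
  have i0 : (0 < i)%N by lia.
  by rewrite (enorm_eq0 r0) tpow0// enorm0 expr0n gtn_eqF// mulr0 oppr0.
have sE : s = r *: (r^-1 *: s) by rewrite scalerA divff// scale1r.
rewrite {2}sE tpowZ -mulNr mulrC ler_wpM2l ?exprn_ge0// hhigh//.
by rewrite enormZ ger0_norm ?invr_ge0// mulVf.
Qed.

Lemma gradient_tpow : - ((enorm (grad f x) + D 1) * r) <= tpow (A 1) s.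
Proof.
have E : tpow (A 1) s = tpow (dtensor f 1 x) s - tpow (dtensor f 1 x - A 1) s.
  by rewrite /tpow tappB subKr.
have gE : tpow (dtensor f 1 x) s = \sum_j grad f x 0 j * s 0 j.
  rewrite /tpow /tapp (reindex (fun j : 'I_n => [tuple j]))/=.
    by apply: eq_bigr => j _; rewrite big_ord1 ffunE/= mxE.
  exists (fun J => thead J) => [j _|J _]; first by rewrite theadE.
  by case/tupleP: J => j J; rewrite theadE; apply: val_inj => /=;
    congr (_ :: _); rewrite (size0nil (size_tuple J)).
have h1 := tpow_le_tnorm (dtensor f 1 x - A 1) s.
have h2 : - (enorm (grad f x) * r) <= tpow (dtensor f 1 x) s.
  rewrite gE lerNl -sumrN -enormN.
  apply: le_trans (cauchy_schwarz _ _).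
  by rewrite le_eqVlt; apply/orP; left; apply/eqP/eq_bigr => j _; rewrite !mxE mulNr.
rewrite E; move: h1; rewrite expr1; lra.
Qed.

Lemma step_length_bound : r ^+ p.+1 <= 2 ^+ p.+1 * Defs.eta p sigma0 khigh ^+ p.+1
  + 2 ^+ p.+1 * fact1 `^ q
    * (2 `^ p%:R^-1 * ((enorm (grad f x) `^ q + err 1) / sigma `^ q)).
Proof.
have sig0 : 0 < sigma by apply: lt_le_trans sigma0_le.
set et := Defs.eta p sigma0 khigh.
have et0 : 0 <= et by apply: bigmax_ge_id.
pose g := enorm (grad f x) + D 1.
have g0 : 0 <= g by rewrite addr_ge0 ?enorm_ge0.
pose b := fact1 * g / sigma.
have b0 : 0 <= b by rewrite divr_ge0 ?mulr_ge0// ltW.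
(* After division by the leading coefficient, the coefficient of index [i] must be at most
   [M ^+ (p - i + 1)]: [eta] ensures this for [i] at least 2, and the p-th root of [b] for
   [i = 1]. *)
pose M := Num.max et (b `^ p%:R^-1).
have M0 : 0 <= M by rewrite le_max et0.
have bM : b <= M ^+ p.
  have -> : b = (b `^ p%:R^-1) ^+ p.
    by rewrite -powR_mulrn ?powR_ge0// -powRrM mulVf ?powRr1// gt_eqF.
  by rewrite lerXn2r ?nnegrE ?powR_ge0// le_max lexx orbT.
have rM : r <= 2 * M.
  have [->|rn0] := eqVneq r 0; first by rewrite mulr_ge0.
  have r0 : 0 < r by rewrite lt_neqAle eq_sym rn0.
  apply: (@root_bound _ p) => //.
  rewrite -(ler_pM2r r0) -exprSr.
  rewrite -(ler_pM2l (_ : 0 < sigma / fact1)) ?divr_gt0//.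
  have := model_decrease; rewrite big_ltn// [(1`!%:R)^-1]invr1 mul1r => H.
  have H1 := gradient_tpow.
  have H2 : - \sum_(2 <= i < p.+1) (i`!%:R)^-1 * (khigh * r ^+ i)
      <= \sum_(2 <= i < p.+1) (i`!%:R)^-1 * tpow (A i) s.
    rewrite -sumrN big_nat_cond [leRHS]big_nat_cond.
    apply: ler_sum => i /andP[/andP[i2 ip] _].
    by rewrite -mulrN ler_wpM2l ?invr_ge0// tpow_lower// i2 -ltnS.
  apply: (@le_trans _ _ (g * r
      + \sum_(2 <= i < p.+1) (i`!%:R)^-1 * (khigh * r ^+ i))).
    by move: H H1; rewrite /g; lra.
  rewrite [X in _ <= _ * (X * _)]big_ltn// subnn expr0 mulr1 (subnK hp).
  rewrite [X in _ <= _ * X]mulrDl [leRHS]mulrDr; apply: lerD.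
    rewrite mulrA ler_wpM2r//.
    have -> : g = sigma / fact1 * b.
      by rewrite /b; field; rewrite !gt_eqF.
    by rewrite ler_wpM2l ?divr_ge0// ltW.
  rewrite mulr_suml mulr_sumr big_nat_cond [leRHS]big_nat_cond.
  apply: ler_sum => i /andP[/andP[i2 ip] _].
  have i0 : (0 < i)%N := ltnW i2.
  pose c := khigh * fact1 / (i`!%:R * sigma0).
  have c0 : 0 <= c by rewrite divr_ge0 ?mulr_ge0// ltW.
  have cM : c <= M ^+ (p - i + 1).
    have -> : c = (c `^ (p - i + 1)%:R^-1) ^+ (p - i + 1).
      rewrite -powR_mulrn ?powR_ge0// -powRrM mulVf ?powRr1//.
    rewrite lerXn2r ?nnegrE ?powR_ge0// le_max; apply/orP; left.
    rewrite /et /Defs.eta; apply: (@le_bigmax_seq _ _ _ _ 0 i xpredT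
      (fun i => (khigh * fact1 / (i`!%:R * sigma0)) `^ (p - i + 1)%:R^-1)) => //.
    by rewrite mem_index_iota i2.
  apply: (@le_trans _ _ (sigma / fact1 * (c * r ^+ i))); last first.
    rewrite ler_wpM2l ?divr_ge0 ?(ltW sig0)//.
    by rewrite -[leRHS]mulrA -exprSr subn1 prednK// ler_wpM2r ?exprn_ge0.
  have -> : sigma / fact1 * (c * r ^+ i)
      = sigma / sigma0 * ((i`!%:R)^-1 * (khigh * r ^+ i)).
    by rewrite /c; field; rewrite !gt_eqF.
  (* [eta] is defined with [sigma0] in place of the current weight; the quotient [sigma / sigma0] is
     at least 1. *)
  rewrite ler_peMl ?mulr_ge0 ?invr_ge0 ?exprn_ge0//.
  by rewrite ler_pdivlMr// mul1r.
apply: (@le_trans _ _ ((2 * M) ^+ p.+1)).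
  by rewrite lerXn2r ?nnegrE ?mulr_ge0.
rewrite exprMn -mulrA -mulrDr ler_wpM2l ?exprn_ge0//.
have MB : M ^+ p.+1 <= et ^+ p.+1 + b `^ q.
  have bq : (b `^ p%:R^-1) ^+ p.+1 = b `^ q.
    by rewrite -powR_mulrn ?powR_ge0// -powRrM mulrC.
  rewrite /M maxEle; case: ifP => _; rewrite -?bq.
    by rewrite lerDr exprn_ge0.
  by rewrite lerDl exprn_ge0// powR_ge0.
apply: le_trans MB _; rewrite lerD2l.
have -> : b `^ q = fact1 `^ q * (g `^ q / sigma `^ q).
  rewrite /b !powRM ?mulr_ge0 ?invr_ge0 ?(ltW sig0)// -mulrA; congr (_ * (_ * _)).
  by rewrite -(powR_inv1 (ltW sig0)) powRAC powR_inv1 ?powR_ge0.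
rewrite ler_wpM2l ?powR_ge0// mulrA ler_wpM2r ?invr_ge0 ?powR_ge0//.
have := power_mean2 q_gt1 (enorm_ge0 (grad f x)) (D_ge0 1).
by rewrite q_subr1 /tensor_error addn1 subn1.
Qed.

End Step.

(** * Sequences of weights *)

Section GrowthSequences.
Context (R : realType) (p m : nat) (sigma0 : R) (sg a : nat -> R).
Hypotheses (hp : (0 < p)%N) (sigma0_gt0 : 0 < sigma0).
Hypothesis sg_init : forall t, (t <= m)%N -> sg t = sigma0 / 2 ^+ (m - t).
Hypothesis sg_succ : forall t, sg t.+1 = sg t + sg t * a t.
Hypothesis a_ge0 : forall t, 0 <= a t.
Hypothesis a_init : forall t, (t < m)%N -> a t = 1.

Local Notation q := (p.+1%:R / p%:R : R).

Definition relative_increment (t : nat) : R := 1 - sg t / sg t.+1.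
Local Notation u := relative_increment.

Let p_gt0 : 0 < p%:R :> R. Proof. by rewrite ltr0n. Qed.

Lemma growth_m : sg m = sigma0.
Proof. by rewrite sg_init// subnn expr0 divr1. Qed.

Lemma growth_gt0 t : 0 < sg t.
Proof.
elim: t => [|t IH]; first by rewrite sg_init// divr_gt0// exprn_gt0.
by rewrite sg_succ ltr_pwDl// mulr_ge0// ltW.
Qed.

Lemma growth_le t t' : (t <= t')%N -> sg t <= sg t'.
Proof.
move=> /subnK <-; elim: (t' - t)%N => // k IH.
by rewrite addSn sg_succ (le_trans IH)// lerDl mulr_ge0// ltW// growth_gt0.
Qed.

Lemma growth_lower t : sigma0 / 2 ^+ m <= sg t.
Proof.
have := growth_le (leq0n t).
by rewrite [sg 0]sg_init// subn0.
Qed.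

Lemma relative_increment_ge0 t : 0 <= u t.
Proof.
by rewrite subr_ge0 ler_pdivrMr ?growth_gt0// mul1r growth_le.
Qed.

Lemma relative_increment_le1 t : u t <= 1.
Proof. by rewrite gerBl divr_ge0// ltW// growth_gt0. Qed.

Lemma relative_incrementE t : u t = sg t * a t / sg t.+1.
Proof.
have g1 := growth_gt0 t.+1.
rewrite /relative_increment -{1}(@divff _ (sg t.+1)) ?gt_eqF// -mulrBl.
by rewrite {1}sg_succ addrAC subrr add0r.
Qed.

(** The relative increment is a / (1 + a). In this form a bound on [a] inserted on the right is
    multiplied by a quantity whose sum is logarithmic. *)
Lemma increment_split t : a t = u t * (1 + a t).
Proof.
have g0 := growth_gt0 t.
have a1 : 0 < 1 + a t by rewrite ltr_pwDl.
rewrite relative_incrementE sg_succ.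
have -> : sg t + sg t * a t = sg t * (1 + a t) by ring.
by field; rewrite !gt_eqF.
Qed.

Lemma relative_increment_le_ln t : u t <= ln (sg t.+1) - ln (sg t).
Proof.
have g0 := growth_gt0 t; have g1 := growth_gt0 t.+1.
have : ln (sg t / sg t.+1) <= sg t / sg t.+1 - 1.
  by rewrite ln_le_subr1// divr_gt0.
rewrite ln_div ?posrE// /relative_increment; lra.
Qed.

Lemma sum_relative_increment t N :
  \sum_(0 <= j < N) u (j + t) <= ln (sg (N + t)) - ln (sg t).
Proof.
elim: N => [|N IH]; first by rewrite big_nil subrr.
rewrite big_nat_recr//= addSn.
have := relative_increment_le_ln (N + t); lra.
Qed.

Lemma powq_split c : 0 < c -> c `^ q = c * c `^ p%:R^-1.
Proof.
move=> c0; rewrite -natr1 mulrDl divff ?gt_eqF// mul1r powRD ?powRr1 ?ltW//.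
by apply/implyP => _; rewrite gt_eqF.
Qed.

(** As [a t] is [u t * sg t.+1 / sg t], one power of [sg k] absorbs [sg t.+1]. The index [t] may lie
    in the conventional past, where [sg t] is only known to be at least [sigma0 / 2 ^+ m]; hence the
    factor [2 ^+ m] of [kappa_d]. *)
Lemma increment_div_powq t k : (t < k)%N -> (m <= k)%N ->
  a t / sg k `^ q <= 2 ^+ m / sigma0 `^ q * u t.
Proof.
move=> tk mk; have gk := growth_gt0 k; have g0 := growth_gt0 t.
have g1 := growth_gt0 t.+1.
have s1 : 0 < sigma0 `^ p%:R^-1 by rewrite powR_gt0.
have aE : a t = u t * sg t.+1 / sg t.
  by rewrite relative_incrementE; field; rewrite !gt_eqF.
rewrite ler_pdivrMr ?powR_gt0// powq_split// powq_split// aE.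
have -> : 2 ^+ m / (sigma0 * sigma0 `^ p%:R^-1) * u t * (sg k * sg k `^ p%:R^-1)
   = u t * (sg k * (2 ^+ m / sigma0) * (sg k `^ p%:R^-1 / sigma0 `^ p%:R^-1)).
  by field; rewrite !gt_eqF.
rewrite -mulrA ler_wpM2l ?relative_increment_ge0//.
rewrite -[leLHS]mulr1 ler_pM//.
- by rewrite divr_ge0// ltW.
- rewrite ler_pM ?invr_ge0 ?(ltW g0) ?(ltW g1)// ?growth_le//.
  rewrite -[leRHS]invrK lef_pV2 ?posrE ?invr_gt0 ?divr_gt0 ?exprn_gt0//.
  by rewrite invf_div growth_lower.
- rewrite ler_pdivlMr// mul1r ge0_ler_powR ?nnegrE ?invr_ge0 ?(ltW gk)//.
  + exact: ltW.
  + by rewrite -[leLHS]growth_m growth_le.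
Qed.

(** With one power of the weight less in the divisor, [sg t.+1] is no longer absorbed, and the
    absolute increment [sg t * a t] appears instead of the relative one. *)
Lemma increment_div_powp t k : (t < k)%N -> (m <= k)%N ->
  a t / sg k `^ p%:R^-1 <= 2 ^+ m / sigma0 `^ q * (sg t.+1 - sg t).
Proof.
move=> tk mk; have gk := growth_gt0 k; have g0 := growth_gt0 t.
have s1 : 0 < sigma0 `^ p%:R^-1 by rewrite powR_gt0.
rewrite sg_succ addrAC subrr add0r powq_split//.
have -> : 2 ^+ m / (sigma0 * sigma0 `^ p%:R^-1) * (sg t * a t)
    = a t * ((sg t * (2 ^+ m / sigma0)) * (sigma0 `^ p%:R^-1)^-1).
  by field; rewrite !gt_eqF.
rewrite ler_wpM2l// -[leLHS]mul1r ler_pM ?invr_ge0 ?powR_ge0//.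
  rewrite -ler_pdivrMr ?divr_gt0 ?exprn_gt0// div1r invf_div.
  exact: growth_lower.
rewrite lef_pV2 ?posrE ?powR_gt0// ge0_ler_powR ?nnegrE ?invr_ge0 ?(ltW gk)//.
  exact: ltW.
by rewrite -[leLHS]growth_m growth_le.
Qed.

Lemma growth_powp_le t k : (t <= k)%N -> sg t `^ p%:R^-1 <= sg k `^ p%:R^-1.
Proof.
move=> tk; have g0 := growth_gt0 t; have gk := growth_gt0 k.
by rewrite ge0_ler_powR ?nnegrE ?invr_ge0 ?growth_le ?(ltW gk)// ltW.
Qed.

(** From index [m] on the weight is at least [sigma0], so the factor [2 ^+ m] is absent here and in
    [kappa_c]. *)
Lemma increment_div_powq_succ t : (m <= t)%N ->
  a t / sg t.+1 `^ q <= (sigma0 `^ q)^-1 * u t.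
Proof.
move=> mt; have g0 := growth_gt0 t; have g1 := growth_gt0 t.+1.
have s1 : 0 < sigma0 `^ p%:R^-1 by rewrite powR_gt0.
have c1 : 0 < sg t.+1 `^ p%:R^-1 by rewrite powR_gt0.
have -> : a t / sg t.+1 `^ q = u t * ((sg t)^-1 * (sg t.+1 `^ p%:R^-1)^-1).
  by rewrite relative_incrementE powq_split//; field; rewrite !gt_eqF.
rewrite mulrC powq_split// invfM ler_wpM2r ?relative_increment_ge0//.
apply: ler_pM.
- by rewrite invr_ge0 ltW.
- by rewrite invr_ge0 ltW.
- by rewrite lef_pV2 ?posrE// -[leLHS]growth_m growth_le.
- by rewrite lef_pV2 ?posrE// -growth_m growth_powp_le// leqW.
Qed.

Lemma weighted_increment_div_powq t :
  sg t `^ q * a t / sg t.+1 `^ q <= u t.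
Proof.
have g0 := growth_gt0 t; have g1 := growth_gt0 t.+1.
have c1 : 0 < sg t.+1 `^ p%:R^-1 by rewrite powR_gt0.
have -> : sg t `^ q * a t / sg t.+1 `^ q
    = u t * (sg t `^ p%:R^-1 / sg t.+1 `^ p%:R^-1).
  by rewrite relative_incrementE !powq_split//; field; rewrite !gt_eqF.
rewrite ler_piMr ?relative_increment_ge0// ler_pdivrMr// mul1r.
exact: growth_powp_le.
Qed.

Lemma increment_div_powp_succ t : (m <= t)%N ->
  a t / sg t.+1 `^ p%:R^-1 <= (sigma0 `^ q)^-1 * (sg t.+1 - sg t).
Proof.
move=> mt; have g0 := growth_gt0 t.
have s1 : 0 < sigma0 `^ p%:R^-1 by rewrite powR_gt0.
have c1 : 0 < sg t.+1 `^ p%:R^-1 by rewrite powR_gt0 ?growth_gt0.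
rewrite {2}sg_succ addrAC subrr add0r powq_split//.
have -> : (sigma0 * sigma0 `^ p%:R^-1)^-1 * (sg t * a t)
    = a t * ((sg t / sigma0) * (sigma0 `^ p%:R^-1)^-1).
  by field; rewrite !gt_eqF.
rewrite ler_wpM2l// -[leLHS]mul1r ler_pM ?invr_ge0 ?(ltW c1)//.
  by rewrite ler_pdivlMr// mul1r -[leLHS]growth_m growth_le.
by rewrite lef_pV2 ?posrE// -growth_m growth_powp_le// leqW.
Qed.

Lemma weighted_increment_div_powp t :
  sg t `^ q * a t / sg t.+1 `^ p%:R^-1 <= sg t.+1 - sg t.
Proof.
have g0 := growth_gt0 t.
have c1 : 0 < sg t.+1 `^ p%:R^-1 by rewrite powR_gt0 ?growth_gt0.
rewrite {2}sg_succ addrAC subrr add0r powq_split// ler_pdivrMr//.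
rewrite mulrAC ler_wpM2l ?growth_powp_le// mulr_ge0// ltW//.
Qed.

Lemma sum_natr_triangle k : \sum_(1 <= i < k.+1) i%:R = k%:R * (k%:R + 1) / 2 :> R.
Proof.
elim: k => [|k IH]; first by rewrite big_nil mul0r mul0r.
by rewrite big_nat_recr//= IH -natr1; field.
Qed.

(** For each shift [i] the sum telescopes from the conventional weight [sigma0 / 2 ^+ i], which
    costs [i] times [ln 2]. When the window is advanced by one, the cost is [i - 1] times [ln 2];
    these are the two multiples of [ln 2] in [kappa_e]. *)
Lemma sum_window_relative_increment k :
  \sum_(0 <= j < k) \sum_(1 <= i < m.+1) u (j + m - i)
    <= m%:R * ln (sg (k + m) / sigma0) + m%:R * (m%:R + 1) / 2 * ln 2.
Proof.
have gk := growth_gt0 (k + m).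
rewrite exchange_big/= -sum_natr_triangle mulr_suml.
have -> : m%:R * ln (sg (k + m) / sigma0)
    = \sum_(1 <= i < m.+1) ln (sg (k + m) / sigma0).
  by rewrite sumr_const_nat subn1/= mulr_natl.
rewrite -big_split/= big_nat_cond [leRHS]big_nat_cond.
apply: ler_sum => i /andP[/andP[i1 im] _].
rewrite (eq_bigr (fun j => u (j + (m - i)))) => [|j _]; last by rewrite addnBA.
apply: le_trans (sum_relative_increment _ _) _.
rewrite (sg_init (leq_subr _ _)) subKn// !ln_div ?posrE ?exprn_gt0//.
rewrite lnXn// -mulr_natl.
have : ln (sg (k + (m - i))) <= ln (sg (k + m)).
  by rewrite ler_ln ?posrE ?growth_gt0// growth_le// leq_add2l leq_subr.
lra.
Qed.

Lemma sum_window_relative_increment_succ k :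
  \sum_(0 <= j < k) \sum_(1 <= i < m.+1) u (j.+1 + m - i)
    <= m%:R * ln (sg (k + m) / sigma0) + m%:R * (m%:R - 1) / 2 * ln 2.
Proof.
have gk := growth_gt0 (k + m).
have mE : m%:R * (m%:R - 1) / 2 * ln 2
    = \sum_(1 <= i < m.+1) (i%:R - 1) * ln 2 :> R.
  rewrite -mulr_suml sumrB sum_natr_triangle sumr_const_nat subn1/=.
  by congr (_ * _); field.
rewrite exchange_big/= mE.
have -> : m%:R * ln (sg (k + m) / sigma0)
    = \sum_(1 <= i < m.+1) ln (sg (k + m) / sigma0).
  by rewrite sumr_const_nat subn1/= mulr_natl.
rewrite -big_split/= big_nat_cond [leRHS]big_nat_cond.
apply: ler_sum => i /andP[/andP[i1 im] _].
have im' : (i.-1 <= m)%N by rewrite (leq_trans (leq_pred _)).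
rewrite (eq_bigr (fun j => u (j + (m - i.-1)))) => [|j _]; last first.
  by rewrite addnBA// -{1}(prednK i1) addSn subSS.
apply: le_trans (sum_relative_increment _ _) _.
rewrite (sg_init (leq_subr _ _)) subKn// !ln_div ?posrE ?exprn_gt0//.
have -> : i%:R - 1 = i.-1%:R :> R by rewrite -{1}(prednK i1) -natr1 addrK.
rewrite lnXn// -mulr_natl.
have : ln (sg (k + (m - i.-1))) <= ln (sg (k + m)).
  by rewrite ler_ln ?posrE ?growth_gt0// growth_le// leq_add2l leq_subr.
lra.
Qed.

Lemma sum_window_increment k :
  \sum_(0 <= j < k) \sum_(1 <= i < m.+1) a (j + m - i)
    <= m%:R * (m%:R + 1) / 2 + m%:R * \sum_(0 <= j < k) a (j + m).
Proof.
rewrite exchange_big/= -sum_natr_triangle.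
have -> : m%:R * \sum_(0 <= j < k) a (j + m)
    = \sum_(1 <= i < m.+1) \sum_(0 <= j < k) a (j + m).
  by rewrite sumr_const_nat subn1/= mulr_natl.
rewrite -big_split/= big_nat_cond [leRHS]big_nat_cond.
apply: ler_sum => i /andP[/andP[i1 im] _].
(* The range is extended so that its first [i] terms are the conventional ones, equal to 1, and the
   other [k] terms form the unshifted sum. *)
apply: (@le_trans _ _ (\sum_(0 <= j < i + k) a (j + m - i))).
  rewrite [leRHS](@big_cat_nat _ _ _ k)//= ?leq_addl// lerDl.
  by apply: sumr_ge0.
rewrite [leLHS](@big_cat_nat _ _ _ i)//= ?leq_addr// lerD//.
  rewrite big_nat_cond (eq_bigr (fun=> 1)) => [|j /andP[/andP[_ ji] _]].
    by rewrite -big_nat_cond sumr_const_nat subn0.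
  by apply: a_init; rewrite ltn_subLR ?ltn_add2r// (leq_trans _ (leq_addl _ _)).
have -> : \sum_(i <= j < i + k) a (j + m - i)
    = \sum_(0 <= j < k) a (j + i + m - i).
  by rewrite -{1}(add0n i) big_addn addKn.
by apply: ler_sum => j _; rewrite addnAC addnK.
Qed.

Lemma sum_window_growth k :
  \sum_(0 <= j < k) \sum_(1 <= i < m.+1) (sg (j + m - i).+1 - sg (j + m - i))
    <= m%:R * sg (k + m).
Proof.
rewrite exchange_big/=.
have -> : m%:R * sg (k + m) = \sum_(1 <= i < m.+1) sg (k + m).
  by rewrite sumr_const_nat subn1/= mulr_natl.
rewrite big_nat_cond [leRHS]big_nat_cond.
apply: ler_sum => i /andP[/andP[i1 im] _].
rewrite (eq_bigr (fun j => sg (j.+1 + (m - i)) - sg (j + (m - i)))) => [|j _].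
  rewrite (telescope_sumr (fun j => sg (j + (m - i))))// add0n.
  rewrite lerBlDr (@le_trans _ _ (sg (k + m)))//.
    by rewrite growth_le// leq_add2l leq_subr.
  by rewrite lerDl ltW// growth_gt0.
by rewrite addSn addnBA.
Qed.

End GrowthSequences.

(** * Runs of the algorithm *)

Section Run.
Context (R : realType) (p n m : nat).
Hypotheses (hp : (1 <= p)%N) (hm : (1 <= m)%N).
Context (sigma0 theta1 : R).
Hypotheses (hsigma0 : 0 < sigma0) (htheta1 : 0 <= theta1).
Context (f : 'rV[R]_n -> R) (d : measure_display) (T : measurableType d)
  (P : probability T R).
Context (X : nat -> T -> 'rV[R]_n) (A : forall i : nat, nat -> T -> tensor R n i)
  (Sigma : nat -> T -> R) (S : nat -> T -> 'rV[R]_n).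
Hypothesis hrun : StOFFAR p f sigma0 theta1 X A Sigma S.
Hypothesis hC : class_C p f.
Context (Lp : R) (hLp : 0 < Lp).
Hypothesis hlip : forall x y,
  tnorm (dtensor f p x - dtensor f p y) <= Lp * enorm (x - y).
Context (khigh : R) (hkhigh : 0 <= khigh).
Hypothesis hhigh : forall i k w, (2 <= i <= p)%N ->
  forall v : 'rV[R]_n, enorm v <= 1 -> - khigh <= tpow (A i k w) v.
Context (kD : R) (hkD : 0 <= kD).
Hypothesis herr : forall k i, (1 <= i <= p)%N ->
  condexp_le P (past p A k)
    (fun w => tnorm (dtensor f i (X k w) - A i k w)
                `^ (p.+1%:R / (p + 1 - i)%:R))
    (fun w => kD * xi p m S k w).

Local Notation q := (p.+1%:R / p%:R : R).
Local Notation fact1 := ((p.+1)`!%:R : R).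

Definition approx_error (i k : nat) (w : T) : R :=
  tensor_error p f (fun i => A i k w) (X k w) i.

(* The weights and the powers of the step norms with indices shifted by m, so
   that the conventions for negative indices fill the first m entries. *)
Definition weight (w : T) (t : nat) : R :=
  if (t < m)%N then sigma0 / 2 ^+ (m - t) else Sigma (t - m) w.

Definition step_power (w : T) (t : nat) : R :=
  if (t < m)%N then 1 else enorm (S (t - m) w) ^+ p.+1.

Local Notation u w t := (relative_increment (weight w) t).

Lemma weight_shift w k : weight w (k + m) = Sigma k w.
Proof. by rewrite /weight ltnNge leq_addl/= addnK. Qed.

Lemma step_power_shift w k : step_power w (k + m) = enorm (S k w) ^+ p.+1.
Proof. by rewrite /step_power ltnNge leq_addl/= addnK. Qed.

Lemma weight_init w t : (t <= m)%N -> weight w t = sigma0 / 2 ^+ (m - t).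
Proof.
rewrite leq_eqVlt => /orP[/eqP ->|tm]; last by rewrite /weight tm.
by rewrite /weight ltnn subnn (initial_weight hrun) expr0 divr1.
Qed.

Lemma weight_succ w t :
  weight w t.+1 = weight w t + weight w t * step_power w t.
Proof.
have [tm|mt] := ltnP t m.
  rewrite !weight_init ?(ltnW tm)// /step_power tm mulr1.
  rewrite -(subnSK tm) exprS invfM; set c := _ ^+ _.
  by have c0 : c != 0 by [rewrite expf_neq0]; field.
by rewrite -(subnK mt) -addSn !weight_shift step_power_shift (next_weight hrun).
Qed.

Lemma step_power_ge0 w t : 0 <= step_power w t.
Proof. by rewrite /step_power; case: ifP => // _; rewrite exprn_ge0// enorm_ge0. Qed.

Lemma step_power_init w t : (t < m)%N -> step_power w t = 1.
Proof. by rewrite /step_power => ->. Qed.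

Lemma xiE k w : xi p m S k w = \sum_(1 <= i < m.+1) step_power w (k + m - i).
Proof.
rewrite /xi big_nat_cond [RHS]big_nat_cond.
apply: eq_bigr => i /andP[/andP[i1]]; rewrite ltnS => im _.
rewrite /past_step_norm /step_power; have [ik|ki] := leqP i k.
  rewrite ltn_subLR ?ltn_add2r; last by rewrite (leq_trans im)// leq_addl.
  by rewrite ltnNge ik/= addnC -addnBA// addKn.
rewrite expr1n ltn_subLR ?ltn_add2r ?ki//.
by rewrite (leq_trans _ (leq_addl _ _)).
Qed.

Lemma Sigma_ge k w : sigma0 <= Sigma k w.
Proof.
rewrite -(weight_shift w k) -[leLHS](growth_m (weight_init w)).
by apply: (growth_le hsigma0 (weight_init w) (weight_succ w) (step_power_ge0 w));
  exact: leq_addl.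
Qed.

Lemma Sigma_gt0 k w : 0 < Sigma k w.
Proof. exact: lt_le_trans hsigma0 (Sigma_ge k w). Qed.

Lemma Sigma_le k k' w : (k <= k')%N -> Sigma k w <= Sigma k' w.
Proof.
move=> kk'; rewrite -!(weight_shift w).
apply: (growth_le hsigma0 (weight_init w) (weight_succ w) (step_power_ge0 w)).
by rewrite leq_add2r.
Qed.

Lemma past_measurable k : past p A k `<=` measurable.
Proof.
move=> _ [i [j [J [B [ip jk mB ->]]]]]; rewrite -[_ @^-1` _]setTI.
exact: (approximations_measurable hrun j J ip measurableT mB).
Qed.

Lemma rv_ge0_Sigma k : rv_ge0 (Sigma k).
Proof.
have mS := measurable_wrt (@past_measurable k) (weight_measurable hrun (k := k)).
by split => [//|w]; exact/ltW/Sigma_gt0.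
Qed.

Lemma rv_ge0_weight t : rv_ge0 (fun w => weight w t).
Proof.
have [tm|mt] := ltnP t m.
  under eq_fun do rewrite /weight tm.
  by apply: rv_ge0_cst; rewrite divr_ge0// ltW.
rewrite -(subnK mt); under eq_fun do rewrite weight_shift.
exact: rv_ge0_Sigma.
Qed.

Lemma rv_ge0_step_power t : rv_ge0 (fun w => step_power w t).
Proof.
have [tm|mt] := ltnP t m.
  under eq_fun do rewrite /step_power tm.
  exact: rv_ge0_cst.
rewrite -(subnK mt); under eq_fun do rewrite step_power_shift.
apply: rv_ge0_exprn; split; last by move=> w; exact: enorm_ge0.
have -> : (fun w => enorm (S (t - m) w))
    = fun w => (\sum_(j < n) S (t - m)%N w 0 j ^+ 2) `^ 2^-1.
  by apply/funext => w; rewrite powR12_sqrt// sumr_ge0// => j _; exact: sqr_ge0.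
apply: (rv_ge0_powR _ _).1; apply: measurable_sum => j; apply: measurable_funX.
exact: (measurable_wrt (@past_measurable _) (step_measurable hrun j (ltnSn (t - m)))).
Qed.

Lemma rv_ge0_relative_increment t : rv_ge0 (fun w => u w t).
Proof.
under eq_fun do rewrite (relative_incrementE hsigma0 (weight_init _)
  (weight_succ _) (step_power_ge0 _)).
apply: rv_ge0_mul; first apply: rv_ge0_mul.
- exact: rv_ge0_weight.
- exact: rv_ge0_step_power.
- by apply: rv_ge0_inv; exact: rv_ge0_weight.
Qed.

Lemma rv_ge0_weight_increment t : rv_ge0 (fun w => weight w t.+1 - weight w t).
Proof.
under eq_fun do rewrite weight_succ addrAC subrr add0r.
by apply: rv_ge0_mul; [exact: rv_ge0_weight|exact: rv_ge0_step_power].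
Qed.

(** * Weighted means of the approximation errors *)

Lemma rv_ge0_approx_error i k : (1 <= i <= p)%N -> rv_ge0 (approx_error i k).
Proof. by move=> /(herr k)[Z [[mY Y0] _ _ _] _]; split. Qed.

Lemma rv_ge0_Sigma_powV k b : rv_ge0 (fun w => (Sigma k w `^ b)^-1).
Proof. by apply/rv_ge0_inv/rv_ge0_powR; case: (rv_ge0_Sigma k). Qed.

Lemma rv_ge0_window (g : T -> nat -> R) k :
  (forall t, rv_ge0 (fun w => g w t)) ->
  rv_ge0 (fun w => \sum_(1 <= i < m.+1) g w (k + m - i)%N).
Proof. by move=> hg; apply: rv_ge0_sum => i _; exact: hg. Qed.

(** The divisor is a power of [Sigma k], which is measurable with respect to the past and can
    therefore be moved inside the conditional bound. *)
Lemma approx_error_mean i k b : (1 <= i <= p)%N ->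
  mean_le P (fun w => approx_error i k w * (Sigma k w `^ b)^-1)
    (fun w => kD * (\sum_(1 <= i < m.+1) step_power w (k + m - i)
                      / Sigma k w `^ b)).
Proof.
move=> ip; have hxi : rv_ge0 (fun w => kD * xi p m S k w).
  apply: rv_ge0_scale => //.
  rewrite (_ : xi p m S k = fun w => \sum_(1 <= i < m.+1) step_power w (k + m - i)).
    exact/rv_ge0_window/rv_ge0_step_power.
  by apply/funext => w; exact: xiE.
have hw : wrt (past p A k) (fun w => (Sigma k w `^ b)^-1).
  apply: (rv_ge0_inv _).1; apply: rv_ge0_powR.
  exact: (weight_measurable hrun (k := k)).
have := condexp_le_mul (@past_measurable k) (herr k ip) hxi hw.
move=> /(_ (rv_ge0_Sigma_powV k b).2).
have -> : (fun w => kD * xi p m S k w * (Sigma k w `^ b)^-1) =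
    fun w => kD * (\sum_(1 <= i < m.+1) step_power w (k + m - i)
                      / Sigma k w `^ b).
  by apply/funext => w; rewrite xiE -mulrA mulr_suml.
exact.
Qed.

Lemma approx_error_mean0 i k : (1 <= i <= p)%N ->
  mean_le P (approx_error i k)
    (fun w => kD * \sum_(1 <= i < m.+1) step_power w (k + m - i)).
Proof.
move=> ip; have := approx_error_mean k 0 ip.
under eq_fun do rewrite powRr0 invr1 mulr1.
have -> : (fun w => kD * (\sum_(1 <= i < m.+1) step_power w (k + m - i)
    / Sigma k w `^ 0)) =
    (fun w => kD * \sum_(1 <= i < m.+1) step_power w (k + m - i)).
  by apply/funext => w; rewrite -mulr_suml powRr0 invr1 mulr1.
exact.
Qed.

Lemma window_index i k : (1 <= i < m.+1)%N -> (k + m - i < k + m)%N.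
Proof.
move=> /andP[i1 im]; rewrite ltn_subrL i1 (leq_trans (hm : (0 < m)%N))//.
exact: leq_addl.
Qed.

Lemma approx_error_mean_q i k : (1 <= i <= p)%N ->
  mean_le P (fun w => approx_error i k w / Sigma k w `^ q)
    (fun w => kD * (2 ^+ m / sigma0 `^ q
                    * \sum_(1 <= i < m.+1) u w (k + m - i))).
Proof.
move=> ip; apply: mean_le_trans (approx_error_mean k q ip) _.
have [_ h _] := approx_error_mean k q ip.
apply: mean_le_pointwise => //.
  apply: rv_ge0_scale => //; apply: rv_ge0_scale.
    by rewrite divr_ge0 ?powR_ge0 ?exprn_ge0.
  apply: (@rv_ge0_window (fun w t => u w t)).
  exact: rv_ge0_relative_increment.
move=> w; rewrite ler_wpM2l// mulr_sumr big_nat_cond [leRHS]big_nat_cond.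
apply: ler_sum => j /andP[jm _]; rewrite -weight_shift.
apply: (increment_div_powq hp hsigma0 (weight_init w) (weight_succ w)
  (step_power_ge0 w)).
  exact: window_index.
exact: leq_addl.
Qed.

Lemma approx_error_mean_p i k : (1 <= i <= p)%N ->
  mean_le P (fun w => approx_error i k w / Sigma k w `^ p%:R^-1)
    (fun w => kD * (2 ^+ m / sigma0 `^ q
       * \sum_(1 <= i < m.+1) (weight w (k + m - i).+1 - weight w (k + m - i)))).
Proof.
move=> ip; apply: mean_le_trans (approx_error_mean k p%:R^-1 ip) _.
have [_ h _] := approx_error_mean k p%:R^-1 ip.
apply: mean_le_pointwise => //.
  apply: rv_ge0_scale => //; apply: rv_ge0_scale.
    by rewrite divr_ge0 ?powR_ge0 ?exprn_ge0.
  apply: (@rv_ge0_window (fun w t => weight w t.+1 - weight w t)).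
  exact: rv_ge0_weight_increment.
move=> w; rewrite ler_wpM2l// mulr_sumr big_nat_cond [leRHS]big_nat_cond.
apply: ler_sum => j /andP[jm _]; rewrite -[in leLHS](weight_shift w k).
apply: (increment_div_powp hp hsigma0 (weight_init w) (weight_succ w)
  (step_power_ge0 w)).
  exact: window_index.
exact: leq_addl.
Qed.

(** At iteration 0 the whole window is conventional, so [xi] is the constant [m]; this is the origin
    of the term m kD in [kappa_e]. *)
Lemma approx_error_mean_start : mean_le P
  (fun w => approx_error 1 0 w / sigma0 `^ q) (cst (kD * m%:R / sigma0 `^ q)).
Proof.
have p1 : (1 <= 1 <= p)%N by rewrite hp.
have := mean_le_scale (_ : 0 <= (sigma0 `^ q)^-1) (approx_error_mean0 0 p1).
under eq_fun do rewrite mulrC.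
rewrite invr_ge0 powR_ge0 => /(_ isT).
have -> : (fun w => (sigma0 `^ q)^-1
    * (kD * \sum_(1 <= i < m.+1) step_power w (0 + m - i)))
  = cst (kD * m%:R / sigma0 `^ q).
  apply/funext => w /=; rewrite mulrC; congr (_ * _ / _).
  rewrite big_nat_cond (eq_bigr (fun=> 1)) => [|i /andP[im _]].
    by rewrite -big_nat_cond sumr_const_nat subn1.
  by rewrite step_power_init//; have := window_index 0 im.
exact.
Qed.

Lemma grad_error_mean (g h : T -> R) k :
  (forall i, (1 <= i <= p)%N ->
     mean_le P (fun w => approx_error i k w * g w) h) ->
  mean_le P
    (fun w => grad_error p f (fun i => A i k w) (X k w) * g w)
    (fun w => chi4 R p * h w).
Proof.
move=> H; rewrite /chi4.
have -> : (fun w => grad_error p f (fun i => A i k w) (X k w) * g w) = fun w =>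
    approx_error 1 k w * g w + \sum_(2 <= i < p.+1)
     ((p - i + 1)%:R / ((i - 1)`!%:R * p%:R)) `^ q * (approx_error i k w * g w).
  apply/funext => w; rewrite /grad_error mulrDl mulr_suml; congr (_ + _).
  by apply: eq_bigr => i _; rewrite mulrA.
have -> : (fun w => (1 + \sum_(2 <= i < p.+1)
    ((p - i + 1)%:R / ((i - 1)`!%:R * p%:R)) `^ q) * h w) = fun w =>
    h w + \sum_(2 <= i < p.+1)
     ((p - i + 1)%:R / ((i - 1)`!%:R * p%:R)) `^ q * h w.
  by apply/funext => w; rewrite mulrDl mul1r mulr_suml.
apply: mean_le_add; first by apply: H; rewrite hp.
apply: mean_le_sum => i; rewrite mem_index_iota => /andP[i2 ip].
apply: mean_le_scale; first exact: powR_ge0.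
by apply: H; rewrite ltnW.
Qed.

Lemma theta1_ratio_ge0 : 0 <= theta1 `^ q / p`!%:R `^ q.
Proof. by rewrite divr_ge0 ?powR_ge0. Qed.

(** * Gradients scaled by powers of the weights *)

Hypothesis hV0 : rv_ge0 (fun w => enorm (grad f (X 0%N w)) `^ q).

(* The gradient of f at X k is not assumed to be measurable for k > 0: this
   measurable majorant of |G_k|^q replaces it in all the means. *)
Definition grad_bound (k : nat) (w : T) : R :=
  if k is j.+1 then 2 `^ p%:R^-1 *
    (kappa_b p Lp * enorm (S j w) ^+ p.+1
     + kappa_p R p * grad_error p f (fun i => A i j w) (X j w)
     + theta1 `^ q / p`!%:R `^ q * (Sigma j w `^ q * enorm (S j w) ^+ p.+1))
  else enorm (grad f (X 0%N w)) `^ q.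

Lemma grad_le_bound k w : enorm (grad f (X k w)) `^ q <= grad_bound k w.
Proof.
case: k => // k; rewrite (next_point hrun) /=.
apply: next_grad_powR => //; first exact: ltW.
  exact/ltW/Sigma_gt0.
exact: (step_gradient hrun).
Qed.

Lemma rv_ge0_grad_error k :
  rv_ge0 (fun w => grad_error p f (fun i => A i k w) (X k w)).
Proof.
apply: rv_ge0_add; first by apply: (rv_ge0_approx_error (i := 1)); rewrite hp.
apply: rv_ge0_sum => i; rewrite mem_index_iota => /andP[i2 ip].
apply: rv_ge0_scale; first exact: powR_ge0.
by apply: (rv_ge0_approx_error (i := i)); rewrite ltnW.
Qed.

Lemma rv_ge0_step k : rv_ge0 (fun w => enorm (S k w) ^+ p.+1).
Proof. by under eq_fun do rewrite -step_power_shift; exact: rv_ge0_step_power. Qed.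

Lemma kappa_p_ge0 : 0 <= kappa_p R p. Proof. exact: powR_ge0. Qed.

Lemma chi3_ge0 : 0 <= chi3 R p.
Proof. by apply: sumr_ge0 => i _; exact: powR_ge0. Qed.

Lemma chi4_ge0 : 0 <= chi4 R p.
Proof. by rewrite addr_ge0// sumr_ge0// => i _; exact: powR_ge0. Qed.

Lemma kappa_b_ge0 : 0 <= kappa_b p Lp.
Proof. by rewrite mulr_ge0 ?kappa_p_ge0// addr_ge0 ?powR_ge0// chi3_ge0. Qed.

Lemma rv_ge0_grad_bound k : rv_ge0 (grad_bound k).
Proof.
case: k => // k /=; apply: rv_ge0_scale; first exact: powR_ge0.
apply: rv_ge0_add; first apply: rv_ge0_add.
- by apply: rv_ge0_scale; [exact: kappa_b_ge0|exact: rv_ge0_step].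
- by apply: rv_ge0_scale; [exact: kappa_p_ge0|exact: rv_ge0_grad_error].
- apply: rv_ge0_scale; first exact: theta1_ratio_ge0.
  apply: rv_ge0_mul; last exact: rv_ge0_step.
  by apply: rv_ge0_powR; case: (rv_ge0_Sigma k).
Qed.

Local Notation ge k w := (grad_error p f (fun i => A i k w) (X k w)).
Local Notation kc := (kappa_c p sigma0 theta1 Lp).
Local Notation kd := (kappa_d p m sigma0 kD).

Lemma kappa_c_gt0 : 0 < kc.
Proof.
have s0 : 0 < sigma0 `^ q by rewrite powR_gt0.
have kb0 : 0 < kappa_b p Lp.
  rewrite /kappa_b mulr_gt0 ?powR_gt0 ?mulr_gt0 ?ltr0n//.
  by apply: ltr_wpDr; rewrite ?chi3_ge0// powR_gt0// divr_gt0// ltr0n fact_gt0.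
rewrite /kappa_c mulr_gt0//; first by rewrite divr_gt0 ?powR_gt0.
by apply: ltr_wpDr => //; rewrite mulr_ge0 ?powR_ge0// theta1_ratio_ge0.
Qed.

Lemma kappa_c_ge0 : 0 <= kc. Proof. exact/ltW/kappa_c_gt0. Qed.

Lemma kappa_dE : kd = 2 `^ p%:R^-1 * kappa_p R p * chi4 R p * kD
  * (2 ^+ m / sigma0 `^ q).
Proof.
rewrite /kappa_d mulrDl mulfK ?pnatr_eq0 -?lt0n// mul1r.
rewrite powRD ?pnatr_eq0 ?implybT// powR_mulrn//; ring.
Qed.

Lemma kappa_d_ge0 : 0 <= kd.
Proof.
by rewrite kappa_dE !mulr_ge0 ?invr_ge0 ?powR_ge0 ?exprn_ge0 ?chi4_ge0.
Qed.

Lemma kappa_cE : kc = 2 `^ p%:R^-1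
  * (kappa_b p Lp * (sigma0 `^ q)^-1 + theta1 `^ q / p`!%:R `^ q).
Proof.
have s0 : sigma0 `^ q != 0 by rewrite gt_eqF ?powR_gt0.
rewrite /kappa_c; move: (theta1 `^ q / p`!%:R `^ q) => t.
by field.
Qed.

(** Common to the divisors of exponents q and 1/p: [x] is the inverse of the divisor, [U] the
    relative or the absolute increment, and [y] the error scaled by the earlier weight. *)
Lemma combine_bounds (t kb kp tau si a b g x y U : R) :
  0 <= t -> 0 <= kb -> 0 <= kp -> 0 <= tau ->
  a * x <= si * U -> b * x <= U -> g * x <= y ->
  t * (kb * a + kp * g + tau * b) * x <= t * (kb * si + tau) * U + t * kp * y.
Proof.
move=> t0 kb0 kp0 tau0 /(ler_wpM2l kb0) h1 /(ler_wpM2l tau0) h2 /(ler_wpM2l kp0) h3.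
rewrite -!mulrA -mulrDr ler_wpM2l// !mulrDl -!mulrA; lra.
Qed.

Lemma grad_bound_div_q k w : grad_bound k.+1 w / Sigma k.+1 w `^ q <=
  kc * u w (k + m) + 2 `^ p%:R^-1 * kappa_p R p * (ge k w / Sigma k w `^ q).
Proof.
have mk : (m <= k + m)%N by exact: leq_addl.
have h1 := increment_div_powq_succ hp hsigma0 (weight_init w) (weight_succ w)
  (step_power_ge0 w) mk.
have h2 := weighted_increment_div_powq hp hsigma0 (weight_init w)
  (weight_succ w) (step_power_ge0 w) (k + m).
rewrite step_power_shift -addSn weight_shift in h1.
rewrite step_power_shift -addSn !weight_shift in h2.
(* The divisor is lowered to a power of [Sigma k] because the conditional bounds admit only
   multipliers known from the past. *)
have h3 : ge k w / Sigma k.+1 w `^ q <= ge k w / Sigma k w `^ q.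
  rewrite ler_wpM2l ?(rv_ge0_grad_error k).2// lef_pV2 ?posrE ?powR_gt0 ?Sigma_gt0//.
  by rewrite ge0_ler_powR ?nnegrE ?divr_ge0 ?(ltW (Sigma_gt0 _ _))// Sigma_le.
rewrite kappa_cE; apply: combine_bounds h1 h2 h3.
- exact: powR_ge0.
- exact: kappa_b_ge0.
- exact: kappa_p_ge0.
- exact: theta1_ratio_ge0.
Qed.

Lemma grad_bound_div_p k w : grad_bound k.+1 w / Sigma k.+1 w `^ p%:R^-1 <=
  kc * (Sigma k.+1 w - Sigma k w)
  + 2 `^ p%:R^-1 * kappa_p R p * (ge k w / Sigma k w `^ p%:R^-1).
Proof.
have mk : (m <= k + m)%N by exact: leq_addl.
have h1 := increment_div_powp_succ hp hsigma0 (weight_init w) (weight_succ w)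
  (step_power_ge0 w) mk.
have h2 := weighted_increment_div_powp hp hsigma0 (weight_init w)
  (weight_succ w) (step_power_ge0 w) (k + m).
rewrite step_power_shift -addSn !weight_shift in h1.
rewrite step_power_shift -addSn !weight_shift in h2.
have h3 : ge k w / Sigma k.+1 w `^ p%:R^-1 <= ge k w / Sigma k w `^ p%:R^-1.
  rewrite ler_wpM2l ?(rv_ge0_grad_error k).2// lef_pV2 ?posrE ?powR_gt0 ?Sigma_gt0//.
  by rewrite ge0_ler_powR ?nnegrE ?invr_ge0 ?(ltW (Sigma_gt0 _ _))// Sigma_le.
rewrite kappa_cE; apply: combine_bounds h1 h2 h3.
- exact: powR_ge0.
- exact: kappa_b_ge0.
- exact: kappa_p_ge0.
- exact: theta1_ratio_ge0.
Qed.

(** * The sum of the step powers, in mean *)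

Local Notation et := (Defs.eta p sigma0 khigh).
Local Notation c1 := (1 + 2 ^+ p.+1 * et ^+ p.+1 : R).
Local Notation C := (2 ^+ p.+1 * fact1 `^ q * 2 `^ p%:R^-1 : R).

Lemma eta_ge0 : 0 <= et. Proof. exact: bigmax_ge_id. Qed.

Lemma c1_ge0 : 0 <= c1.
Proof. by rewrite addr_ge0// mulr_ge0 ?exprn_ge0// eta_ge0. Qed.

Lemma C_ge0 : 0 <= C. Proof. by rewrite !mulr_ge0 ?exprn_ge0 ?powR_ge0. Qed.

(** In [x = U + U * x] the bound on [x] is inserted once: the constant [E] keeps the factor [U],
    while [B] gives it up because [U] is at most 1. *)
Lemma absorb_increment (x U E B : R) : 0 <= U -> U <= 1 -> 0 <= B ->
  x = U * (1 + x) -> x <= E + B -> x <= (1 + E) * U + B.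
Proof.
move=> U0 U1 B0 xE /(ler_wpM2l U0) h; have : U * B <= B by rewrite ler_piMl.
by move: h; rewrite {2}xE; lra.
Qed.

Lemma step_le k w : enorm (S k w) ^+ p.+1 <= c1 * u w (k + m)
  + C * ((grad_bound k w + approx_error 1 k w) / Sigma k w `^ q).
Proof.
have H := step_length_bound hp (ltW hLp) (ltW (Sigma_gt0 k w))
  (step_decrease hrun k w) hsigma0 (Sigma_ge k w) hkhigh
  (fun i ip => hhigh k w ip).
have s0 : 0 < Sigma k w `^ q by rewrite powR_gt0 ?Sigma_gt0.
set a := enorm (S k w) ^+ p.+1 in H *.
set B := (grad_bound k w + approx_error 1 k w) / Sigma k w `^ q.
have B0 : 0 <= B.
  rewrite divr_ge0 ?(ltW s0)// addr_ge0//; first exact: (rv_ge0_grad_bound k).2.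
  by apply: (rv_ge0_approx_error k _).2; rewrite hp.
have H' : a <= 2 ^+ p.+1 * et ^+ p.+1 + C * B.
  apply: le_trans H _; rewrite lerD2l -[leRHS]mulrA ler_wpM2l//.
  rewrite ler_wpM2l ?powR_ge0// ler_wpM2r ?invr_ge0 ?powR_ge0//.
  by rewrite lerD2r grad_le_bound.
have u0 := relative_increment_ge0 hsigma0 (weight_init w) (weight_succ w)
  (step_power_ge0 w) (k + m).
have u1 := relative_increment_le1 hsigma0 (weight_init w) (weight_succ w)
  (step_power_ge0 w) (k + m).
have aE := increment_split hsigma0 (weight_init w) (weight_succ w)
  (step_power_ge0 w) (k + m).
rewrite step_power_shift -/a in aE.
by apply: absorb_increment aE H' => //; rewrite mulr_ge0// C_ge0.
Qed.

Definition window_u (w : T) (k : nat) : R := \sum_(1 <= i < m.+1) u w (k + m - i).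

(** Term [j] of the last sum accounts for iteration [j.+1]: its gradient, bounded through step [j],
    and its first-order error, bounded through the window of [j.+1]. Iteration 0 stands apart, with
    the initial gradient and a conventional window. *)
Definition step_sum_bound (k : nat) (w : T) : R :=
  c1 * \sum_(0 <= j < k.+1) u w (j + m)
  + C * (grad_bound 0 w / sigma0 `^ q + kD * m%:R / sigma0 `^ q
         + \sum_(0 <= j < k) (kc * u w (j + m) + kd * window_u w j
              + kD * (2 ^+ m / sigma0 `^ q * window_u w j.+1))).

Lemma grad_bound_div_q_mean k :
  mean_le P (fun w => grad_bound k.+1 w / Sigma k.+1 w `^ q)
    (fun w => kc * u w (k + m) + kd * window_u w k).
Proof.
have kpos : 0 <= 2 `^ p%:R^-1 * kappa_p R p by rewrite mulr_ge0 ?powR_ge0.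
have hu : rv_ge0 (fun w => kc * u w (k + m)).
  by apply: rv_ge0_scale; [exact: kappa_c_ge0|exact: rv_ge0_relative_increment].
have hg : rv_ge0 (fun w => 2 `^ p%:R^-1 * kappa_p R p * (ge k w / Sigma k w `^ q)).
  apply: rv_ge0_scale => //; apply: rv_ge0_mul; first exact: rv_ge0_grad_error.
  exact: rv_ge0_Sigma_powV.
apply: (@mean_le_trans _ _ _ _ (fun w => kc * u w (k + m)
  + 2 `^ p%:R^-1 * kappa_p R p * (ge k w / Sigma k w `^ q))).
  apply: mean_le_pointwise; last exact: grad_bound_div_q.
    apply: rv_ge0_mul; first exact: rv_ge0_grad_bound.
    exact: rv_ge0_Sigma_powV.
  exact: rv_ge0_add.
apply: mean_le_add; first exact: mean_le_refl.
have -> : (fun w => kd * window_u w k) = fun w =>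
    2 `^ p%:R^-1 * kappa_p R p * (chi4 R p * (kD * (2 ^+ m / sigma0 `^ q
                    * \sum_(1 <= i < m.+1) u w (k + m - i)))).
  by apply/funext => w; rewrite kappa_dE /window_u; ring.
apply: mean_le_scale => //; apply: grad_error_mean => i ip.
exact: approx_error_mean_q.
Qed.

Lemma step_sum_mean k :
  mean_le P (fun w => \sum_(0 <= j < k.+1) enorm (S j w) ^+ p.+1)
    (step_sum_bound k).
Proof.
have hB j : rv_ge0 (fun w =>
    (grad_bound j w + approx_error 1 j w) / Sigma j w `^ q).
  apply: rv_ge0_mul; last exact: rv_ge0_Sigma_powV.
  apply: rv_ge0_add; first exact: rv_ge0_grad_bound.
  by apply: rv_ge0_approx_error; rewrite hp.
have hu : rv_ge0 (fun w => c1 * \sum_(0 <= j < k.+1) u w (j + m)).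
  apply: rv_ge0_scale; first exact: c1_ge0.
  by apply: rv_ge0_sum => j _; exact: rv_ge0_relative_increment.
apply: (@mean_le_trans _ _ _ _ (fun w => c1 * \sum_(0 <= j < k.+1) u w (j + m)
   + C * \sum_(0 <= j < k.+1)
        ((grad_bound j w + approx_error 1 j w) / Sigma j w `^ q))).
  apply: mean_le_pointwise.
  - by apply: rv_ge0_sum => j _; exact: rv_ge0_step.
  - apply: rv_ge0_add => //; apply: rv_ge0_scale; first exact: C_ge0.
    by apply: rv_ge0_sum => j _; exact: hB.
  - by move=> w; rewrite !mulr_sumr -big_split/=; apply: ler_sum => j _; exact: step_le.
apply: mean_le_add; first exact: mean_le_refl.
apply: mean_le_scale; first exact: C_ge0.
under eq_fun do rewrite big_nat_recl//.
have p1 : (1 <= 1 <= p)%N by rewrite hp.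
apply: mean_le_add.
  under eq_fun do rewrite (initial_weight hrun) mulrDl.
  apply: mean_le_add; last exact: approx_error_mean_start.
  apply: mean_le_refl; apply: rv_ge0_mul; first exact: rv_ge0_grad_bound.
  by apply: rv_ge0_cst; rewrite invr_ge0 powR_ge0.
apply: mean_le_sum => j _.
under eq_fun do rewrite mulrDl.
apply: mean_le_add; first exact: grad_bound_div_q_mean.
exact: approx_error_mean_q.
Qed.

(** * A bound affine in the logarithm of the weight *)

Context (EG0 Gamma0 flow : R).
Hypothesis hflow : forall x, flow <= f x.
Hypothesis hEG0 : mean_le P (fun w => enorm (grad f (X 0%N w)) `^ q) (cst EG0).
Hypothesis hGamma0 : mean_le P (fun w => f (X 0%N w) - flow) (cst Gamma0).

Local Notation sq := (sigma0 `^ q).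
Local Notation z := (2 `^ p%:R^-1 : R).
Local Notation mR := (m%:R : R).

Let sq_gt0 : 0 < sq. Proof. exact: powR_gt0. Qed.

Lemma mean_le_cst_le (g : T -> R) (a b : R) :
  mean_le P g (cst a) -> a <= b -> mean_le P g (cst b).
Proof.
move=> ga ab; apply: mean_le_trans (ga) _; case: ga => _ ha _.
apply: mean_le_pointwise => //; split; first exact: measurable_cst.
by move=> w; apply: le_trans (ha.2 w) ab.
Qed.

(* Here l stands for the logarithm of Sigma / sigma0, which dominates the sum of
   the relative increments, and v for |G_0|^q. *)
Definition affine_bound (l v : R) : R :=
  c1 * l + C * (v / sq + kD * mR / sq
    + (kc * l + kd * (mR * l + mR * (mR + 1) / 2 * ln 2)
       + kD * (2 ^+ m / sq * (mR * l + mR * (mR - 1) / 2 * ln 2)))).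

Lemma m_ge1 : 1 <= mR. Proof. by rewrite (ler_nat R 1). Qed.

Lemma ln2_ge0 : 0 <= ln 2 :> R.
Proof. by rewrite ln_ge0// ler1n. Qed.

Lemma affine_bound_mean (l : T -> R) (l' : R) : mean_le P l (cst l') ->
  mean_le P (fun w => affine_bound (l w) (grad_bound 0 w))
    (cst (affine_bound l' EG0)).
Proof.
move=> hl; have m1 := m_ge1; have l2 := ln2_ge0.
pose slope := c1 + C * (kc + kd * mR + kD * (2 ^+ m / sq * mR)).
pose base := C * (kD * mR / sq + kd * (mR * (mR + 1) / 2 * ln 2)
  + kD * (2 ^+ m / sq * (mR * (mR - 1) / 2 * ln 2))).
have E x v : affine_bound x v = slope * x + (C / sq * v + base).
  by rewrite /affine_bound /slope /base; ring.
have kc0 := kappa_c_ge0; have kd0 := kappa_d_ge0.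
have e0 : 0 <= 2 ^+ m / sq by rewrite divr_ge0 ?exprn_ge0 ?(ltW sq_gt0).
have slope0 : 0 <= slope.
  rewrite addr_ge0 ?c1_ge0// mulr_ge0 ?C_ge0// !addr_ge0//.
    by rewrite mulr_ge0.
  by rewrite mulr_ge0// mulr_ge0.
have base0 : 0 <= base.
  rewrite mulr_ge0 ?C_ge0// !addr_ge0//.
  - by rewrite divr_ge0 ?mulr_ge0// ltW.
  - by rewrite mulr_ge0// mulr_ge0// divr_ge0// mulr_ge0// addr_ge0.
  - rewrite mulr_ge0// mulr_ge0// mulr_ge0// divr_ge0// mulr_ge0// subr_ge0//.
have Cs0 : 0 <= C / sq by rewrite divr_ge0 ?C_ge0 ?(ltW sq_gt0).
under eq_fun do rewrite E; rewrite E.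
apply: mean_le_add; first exact: (mean_le_scale slope0 hl).
apply: mean_le_add; first exact: (mean_le_scale Cs0 hEG0).
exact/mean_le_refl/rv_ge0_cst.
Qed.

Lemma window_u_le k w : window_u w k <= mR.
Proof.
have -> : mR = \sum_(1 <= i < m.+1) 1 by rewrite sumr_const_nat subn1.
apply: ler_sum => i _.
exact: (relative_increment_le1 hsigma0 (weight_init w) (weight_succ w)
  (step_power_ge0 w)).
Qed.

Lemma rv_ge0_step_sum_bound k : rv_ge0 (step_sum_bound k).
Proof. by case: (step_sum_mean k). Qed.

(** Every relative increment is at most 1. The constant grows linearly with [k] and serves to prove
    that the weight has a finite mean. *)
Lemma step_sum_bound_const k : exists K, mean_le P (step_sum_bound k) (cst K).
Proof.
have u1 w t := relative_increment_le1 hsigma0 (weight_init w) (weight_succ w)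
  (step_power_ge0 w) t.
pose D := kD * mR / sq + k%:R * (kc + kd * mR + kD * (2 ^+ m / sq * mR)).
have e0 : 0 <= 2 ^+ m / sq by rewrite divr_ge0 ?exprn_ge0 ?(ltW sq_gt0).
have D0 : 0 <= D.
  apply: addr_ge0; first by rewrite divr_ge0 ?mulr_ge0 ?(ltW sq_gt0).
  apply: mulr_ge0 => //; apply: addr_ge0; last by rewrite mulr_ge0// mulr_ge0.
  exact: addr_ge0 kappa_c_ge0 (mulr_ge0 kappa_d_ge0 (ler0n _ _)).
have Cs0 : 0 <= C / sq by rewrite divr_ge0 ?C_ge0 ?(ltW sq_gt0).
have K0 : 0 <= c1 * k.+1%:R + C * D.
  by rewrite addr_ge0 ?mulr_ge0// ?c1_ge0 ?C_ge0.
exists (C / sq * EG0 + (c1 * k.+1%:R + C * D)).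
apply: (@mean_le_trans _ _ _ _ (fun w =>
    C / sq * grad_bound 0 w + (c1 * k.+1%:R + C * D))).
  apply: mean_le_pointwise; first exact: rv_ge0_step_sum_bound.
    apply: rv_ge0_add; last exact: rv_ge0_cst.
    by apply: rv_ge0_scale => //; exact: (rv_ge0_grad_bound 0).
  move=> w; rewrite /step_sum_bound.
  have h1 : \sum_(0 <= j < k.+1) u w (j + m) <= k.+1%:R.
    have -> : k.+1%:R = \sum_(0 <= j < k.+1) 1 :> R by rewrite sumr_const_nat subn0.
    by apply: ler_sum.
  have h2 : \sum_(0 <= j < k) (kc * u w (j + m) + kd * window_u w j
        + kD * (2 ^+ m / sq * window_u w j.+1))
      <= k%:R * (kc + kd * mR + kD * (2 ^+ m / sq * mR)).
    set e := kc + _ + _.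
    have -> : k%:R * e = \sum_(0 <= j < k) e by rewrite sumr_const_nat subn0 mulr_natl.
    rewrite /e; apply: ler_sum => j _.
    apply: lerD; first apply: lerD.
    - by rewrite ler_piMr ?kappa_c_ge0.
    - by rewrite ler_wpM2l ?kappa_d_ge0// window_u_le.
    - by rewrite ler_wpM2l// ler_wpM2l// window_u_le.
  have h3 := ler_wpM2l c1_ge0 h1.
  have h4 : C * (grad_bound 0 w / sq + kD * mR / sq
       + \sum_(0 <= j < k) (kc * u w (j + m) + kd * window_u w j
              + kD * (2 ^+ m / sq * window_u w j.+1)))
      <= C / sq * grad_bound 0 w + C * D.
    have E (c v e : R) : c / sq * v + c * e = c * (v / sq + e) by ring.
    by rewrite E ler_wpM2l ?C_ge0// /D -addrA lerD2l lerD2l.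
  lra.
apply: mean_le_add; first exact: (mean_le_scale Cs0 hEG0).
exact/mean_le_refl/rv_ge0_cst.
Qed.

Lemma step_sum_bound_ln k w :
  step_sum_bound k w
    <= affine_bound (ln (Sigma k.+1 w / sigma0)) (grad_bound 0 w).
Proof.
have e0 : 0 <= 2 ^+ m / sq by rewrite divr_ge0 ?exprn_ge0 ?(ltW sq_gt0).
have u0 t := relative_increment_ge0 hsigma0 (weight_init w) (weight_succ w)
  (step_power_ge0 w) t.
set l := ln _.
have hl : ln (Sigma k w / sigma0) <= l.
  rewrite ler_ln ?posrE ?divr_gt0 ?Sigma_gt0// ler_pM2r ?invr_gt0//.
  exact: Sigma_le.
have h1 : \sum_(0 <= j < k.+1) u w (j + m) <= l.
  apply: le_trans (sum_relative_increment hsigma0 (weight_init w)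
    (weight_succ w) (step_power_ge0 w) _ _) _.
  by rewrite weight_shift (growth_m (weight_init w)) /l ln_div ?posrE ?Sigma_gt0.
have h1' : \sum_(0 <= j < k) u w (j + m) <= l.
  by apply: le_trans h1; rewrite big_nat_recr//= lerDl.
have h2 : \sum_(0 <= j < k) window_u w j <= mR * l + mR * (mR + 1) / 2 * ln 2.
  apply: le_trans (sum_window_relative_increment hsigma0 (weight_init w)
    (weight_succ w) (step_power_ge0 w) _) _.
  by rewrite lerD2r weight_shift ler_wpM2l.
have h3 : \sum_(0 <= j < k) window_u w j.+1 <= mR * l + mR * (mR - 1) / 2 * ln 2.
  apply: le_trans (sum_window_relative_increment_succ hsigma0 (weight_init w)
    (weight_succ w) (step_power_ge0 w) _) _.
  by rewrite lerD2r weight_shift ler_wpM2l.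
rewrite /step_sum_bound /affine_bound; apply: lerD.
  by rewrite ler_wpM2l ?c1_ge0.
rewrite ler_wpM2l ?C_ge0// lerD2l !big_split/= -!mulr_sumr.
apply: lerD; first apply: lerD.
- by rewrite ler_wpM2l ?kappa_c_ge0.
- by rewrite ler_wpM2l ?kappa_d_ge0.
- by rewrite ler_wpM2l// ler_wpM2l.
Qed.

Local Notation ke := (kappa_e p m sigma0 theta1 Lp khigh kD EG0).
Local Notation kf := (kappa_f p m sigma0 theta1 Lp khigh kD).

(** With z = 2^(1/p), the error terms carry 2^m z, whereas [kappa_e] and [kappa_f] carry 2^m z^2.
    The difference of the two sides is this slack, with the factor z (z - 1), and it is nonnegative
    because z and [m] are at least 1. *)
Lemma affine_bound_le (l : R) : 0 <= l ->
  affine_bound l EG0 <= ke + kf * (l + ln sigma0).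
Proof.
move=> l0; have m1 := m_ge1; have l2 := ln2_ge0.
have z1 : 1 <= z by rewrite -[leLHS](powRr0 2) ler_powR ?invr_ge0// ler1n.
have zE : 2 `^ ((mR * p%:R + 2) / p%:R) = 2 ^+ m * (z * z) :> R.
  rewrite -powRD ?pnatr_eq0 ?implybT// -powR_mulrn// -powRD ?pnatr_eq0 ?implybT//; congr (_ `^ _).
  by rewrite mulrDl mulfK ?pnatr_eq0 -?lt0n// mulrDl mul1r.
rewrite -subr_ge0.
have -> : ke + kf * (l + ln sigma0) - affine_bound l EG0 =
    2 ^+ p.+1 * fact1 `^ q * (kD * mR * 2 ^+ m / sq * z * (z - 1)
      * ((mR - 1) / 2 * ln 2 + l)).
  rewrite /kappa_e /kappa_f /affine_bound zE kappa_dE.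
  move: (ln sigma0) (kappa_c _ _ _ _) (chi4 _ _) (kappa_p _ _) (_ `^ q) (ln 2)
    (2 `^ _) (2 ^+ p.+1) (2 ^+ m) (Defs.eta _ _ _ ^+ p.+1) sq_gt0
    => ls k1 x4 kp F L2 zz pp mm ee; move: sq => s s0.
  by field; rewrite gt_eqF.
apply: mulr_ge0; first by rewrite mulr_ge0 ?exprn_ge0 ?powR_ge0.
apply: mulr_ge0; last first.
  by rewrite addr_ge0// mulr_ge0// divr_ge0// subr_ge0.
apply: mulr_ge0; last by rewrite subr_ge0.
apply: mulr_ge0; last exact: powR_ge0.
apply: divr_ge0; last exact: powR_ge0.
by rewrite mulr_ge0 ?exprn_ge0// mulr_ge0.
Qed.

(** * The mean of the weights *)

Lemma chi1_ge0 : 0 <= chi1 R p.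
Proof. by apply: sumr_ge0 => i _; rewrite divr_ge0// mulr_ge0. Qed.

Lemma chi2_ge0 : 0 <= chi2 R p.
Proof. by apply: sumr_ge0 => i _; rewrite divr_ge0// mulr_ge0. Qed.

Lemma fact1_gt0 : 0 < fact1. Proof. by rewrite ltr0n fact_gt0. Qed.

Lemma kappa_a_gt0 : 0 < kappa_a p Lp.
Proof. by rewrite ltr_pwDl ?chi1_ge0// divr_gt0 ?fact1_gt0. Qed.

Lemma kappa_f_ge1 : 1 <= kf.
Proof.
have C0 : 0 <= 2 ^+ p.+1 * fact1 `^ q by rewrite mulr_ge0 ?exprn_ge0 ?powR_ge0.
have k0 : 0 <= 2 `^ p%:R^-1 * kc by rewrite mulr_ge0 ?powR_ge0 ?kappa_c_ge0.
have x0 : 0 <= 1 + chi4 R p * kappa_p R p.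
  by rewrite addr_ge0// mulr_ge0 ?chi4_ge0 ?kappa_p_ge0.
rewrite /kappa_f -addrA lerDl; apply: addr_ge0.
  by rewrite mulr_ge0 ?exprn_ge0 ?eta_ge0.
apply: (mulr_ge0 C0); apply: addr_ge0 k0; apply: divr_ge0; last exact: powR_ge0.
by rewrite mulr_ge0// mulr_ge0// mulr_ge0 ?powR_ge0.
Qed.

(** The regularization term in [value_decrease] is the increment of the weight divided by (p+1)!, so
    the values of [f] and the weights telescope together. *)
Lemma value_telescope k w :
  f (X k w) + Sigma k w / fact1 <= f (X 0%N w) + sigma0 / fact1
    + kappa_a p Lp * \sum_(0 <= j < k) enorm (S j w) ^+ p.+1
    + \sum_(0 <= j < k) \sum_(1 <= i < p.+1)
        (p + i - 1)%:R / (i`!%:R * p.+1%:R) * approx_error i j w.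
Proof.
elim: k => [|k IH].
  by rewrite !big_nil mulr0 !addr0 (initial_weight hrun).
have H := value_decrease hp hC (ltW hLp) hlip (ltW (Sigma_gt0 k w))
  (step_decrease hrun k w).
rewrite -(next_point hrun) in H.
rewrite [X in kappa_a p Lp * X]big_nat_recr//= [X in _ <= _ + X]big_nat_recr//=.
rewrite [kappa_a p Lp * (_ + _)]mulrDr (next_weight hrun) [X in _ + X <= _]mulrDl.
rewrite mulrAC in H; rewrite /approx_error; lra.
Qed.

Lemma weight_mean k : mean_le P (fun w => Sigma k.+1 w / fact1)
  (fun w => (f (X 0%N w) - flow) + sigma0 / fact1
    + kappa_a p Lp * (\sum_(0 <= j < k.+1) enorm (S j w) ^+ p.+1)
    + chi2 R p * (kD * (mR * (mR + 1) / 2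
                  + mR * \sum_(0 <= j < k.+1) enorm (S j w) ^+ p.+1))).
Proof.
have hs : rv_ge0 (fun w => \sum_(0 <= j < k.+1) enorm (S j w) ^+ p.+1).
  by apply: rv_ge0_sum => j _; exact: rv_ge0_step.
have F0 := ltW fact1_gt0.
have hb : rv_ge0 (fun w => (f (X 0%N w) - flow) + sigma0 / fact1
    + kappa_a p Lp * (\sum_(0 <= j < k.+1) enorm (S j w) ^+ p.+1)).
  apply: rv_ge0_add; first apply: rv_ge0_add.
  - by case: hGamma0.
  - by apply: rv_ge0_cst; rewrite divr_ge0// ltW.
  - by apply: rv_ge0_scale => //; exact/ltW/kappa_a_gt0.
pose c i : R := (p + i - 1)%:R / (i`!%:R * p.+1%:R).
have c0 i : 0 <= c i by rewrite divr_ge0// mulr_ge0.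
have hE j : rv_ge0 (fun w => \sum_(1 <= i < p.+1) c i * approx_error i j w).
  apply: rv_ge0_sum => i; rewrite mem_index_iota => ip.
  by apply: rv_ge0_scale => //; exact: rv_ge0_approx_error.
apply: (@mean_le_trans _ _ _ _ (fun w => (f (X 0%N w) - flow) + sigma0 / fact1
    + kappa_a p Lp * (\sum_(0 <= j < k.+1) enorm (S j w) ^+ p.+1)
    + \sum_(0 <= j < k.+1) \sum_(1 <= i < p.+1) c i * approx_error i j w)).
  apply: mean_le_pointwise.
  - apply: rv_ge0_mul; first exact: rv_ge0_Sigma.
    by apply: rv_ge0_cst; rewrite invr_ge0.
  - by apply: rv_ge0_add => //; apply: rv_ge0_sum => j _; exact: hE.
  - by move=> w; have := value_telescope k.+1 w; have := hflow (X k.+1 w); rewrite /c; lra.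
apply: mean_le_add; first exact: mean_le_refl.
pose win w j : R := \sum_(1 <= i < m.+1) step_power w (j + m - i).
have hwin j : rv_ge0 (fun w => win w j).
  by apply: rv_ge0_window; exact: rv_ge0_step_power.
apply: (@mean_le_trans _ _ _ _ (fun w => \sum_(0 <= j < k.+1) chi2 R p * (kD * win w j))).
  apply: mean_le_sum => j _; rewrite /chi2.
  under [X in mean_le _ _ X]eq_fun do rewrite mulr_suml.
  apply: mean_le_sum => i; rewrite mem_index_iota => ip.
  by apply: mean_le_scale => //; exact: approx_error_mean0.
apply: mean_le_pointwise.
- apply: rv_ge0_sum => j _; apply: rv_ge0_scale; first exact: chi2_ge0.
  exact: rv_ge0_scale.
- apply: rv_ge0_scale; first exact: chi2_ge0.
  apply: rv_ge0_scale => //; apply: rv_ge0_add; last exact: rv_ge0_scale.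
  by apply: rv_ge0_cst; rewrite divr_ge0// mulr_ge0// addr_ge0.
- move=> w; rewrite -!mulr_sumr ler_wpM2l ?chi2_ge0// ler_wpM2l//.
  apply: le_trans (sum_window_increment (step_power_ge0 w) (@step_power_init w) _) _.
  by under eq_bigr do rewrite step_power_shift.
Qed.

Local Notation kaf := (kappa_af p m sigma0 theta1 Lp khigh kD).
Local Notation smax := (sigma_max p m sigma0 theta1 Lp khigh kD EG0 Gamma0).

Lemma kappa_af_gt0 : 0 < kaf.
Proof.
have kf0 : 0 < kf by apply: lt_le_trans kappa_f_ge1.
by rewrite /kappa_af ltr_pwDl ?mulr_gt0 ?kappa_a_gt0// !mulr_ge0 ?chi2_ge0// ltW.
Qed.

Lemma weight_mean_le k : mean_le P (Sigma k.+1) (cst smax).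
Proof.
have F0 := fact1_gt0; have ka0 := ltW kappa_a_gt0; have x20 := chi2_ge0.
have scaleF : (fun w => fact1 * (Sigma k.+1 w / fact1)) = Sigma k.+1.
  by apply/funext => w; rewrite mulrC divfK// gt_eqF.
(* Used twice: a crude constant M makes the mean y of Sigma finite, after
   which Jensen's inequality allows M to be affine in ln y. *)
have bound M : mean_le P
    (fun w => \sum_(0 <= j < k.+1) enorm (S j w) ^+ p.+1) (cst M) ->
    mean_le P (Sigma k.+1) (cst (fact1 * (Gamma0 + sigma0 / fact1
      + kappa_a p Lp * M + chi2 R p * (kD * (mR * (mR + 1) / 2 + mR * M))))).
  move=> hM; rewrite -scaleF; apply: (mean_le_scale (ltW F0)).
  apply: mean_le_trans (weight_mean k) _.
  apply: mean_le_add; first apply: mean_le_add; first apply: mean_le_add.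
  - exact: hGamma0.
  - by apply/mean_le_refl/rv_ge0_cst; rewrite divr_ge0// ltW.
  - exact: (mean_le_scale ka0 hM).
  - apply: (mean_le_scale x20); apply: (mean_le_scale hkD); apply: mean_le_add.
      by apply/mean_le_refl/rv_ge0_cst; rewrite divr_ge0// mulr_ge0// addr_ge0.
    exact: (mean_le_scale _ hM).
have [K hK] := step_sum_bound_const k.
have hfin := mean_le_cst (bound K (mean_le_trans (step_sum_mean k) hK)).
have hS := rv_ge0_Sigma k.+1.
have int0 : (0 <= \int[P]_w (Sigma k.+1 w)%:E)%E.
  by apply: integral_ge0 => w _; rewrite lee_fin hS.2.
have fin : (\int[P]_w (Sigma k.+1 w)%:E)%E \is a fin_num.
  by rewrite ge0_fin_numE// (le_lt_trans hfin)// ltry.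
set y := fine (\int[P]_w (Sigma k.+1 w)%:E)%E.
have yE : (\int[P]_w (Sigma k.+1 w)%:E = y%:E)%E by rewrite fineK.
have y0 : 0 <= y by rewrite fine_ge0.
have hy : mean_le P (Sigma k.+1) (cst y).
  by apply: mean_le_cstP => //; rewrite yE.
have sy : sigma0 <= y.
  rewrite -lee_fin -yE -(integral_cstT P) ge0_le_integral_nonmeasurable// => w.
    by rewrite lee_fin ltW.
  by rewrite lee_fin Sigma_ge.
have y_gt0 : 0 < y by apply: lt_le_trans sy.
have hln := jensen_ln hsigma0 (Sigma_ge k.+1) hS.1 hy.
have l0 : 0 <= ln (y / sigma0) by rewrite ln_ge0// ler_pdivlMr// mul1r.
have hM : mean_le P (fun w => \sum_(0 <= j < k.+1) enorm (S j w) ^+ p.+1)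
    (cst (ke + kf * ln y)).
  apply: mean_le_trans (step_sum_mean k) _.
  apply: (@mean_le_cst_le _ (affine_bound (ln (y / sigma0)) EG0)).
    apply: mean_le_trans (affine_bound_mean hln).
    apply: mean_le_pointwise; first exact: rv_ge0_step_sum_bound.
      by case: (affine_bound_mean hln).
    by move=> w; exact: step_sum_bound_ln.
  by have := affine_bound_le l0; rewrite ln_div ?posrE// subrK.
have := mean_le_cst (bound _ hM); rewrite yE lee_fin => Hy.
apply: mean_le_cst_le hy _.
apply: lambertWm1_bound => //; first by rewrite mulr_gt0 ?kappa_af_gt0.
apply: le_trans Hy _; rewrite -[leRHS]mulrA ler_wpM2l ?(ltW F0)//.
(* [kappa_g] is the part without [ln y] divided by [kappa_af], the coefficient of [ln y]; the two
   sides are equal. *)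
rewrite [leRHS]mulrDr /kappa_g [X in _ <= X + _]mulrC divfK ?gt_eqF ?kappa_af_gt0//.
rewrite le_eqVlt; apply/orP; left; apply/eqP.
rewrite /kappa_af; move: (sigma0 / fact1) (kappa_a _ _) ke kf (chi2 _ _) (ln y).
by move=> s ka e f' x2 ly; ring.
Qed.

(** * From scaled gradients to the mean gradient norm *)

Local Notation alpha := (p%:R / p.+1%:R : R).
Local Notation scaled_bound j w :=
  (grad_bound j.+1 w / Sigma j.+1 w `^ p%:R^-1).

Lemma rv_ge0_scaled_bound j : rv_ge0 (fun w => scaled_bound j w).
Proof.
apply: rv_ge0_mul; first exact: rv_ge0_grad_bound.
exact: rv_ge0_Sigma_powV.
Qed.

Lemma scaled_bound_mean k : mean_le P (fun w => scaled_bound k w)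
  (fun w => kc * (Sigma k.+1 w - Sigma k w)
    + kd * \sum_(1 <= i < m.+1) (weight w (k + m - i).+1 - weight w (k + m - i))).
Proof.
have kpos : 0 <= 2 `^ p%:R^-1 * kappa_p R p by rewrite mulr_ge0 ?powR_ge0.
have hS : rv_ge0 (fun w => kc * (Sigma k.+1 w - Sigma k w)).
  apply: rv_ge0_scale; first exact: kappa_c_ge0.
  by under eq_fun do rewrite -!weight_shift; exact: rv_ge0_weight_increment.
have hg : rv_ge0 (fun w =>
    2 `^ p%:R^-1 * kappa_p R p * (ge k w / Sigma k w `^ p%:R^-1)).
  apply: rv_ge0_scale => //; apply: rv_ge0_mul; first exact: rv_ge0_grad_error.
  exact: rv_ge0_Sigma_powV.
apply: (@mean_le_trans _ _ _ _ (fun w => kc * (Sigma k.+1 w - Sigma k w)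
  + 2 `^ p%:R^-1 * kappa_p R p * (ge k w / Sigma k w `^ p%:R^-1))).
  apply: mean_le_pointwise; last exact: grad_bound_div_p.
    exact: rv_ge0_scaled_bound.
  exact: rv_ge0_add.
apply: mean_le_add; first exact: mean_le_refl.
have -> : (fun w => kd * \sum_(1 <= i < m.+1)
    (weight w (k + m - i).+1 - weight w (k + m - i))) = fun w =>
    2 `^ p%:R^-1 * kappa_p R p * (chi4 R p * (kD * (2 ^+ m / sigma0 `^ q
       * \sum_(1 <= i < m.+1) (weight w (k + m - i).+1 - weight w (k + m - i))))).
  by apply/funext => w; rewrite kappa_dE; move: (\sum_(1 <= i < m.+1) _) => e; ring.
apply: mean_le_scale => //; apply: grad_error_mean => i ip.
exact: approx_error_mean_p.
Qed.

(** The increments of the weights telescope once for the current step and once for each of the [m]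
    shifts of the window, each time to at most [Sigma k.+1]; hence the factor [kc + kd * mR]. *)
Lemma sum_scaled_bound_mean k :
  mean_le P (fun w => \sum_(0 <= j < k.+1) scaled_bound j w)
    (cst ((kc + kd * mR) * smax)).
Proof.
have K0 : 0 <= kc + kd * mR.
  exact: addr_ge0 kappa_c_ge0 (mulr_ge0 kappa_d_ge0 (ler0n _ _)).
apply: (@mean_le_trans _ _ _ _ (fun w => (kc + kd * mR) * Sigma k.+1 w));
  last exact: mean_le_scale (weight_mean_le k).
apply: (@mean_le_trans _ _ _ _ (fun w => \sum_(0 <= j < k.+1)
    (kc * (Sigma j.+1 w - Sigma j w) + kd * \sum_(1 <= i < m.+1)
        (weight w (j + m - i).+1 - weight w (j + m - i))))).
  by apply: mean_le_sum => j _; exact: scaled_bound_mean.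
apply: mean_le_pointwise.
- by apply: rv_ge0_sum => j _; case: (scaled_bound_mean j).
- exact: (rv_ge0_scale K0 (rv_ge0_Sigma _)).
- move=> w; rewrite big_split/= -!mulr_sumr mulrDl; apply: lerD.
    rewrite ler_wpM2l ?kappa_c_ge0// (telescope_sumr (fun j => Sigma j w))//.
    by rewrite gerBl ltW// Sigma_gt0.
  rewrite -mulrA ler_wpM2l ?kappa_d_ge0//.
  rewrite -(weight_shift w k.+1); apply: sum_window_growth hsigma0
    (weight_init w) (weight_succ w) (step_power_ge0 w) _.
Qed.

(** Positivity is read off from sigma0 <= E[Sigma_1] <= sigma_max, not from the formula with the
    Lambert function. *)
Lemma sigma_max_gt0 : 0 < smax.
Proof.
apply: lt_le_trans hsigma0 _; rewrite -lee_fin -(integral_cstT P).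
apply: le_trans (mean_le_cst (weight_mean_le 0)).
apply: ge0_le_integral_nonmeasurable => w; first by rewrite lee_fin ltW.
by rewrite lee_fin Sigma_ge.
Qed.

Lemma exists_small_scaled_bound k : exists j : 'I_k.+1,
  mean_le P (fun w => scaled_bound j w) (cst ((kc + kd * mR) * smax / k.+1%:R)).
Proof.
set M := (kc + kd * mR) * smax.
have M0 : 0 <= M.
  rewrite mulr_ge0 ?(ltW sigma_max_gt0)//.
  exact: addr_ge0 kappa_c_ge0 (mulr_ge0 kappa_d_ge0 (ler0n _ _)).
pose I (j : 'I_k.+1) := (\int[P]_w (scaled_bound j w)%:E)%E.
have I0 j : (0 <= I j)%E.
  by apply: integral_ge0 => w _; rewrite lee_fin (rv_ge0_scaled_bound j).2.
have sumI : (\sum_j I j <= M%:E)%E.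
  have := mean_le_cst (sum_scaled_bound_mean k); rewrite -/M.
  under eq_integral do rewrite big_mkord -sumEFin.
  rewrite ge0_integral_sum// => j; last by move=> w; rewrite lee_fin (rv_ge0_scaled_bound j).2.
  by apply/measurable_EFinP; case: (rv_ge0_scaled_bound j).
have Ifin j : I j \is a fin_num.
  rewrite ge0_fin_numE//; apply: le_lt_trans (ltry M).
  by apply: le_trans sumI; rewrite (bigD1 j)//= leeDl// sume_ge0.
have [j _ jmin] := @arg_minP _ R _ ord0 xpredT (fun j => fine (I j)) isT.
exists j; apply: mean_le_cstP; first exact: rv_ge0_scaled_bound.
  by rewrite divr_ge0.
rewrite -/(I j) -(fineK (Ifin j)) lee_fin ler_pdivlMr ?ltr0n//.
rewrite -lee_fin; apply: le_trans sumI.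
rewrite (eq_bigr (fun j => (fine (I j))%:E)) => [|j' _]; last by rewrite fineK.
rewrite sumEFin lee_fin mulr_natr.
have -> : fine (I j) *+ k.+1 = \sum_(i < k.+1) fine (I j).
  by rewrite sumr_const card_ord.
by apply: ler_sum => j' _; exact: jmin.
Qed.

(* Weighted AM-GM replaces Hölder's inequality for the factors
   |G| / Sigma^(1/(p+1)) and Sigma^(1/(p+1)). *)
Lemma grad_integral_le j (v : R) : 0 < v ->
  mean_le P (fun w => scaled_bound j w) (cst v) ->
  (\int[P]_w (enorm (grad f (X j.+1 w)))%:E
     <= (v `^ alpha * smax `^ (1 - alpha))%:E)%E.
Proof.
move=> v0 hv; have s0 := sigma_max_gt0.
have p0 : 0 < p%:R :> R by rewrite ltr0n.
have p1 : 0 < p.+1%:R :> R by rewrite ltr0n.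
have a01 : 0 < alpha < 1.
  by rewrite divr_gt0//= ltr_pdivrMr// mul1r ltr_nat.
have [a0 a1] := andP a01.
set c := v `^ alpha * smax `^ (1 - alpha).
have c0 : 0 <= c by rewrite mulr_ge0 ?powR_ge0.
have b0 : 0 <= alpha / v by rewrite divr_ge0 ?ltW.
have d0 : 0 <= (1 - alpha) / smax by rewrite divr_ge0 ?subr_ge0 ?ltW.
(* Divided by [v] and [smax], the two variables have means at most 1, so the weights [alpha] and
   [1 - alpha] add up and the mean of [B] is at most [c]. *)
pose B w := c * (alpha / v * scaled_bound j w + (1 - alpha) / smax * Sigma j.+1 w).
have hB : mean_le P B (cst (c * (alpha / v * v + (1 - alpha) / smax * smax))).
  apply: (mean_le_scale c0); apply: mean_le_add.
    exact: (mean_le_scale b0 hv).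
  exact: (mean_le_scale d0 (weight_mean_le j)).
have cE : c * (alpha / v * v + (1 - alpha) / smax * smax) = c.
  by rewrite !divfK ?gt_eqF// addrCA subrr addr0 mulr1.
rewrite -cE; apply: le_trans (mean_le_cst hB).
apply: ge0_le_integral_nonmeasurable => w; rewrite lee_fin ?enorm_ge0//.
have Sg0 := Sigma_gt0 j.+1 w.
set W := scaled_bound j w; have W0 : 0 <= W := (rv_ge0_scaled_bound j).2 w.
have qa : q * alpha = 1 by field; rewrite !gt_eqF.
have -> : enorm (grad f (X j.+1 w)) = (enorm (grad f (X j.+1 w)) `^ q) `^ alpha.
  by rewrite -powRrM qa powRr1// enorm_ge0.
apply: (@le_trans _ _ (grad_bound j.+1 w `^ alpha)).
  rewrite ge0_ler_powR ?(ltW a0) ?nnegrE ?powR_ge0 ?grad_le_bound//.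
  exact: (rv_ge0_grad_bound _).2.
have -> : grad_bound j.+1 w = W * Sigma j.+1 w `^ p%:R^-1.
  by rewrite /W divfK// gt_eqF ?powR_gt0.
rewrite powRM ?powR_ge0// -powRrM.
have -> : p%:R^-1 * alpha = 1 - alpha.
  by rewrite -natr1; field; rewrite natr1 !gt_eqF.
have -> : W = v * (W / v) by rewrite mulrC divfK ?gt_eqF.
have {1}-> : Sigma j.+1 w = smax * (Sigma j.+1 w / smax).
  by rewrite mulrC divfK ?gt_eqF.
have Wv0 : 0 <= W / v by rewrite divr_ge0 ?(ltW v0).
have Ss0 : 0 <= Sigma j.+1 w / smax by rewrite divr_ge0 ?(ltW Sg0) ?(ltW s0).
rewrite (powRM _ (ltW v0) Wv0) (powRM _ (ltW s0) Ss0) mulrACA.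
apply: le_trans (ler_wpM2l c0 (weighted_am_gm a01 Wv0 Ss0)) _.
rewrite /B -/W le_eqVlt; apply/orP; left; apply/eqP; congr (c * _).
rewrite (mulrCA alpha) (mulrCA (1 - alpha)).
by rewrite !(mulrC _ W) !(mulrC _ (Sigma j.+1 w)).
Qed.

End Run.

Unset Implicit Arguments.
Set Strict Implicit.
Set Printing Implicit Defensive.

Theorem theorem3p8 (R : realType) (p n m : nat)
    (hp : (1 <= p)%N) (hn : (1 <= n)%N) (hm : (1 <= m)%N)
    (sigma0 theta1 : R) (hsigma0 : 0 < sigma0) (htheta1 : 1 < theta1)
    (f : 'rV[R]_n -> R)
    (d : measure_display) (T : measurableType d) (P : probability T R)
    (X : nat -> T -> 'rV[R]_n)
    (A : forall i : nat, nat -> T -> tensor R n i)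
    (Sigma : nat -> T -> R) (S : nat -> T -> 'rV[R]_n)
    (hrun : StOFFAR p f sigma0 theta1 X A Sigma S)
    (hfX0 : P.-integrable setT (fun w => (f (X 0%N w))%:E))
    (hG0 : P.-integrable setT
       (fun w => (enorm (grad f (X 0%N w)) `^ (p.+1%:R / p%:R))%:E))
    (hC : class_C p f)
    (flow : R) (hflow : forall x, flow <= f x)
    (Lp : R) (hLp : 3 <= Lp)
    (hlip : forall x y,
       tnorm (dtensor f p x - dtensor f p y) <= Lp * enorm (x - y))
    (khigh : R) (hkhigh : 0 <= khigh) (hkhigh1 : p = 1%N -> khigh = 0)
    (hhigh : forall i k w, (2 <= i <= p)%N ->
       forall v : 'rV[R]_n, enorm v <= 1 -> - khigh <= tpow (A i k w) v)
    (kD : R) (hkD : 0 <= kD)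
    (herr : forall k i, (1 <= i <= p)%N ->
       condexp_le P (past p A k)
         (fun w => tnorm (dtensor f i (X k w) - A i k w)
                     `^ (p.+1%:R / (p + 1 - i)%:R))
         (fun w => kD * xi p m S k w)) :
  forall k : nat,
    (\big[Order.min/+oo]_(j < k.+1) 'E_P[fun w => enorm (grad f (X j.+1 w))]
     <= ((kappa_c p sigma0 theta1 Lp + kappa_d p m sigma0 kD * m%:R)
            `^ (p%:R / p.+1%:R)
         * (sigma_max p m sigma0 theta1 Lp khigh kD
              (fine 'E_P[fun w => (enorm (grad f (X 0%N w))
                                     `^ (p.+1%:R / p%:R))%R])
              (fine 'E_P[fun w => (f (X 0%N w) - flow)%R])
            / k.+1%:R `^ (p%:R / p.+1%:R)))%R%:E)%E.
Proof.
move=> k; set q := p.+1%:R / p%:R; set kc := kappa_c _ _ _ _.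
set kd := kappa_d _ _ _ _; set EG0 := fine _; set Gamma0 := fine _.
set smax := sigma_max _ _ _ _ _ _ _ _ _.
have hLp0 : 0 < Lp by apply: lt_le_trans hLp.
have hth0 : 0 <= theta1 by apply/ltW/(lt_trans _ htheta1).
have hV0 : rv_ge0 (fun w => enorm (grad f (X 0%N w)) `^ q).
  split=> [|w]; last exact: powR_ge0.
  by apply/measurable_EFinP; exact: measurable_int hG0.
have hEG0 : mean_le P (fun w => enorm (grad f (X 0%N w)) `^ q) (cst EG0).
  have int0 : (0 <= \int[P]_w (enorm (grad f (X 0%N w)) `^ q)%:E)%E.
    by apply: integral_ge0 => w _; rewrite lee_fin powR_ge0.
  apply: mean_le_cstP => //; rewrite /EG0 unlock; first by rewrite fine_ge0.
  by rewrite fineK// integrable_fin_num.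
have hf : P.-integrable setT (fun w => (f (X 0%N w) - flow)%:E).
  under eq_fun do rewrite EFinB.
  by apply: integrableB => //; exact: finite_measure_integrable_cst.
have hGamma0 : mean_le P (fun w => f (X 0%N w) - flow) (cst Gamma0).
  have int0 : (0 <= \int[P]_w (f (X 0%N w) - flow)%:E)%E.
    by apply: integral_ge0 => w _; rewrite lee_fin subr_ge0.
  apply: mean_le_cstP.
  - split=> [|w]; last by rewrite subr_ge0.
    by apply/measurable_EFinP; exact: measurable_int hf.
  - by rewrite /Gamma0 unlock fine_ge0.
  - by rewrite /Gamma0 unlock fineK// integrable_fin_num.
have s0 : 0 < smax.
  exact: (sigma_max_gt0 hp hm hsigma0 hth0 hrun hC hLp0 hlip hkhigh hhigh hkD
    herr hV0 hflow hEG0 hGamma0).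
have [j hj] := exists_small_scaled_bound hp hm hsigma0 hth0 hrun hC hLp0 hlip
  hkhigh hhigh hkD herr hV0 hflow hEG0 hGamma0 k.
have kc0 : 0 < kc + kd * m%:R.
  apply: ltr_wpDr; first by rewrite mulr_ge0 ?ler0n ?(kappa_d_ge0 m hp sigma0 hkD).
  have := kappa_c_gt0 hp theta1 hsigma0 hLp0.
  exact: id.
have k0 : 0 < k.+1%:R :> R by rewrite ltr0n.
have v0 : 0 < (kc + kd * m%:R) * smax / k.+1%:R by rewrite divr_gt0 ?mulr_gt0.
apply: (bigmin_inf j) => //; rewrite unlock.
apply: le_trans (grad_integral_le hp hm hsigma0 hth0 hrun hC hLp0 hlip hkhigh
  hhigh hkD herr hV0 hflow hEG0 hGamma0 v0 hj) _.
rewrite lee_fin -/smax; set a := p%:R / p.+1%:R.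
(* The exponents [a] from the scaled gradient and [1 - a] from the weight add up to 1, so [smax]
   enters the rate to the first power. *)
have smaxE : smax `^ a * smax `^ (1 - a) = smax.
  by rewrite -powRD ?(gt_eqF s0) ?implybT// addrC subrK powRr1 ?(ltW s0).
rewrite powRM ?invr_ge0 ?mulr_ge0 ?(ltW kc0) ?(ltW s0)//.
rewrite powRM ?(ltW kc0) ?(ltW s0)//.
have -> : k.+1%:R^-1 `^ a = (k.+1%:R `^ a)^-1.
  by rewrite -powR_inv1// powRAC -powR_inv1 ?powR_ge0.
by rewrite mulrAC -(mulrA _ (smax `^ a)) smaxE mulrA.
Qed.
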